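(* Let $A\in\mathbb{R}^{n\times n}$ with spectral radius $\rho(A)<1$, $C\in\mathbb{R}^{m\times n}$, $Q\in\mathbb{R}^{n\times n}$ symmetric positive semidefinite, $R\in\mathbb{R}^{m\times m}$ symmetric positive definite, and let $\Sigma\geq 0$ be the solution of $\Sigma=A\Sigma A^{\top}+Q$. Consider the process $x_{k+1}=Ax_k+w_k$, $y_k=Cx_k+v_k$ ($k\ge 0$), where $w_k\sim\mathcal N(0,Q)$, $v_k\sim\mathcal N(0,R)$ are i.i.d. and mutually independent, and $x_0\sim\mathcal N(0,\Sigma)$ is independent of them. Let $\eta_k\in\{0,1\}$ be i.i.d. Bernoulli with $\Pr(\eta_k=1)=\lambda\in(0,1]$ and $\zeta_k$ i.i.d. uniform on $[0,1]$, all independent of each other and of $x_0,w,v$. Fix a symmetric positive definite $Y\in\mathbb{R}^{m\times m}$ and let the (open-loop) scheduler be $\varepsilon_k=1$ if $\zeta_k>\exp(-\tfrac12 y_k^{\top}Yy_k)$ and $\varepsilon_k=0$ otherwise. Let $\mathcal I_k$ be the information available to the remote estimator at time $k$, namely $\{\eta_j\}_{j=0}^k$ together with $\varepsilon_j$ and $\varepsilon_j y_j$ for every $j\le k$ with $\eta_j=1$ (when $\eta_j=0$ nothing about $\varepsilon_j$ or $y_j$ is revealed), with $\mathcal I_{-1}=\emptyset$. Let $\hat x_k^-=\mathbb E[x_k\mid\mathcal I_{k-1}]$, $\hat y_k^-=\mathbb E[y_k\mid \mathcal I_{k-1}]$, $\hat x_k=\mathbb E[x_k\mid\mathcal I_k]$,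 and let $P_k^-$, $P_k$ be the covariances of the errors $x_k-\hat x_k^-$ and $x_k-\hat x_k$ conditional on $\mathcal I_{k-1}$ and $\mathcal I_k$ respectively. Then $\hat x_0^-=0$, $P_0^-=\Sigma$, and for all $k\ge 0$: $K_k=\eta_k P_k^-C^{\top}\big(CP_k^-C^{\top}+R+(1-\varepsilon_k)Y^{-1}\big)^{-1}$, $\hat x_k=\hat x_k^-+\varepsilon_kK_ky_k-K_k\hat y_k^-=(I-K_kC)\hat x_k^-+\varepsilon_kK_ky_k$, $P_k=P_k^--K_kCP_k^-$, $\hat x_{k+1}^-=A\hat x_k$, $P_{k+1}^-=AP_kA^{\top}+Q$.
   Context: Throughout the paper $(A,\sqrt Q)$ is assumed stabilizable and $(A,C)$ detectable. When $\eta_k=0$ the gain $K_k$ is zero, so the value of $\varepsilon_k$ in these formulas is irrelevant. *)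

(* Defs.v *)
From HB Require Import structures.
From mathcomp Require Import all_boot all_order all_algebra.
From mathcomp Require Import all_classical all_reals all_analysis.
From mathcomp Require Import complex.

Set Implicit Arguments.
Unset Strict Implicit.
Unset Printing Implicit Defensive.

Import Order.TTheory GRing.Theory Num.Theory.
Local Open Scope ring_scope.
Local Open Scope classical_set_scope.

Definition psd (R : realType) n (M : 'M[R]_n) : Prop :=
  M^T = M /\ forall u : 'cV[R]_n, 0 <= (u^T *m M *m u) ord0 ord0.

Definition pd (R : realType) n (M : 'M[R]_n) : Prop :=
  M^T = M /\ forall u : 'cV[R]_n, u != 0 -> 0 < (u^T *m M *m u) ord0 ord0.

Definition spectral_radius_lt1 (R : realType) n (A : 'M[R]_n) : Prop :=
  forall z : R[i], eigenvalue (map_mx (fun r => (r%:C)%C) A) z -> `|z| < 1.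

Definition sigma_gen (Om : Type) (R : realType) (fs : set (Om -> R)) : set (set Om) :=
  <<s [set S | exists f (B : set R), fs f /\ measurable B /\ S = f @^-1` B] >>.

Definition coords_cV (Om : Type) (R : realType) k (X : Om -> 'cV[R]_k) : set (Om -> R) :=
  [set f | exists i : 'I_k, f = fun w => X w i ord0].

Inductive src := Sx0 | Sw of nat | Sv of nat | Seta of nat | Szeta of nat.

Definition src_enc (s : src) : nat * nat :=
  match s with Sx0 => (0, 0) | Sw k => (1, k) | Sv k => (2, k)
             | Seta k => (3, k) | Szeta k => (4, k) end.
Definition src_dec (p : nat * nat) : option src :=
  match p with
  | (0, _) => Some Sx0 | (1, k) => Some (Sw k) | (2, k) => Some (Sv k)
  | (3, k) => Some (Seta k) | (4, k) => Some (Szeta k) | _ => None end.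
Lemma src_encK : pcancel src_enc src_dec. Proof. by case. Qed.
HB.instance Definition _ := Equality.copy src (pcan_type src_encK).

Definition mutually_independent (R : realType) d (Om : measurableType d)
    (P : probability Om R) (I : eqType) (F : I -> set (set Om)) : Prop :=
  forall (J : seq I) (E : I -> set Om), uniq J ->
    (forall i, i \in J -> F i (E i)) ->
    P (\big[setI/setT]_(i <- J) E i) = (\prod_(i <- J) P (E i))%E.

(* X ~ N(0, S) on R^k, via its characteristic function
   E[exp(i a^T X)] = exp(-a^T S a / 2) (real and imaginary parts) *)
Definition gaussian0 (R : realType) d (Om : measurableType d)
    (P : probability Om R) k (X : Om -> 'cV[R]_k) (S : 'M[R]_k) : Prop :=
  forall a : 'cV[R]_k,
    (\int[P]_w (cos ((a^T *m X w) ord0 ord0))%:E = (expR (- (a^T *m S *m a) ord0 ord0 / 2))%:E)%E /\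
    (\int[P]_w (sin ((a^T *m X w) ord0 ord0))%:E = 0)%E.

Definition uniform01 (R : realType) d (Om : measurableType d)
    (P : probability Om R) (z : Om -> R) : Prop :=
  forall B : set R, measurable B ->
    P (z @^-1` B) = (@lebesgue_measure R) (B `&` `[0, 1]%classic).

Definition cond_exp_version (R : realType) d (Om : measurableType d)
    (P : probability Om R) (G : set (set Om)) (X g : Om -> R) : Prop :=
  (forall B : set R, measurable B -> G (g @^-1` B)) /\
  P.-integrable setT (EFin \o X) /\
  P.-integrable setT (EFin \o g) /\
  (forall S, G S -> (\int[P]_(w in S) (X w)%:E = \int[P]_(w in S) (g w)%:E)%E).

Definition cond_exp_mx (R : realType) d (Om : measurableType d)
    (P : probability Om R) (G : set (set Om)) p q
    (X g : Om -> 'M[R]_(p, q)) : Prop :=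
  forall (i : 'I_p) (j : 'I_q),
    cond_exp_version P G (fun w => X w i j) (fun w => g w i j).

(* info k = sigma(I_{k-1}): generated by eta_j, eta_j*eps_j and
   eta_j*eps_j*y_j for j < k.  So info 0 = sigma(I_{-1}) is trivial and
   info k.+1 = sigma(I_k). *)
Definition info (R : realType) (Om : Type) m
    (eta eps : nat -> Om -> bool) (y : nat -> Om -> 'cV[R]_m) (k : nat)
    : set (set Om) :=
  sigma_gen [set f | exists j, (j < k)%N /\
     (f = (fun w => (eta j w)%:R) \/
      f = (fun w => (eta j w && eps j w)%:R) \/
      exists i : 'I_m, f = fun w => (eta j w && eps j w)%:R * y j w i ord0)].

Definition src_sigma (R : realType) (Om : Type) n m
    (x0 : Om -> 'cV[R]_n) (w : nat -> Om -> 'cV[R]_n)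
    (v : nat -> Om -> 'cV[R]_m) (eta : nat -> Om -> bool)
    (zeta : nat -> Om -> R) (s : src) : set (set Om) :=
  match s with
  | Sx0 => sigma_gen (coords_cV x0)
  | Sw k => sigma_gen (coords_cV (w k))
  | Sv k => sigma_gen (coords_cV (v k))
  | Seta k => sigma_gen [set fun o => ((eta k o)%:R : R)]
  | Szeta k => sigma_gen [set zeta k]
  end.

Definition gain (R : realType) n m (C : 'M[R]_(m, n)) (Rv Y : 'M[R]_m)
    (etak epsk : bool) (Pm : 'M[R]_n) : 'M[R]_(n, m) :=
  (etak%:R) *: (Pm *m C^T *m
     invmx (C *m Pm *m C^T + Rv + (1 - (epsk%:R : R)) *: invmx Y)).

(* Main.v *)
(* Conditionally on the received information, the state is Gaussian; "Gaussian" is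
   expressed throughout by Stein's identity E[h (x - c) f(x)] = E[h M grad f(x)] for
   trigonometric f and bounded information-measurable h, because this form is stable
   under all steps of the filter:
   - the primitive noises satisfy it by differentiating their characteristic functions;
   - adding an independent noise is the product rule (time update);
   - reweighting by exp(-y'Yy/2), the conditional probability of silence, only adds a
     logarithmic-gradient term -M C'Y y, after which the posterior mean and covariance
     come out of linear algebra. The weight is a limit of products of cosines, so no
     Gaussian density is needed and singular covariances are harmless.
   Testing against all h bounded and measurable for the enlarged information reduces, by a
   functional monotone class argument, to cosines of the received y.  Taking f constant
   and f(x) = N sin(x_j / N) with N -> oo identifies the conditional mean and covariance. *)

Require Import Defs.
From HB Require Import structures.
From mathcomp Require Import all_boot all_order all_algebra.
From mathcomp Require Import all_classical all_reals all_analysis.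
From mathcomp Require Import measurable_realfun complex ring lra.
Import Order.TTheory GRing.Theory Num.Theory.
Import numFieldNormedType.Exports.
Local Open Scope ring_scope.
Local Open Scope classical_set_scope.

Set Implicit Arguments.
Unset Strict Implicit.
Unset Printing Implicit Defensive.

(** * Integrable and centred random variables *)

Section Mean.
Context (R : realType) (d : measure_display) (Om : measurableType d)
  (P : probability Om R).
Implicit Types f g h : Om -> R.

(** A direct conditioning argument is blocked because what is learned at time k is not independent
    noise: [eps k] depends on [y k], and [y k] is seen only when [eta k] and [eps k] both hold. The
    proof splits along three disjoint events: no arrival, arrival of a silence, arrival of [y k]. On
    the first two the event itself is all that is learned; on the third all of [y k] is learned.
    Integrating out [zeta k] replaces silence by the weight U = exp(-y'Yy/2) and reception by 1 - U,
    so the identity for reception is needed both with and without the weight U. The inverse of Y in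
    the silent gain appears when y is written as Y^-1 applied to Y y, in order to cancel the
    gradient of U. Sources of randomness enter one at a time, in the order v, zeta, eta, w, each
    independent of everything before it. The recursion is run pathwise through the explicit
    functions [pred_mean] and [pred_cov], whose measurability is proved by induction. The
    conditional expectations of the statement are arbitrary versions, compared with these functions
    almost surely only at the end. *)

Definition integ f : Prop := P.-integrable setT (EFin \o f).

Definition mean f : R := Rintegral P setT f.

(** Integrability is bundled with the vanishing mean because [mean] alone is not informative: [fine]
    sends an infinite integral to 0. The bundle is closed under linear combinations and dominated
    limits. *)
Definition null f : Prop := integ f /\ mean f = 0.

Lemma integ_measurable f : integ f -> measurable_fun setT f.
Proof. by move=> /integrableP[/measurable_EFinP]. Qed.

Lemma integD f g : integ f -> integ g -> integ (fun o => f o + g o).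
Proof. by move=> If Ig; exact: (integrableD measurableT If Ig). Qed.

Lemma integZ (k : R) f : integ f -> integ (fun o => k * f o).
Proof. by move=> If; exact: (integrableZl measurableT k If). Qed.

Lemma integ_le f g : measurable_fun setT f -> integ g ->
  (forall o, `|f o| <= `|g o|) -> integ f.
Proof.
move=> mf Ig fg; apply: le_integrable Ig => //; first exact/measurable_EFinP.
by move=> o _ /=; rewrite lee_fin.
Qed.

Lemma integ_norm f : integ f -> integ (fun o => `|f o|).
Proof. exact: integrable_norm. Qed.

Lemma integ_cst (c : R) : integ (fun=> c).
Proof. exact: finite_measure_integrable_cst. Qed.

Lemma integ_bounded f (M : R) : measurable_fun setT f ->
  (forall o, `|f o| <= M) -> integ f.
Proof.
move=> mf fM; apply: (integ_le _ (integ_cst M)) => // o.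
exact: le_trans (fM o) (ler_norm _).
Qed.

Lemma integM f g (M : R) : measurable_fun setT f -> (forall o, `|f o| <= M) ->
  integ g -> integ (fun o => f o * g o).
Proof.
move=> mf fM Ig; have mg := integ_measurable Ig.
apply: (integ_le _ (integZ M Ig)); first exact: measurable_funM.
move=> o; rewrite !normrM ler_wpM2r//.
exact: le_trans (fM o) (ler_norm _).
Qed.

Lemma integ_sum (I : Type) (r : seq I) (F : I -> Om -> R) :
  (forall i, integ (F i)) -> integ (fun o => \sum_(i <- r) F i o).
Proof.
move=> IF; elim: r => [|i r IH].
  by under eq_fun do rewrite big_nil; exact: integ_cst.
by under eq_fun do rewrite big_cons; exact: integD.
Qed.

Lemma meanD f g : integ f -> integ g ->
  mean (fun o => f o + g o) = mean f + mean g.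
Proof. by move=> If Ig; rewrite /mean RintegralD. Qed.

Lemma meanZ (k : R) f : integ f -> mean (fun o => k * f o) = k * mean f.
Proof. by move=> If; rewrite /mean RintegralZl. Qed.

Lemma mean_cst (c : R) : mean (fun=> c) = c.
Proof.
rewrite /mean Rintegral_cst// (_ : fine _ = 1) ?mulr1//.
exact: (congr1 fine (probability_setT P)).
Qed.

Lemma meanE f : integ f -> (\int[P]_o (f o)%:E = (mean f)%:E)%E.
Proof. by move=> If; rewrite /mean /Rintegral fineK//; exact: integrable_fin_num. Qed.

Lemma mean_dominated (fs : nat -> Om -> R) f g :
  (forall n, measurable_fun setT (fs n)) -> integ g ->
  (forall n o, `|fs n o| <= g o) -> (forall o, fs n o @[n --> \oo] --> f o) ->
  integ f /\ mean (fs n) @[n --> \oo] --> mean f.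
Proof.
move=> mfs Ig fsg fsf.
have mf : measurable_fun setT f by apply: measurable_fun_cvg => // o _; exact: fsf.
have [] := @dominated_convergence _ _ _ P setT measurableT
  (fun n => EFin \o fs n) (EFin \o f) (EFin \o g).
- by move=> n; exact/measurable_EFinP.
- exact/measurable_EFinP.
- by apply: aeW => o _; apply/cvg_EFin; [exact: nearW|exact: fsf].
- exact: Ig.
- by apply: aeW => o n _ /=; rewrite lee_fin.
move=> If _ cv; split => //.
have Ifs n : integ (fs n).
  by apply: (integ_le _ Ig) => // o; exact: le_trans (fsg n o) (ler_norm _).
have {}cv : (mean (fs n))%:E @[n --> \oo] --> (mean f)%:E.
  by rewrite -meanE//; under eq_fun do rewrite -meanE//.
by have /fine_cvgP[] := cv.
Qed.

Lemma null_ext f g : null f -> (forall o, f o = g o) -> null g.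
Proof. by move=> nf fg; rewrite (_ : g = f)//; apply/funext => o; rewrite fg. Qed.

Lemma null0 : null (fun=> 0).
Proof. by split; [exact: integ_cst|exact: mean_cst]. Qed.

Lemma nullD f g : null f -> null g -> null (fun o => f o + g o).
Proof. by move=> [If f0] [Ig g0]; split; [exact: integD|rewrite meanD// f0 g0 addr0]. Qed.

Lemma nullZ (k : R) f : null f -> null (fun o => k * f o).
Proof. by move=> [If f0]; split; [exact: integZ|rewrite meanZ// f0 mulr0]. Qed.

Lemma nullB f g : null f -> null g -> null (fun o => f o - g o).
Proof.
by move=> nf /(nullZ (-1)) /(nullD nf) /null_ext; apply => o; rewrite mulN1r.
Qed.

Lemma null_sum (I : Type) (s : seq I) (F : I -> Om -> R) :
  (forall i, null (F i)) -> null (fun o => \sum_(i <- s) F i o).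
Proof.
move=> nF; elim: s => [|i s IH].
  by apply: (null_ext null0) => o; rewrite big_nil.
by apply: (null_ext (nullD (nF i) IH)) => o; rewrite big_cons.
Qed.

Lemma null_lim (fs : nat -> Om -> R) f g : (forall n, null (fs n)) -> integ g ->
  (forall n o, `|fs n o| <= g o) -> (forall o, fs n o @[n --> \oo] --> f o) ->
  null f.
Proof.
move=> nfs Ig fsg fsf.
have [If cv] := mean_dominated (fun n => integ_measurable (nfs n).1) Ig fsg fsf.
split => //; have := cv; under eq_fun do rewrite (nfs _).2.
by move/cvg_lim => <-//; rewrite lim_cst.
Qed.

End Mean.

(** * Bounded functions measurable for a sub-sigma-algebra *)

Section SubSigmaAlgebra.
Context (R : realType) (d : measure_display) (Om : measurableType d).
Implicit Types (f g h : Om -> R) (G H : set (set Om)).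

(** Passing to the sigma-algebra generated by [G] makes the general measurability lemmas applicable
    to any family of sets; when [G] is already a sigma-algebra, [msubE] gives back the condition on
    preimages. *)
Definition msub G f : Prop := measurable_fun setT (f : g_sigma_algebraType G -> R).

Definition bm G f : Prop := msub G f /\ exists M : R, forall o, `|f o| <= M.

Lemma msubE G f : sigma_algebra setT G ->
  msub G f <-> (forall B, measurable B -> G (f @^-1` B)).
Proof.
move=> sG; split=> [mf B mB|GB _ B mB].
  have := mf measurableT B mB; rewrite setTI.
  by rewrite /measurable/= (sigma_algebra_id sG).
by rewrite setTI; apply: sub_sigma_algebra; exact: GB.
Qed.

Lemma msubS G H f : G `<=` H -> msub G f -> msub H f.
Proof.
move=> GH mf _ B mB; have := mf measurableT B mB.
exact: (sub_sigma_algebra2 (D := setT) GH).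
Qed.

Lemma msub_measurable G f : G `<=` measurable -> msub G f ->
  measurable_fun setT f.
Proof.
move=> GH mf _ B mB; have := mf measurableT B mB.
move/(sub_sigma_algebra2 (D := setT) GH).
by rewrite (sigma_algebra_id (sigma_algebra_measurable _)).
Qed.

Lemma msub_cst G (c : R) : msub G (fun=> c).
Proof. exact: measurable_cst. Qed.

Lemma msubD G f g : msub G f -> msub G g -> msub G (fun o => f o + g o).
Proof. by move=> mf mg; exact: measurable_funD. Qed.

Lemma msubB G f g : msub G f -> msub G g -> msub G (fun o => f o - g o).
Proof. by move=> mf mg; exact: measurable_funB. Qed.

Lemma msubM G f g : msub G f -> msub G g -> msub G (fun o => f o * g o).
Proof. by move=> mf mg; exact: measurable_funM. Qed.

Lemma msub_comp G (u : R -> R) f : measurable_fun setT u -> msub G f ->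
  msub G (fun o => u (f o)).
Proof. by move=> mu mf; exact: measurableT_comp. Qed.

Lemma msubN G f : msub G f -> msub G (fun o => - f o).
Proof. by move=> mf; apply: (msub_comp _ mf); exact: oppr_measurable. Qed.

Lemma msub_cos G f : msub G f -> msub G (fun o => cos (f o)).
Proof.
by apply: msub_comp; apply: continuous_measurable_fun; exact: continuous_cos.
Qed.

Lemma msub_sin G f : msub G f -> msub G (fun o => sin (f o)).
Proof.
by apply: msub_comp; apply: continuous_measurable_fun; exact: continuous_sin.
Qed.

Lemma msub_expR G f : msub G f -> msub G (fun o => expR (f o)).
Proof. by apply: msub_comp; exact: measurable_expR. Qed.

Lemma msub_sum G (I : Type) (s : seq I) (F : I -> Om -> R) :
  (forall i, msub G (F i)) -> msub G (fun o => \sum_(i <- s) F i o).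
Proof. by move=> mF; exact: measurable_sum. Qed.

Lemma msub_mulmx G p q r (M : Om -> 'M[R]_(p, q)) (N : Om -> 'M[R]_(q, r)) :
  (forall i j, msub G (fun o => M o i j)) ->
  (forall i j, msub G (fun o => N o i j)) ->
  forall i j, msub G (fun o => (M o *m N o) i j).
Proof.
move=> mM mN i j; under eq_fun do rewrite mxE.
by apply: msub_sum => k; exact: msubM.
Qed.

Lemma msub_lt G f g : msub G f -> msub G g -> msub G (fun o => (f o < g o)%R%:R).
Proof.
move=> mf mg.
have mb : measurable_fun setT
  ((fun o => f o < g o) : g_sigma_algebraType G -> bool).
  exact: measurable_fun_ltr.
by apply: (@measurableT_comp _ _ _ _ _ _ (fun b : bool => b%:R : R) _ _ _ mb).
Qed.

Lemma bm_cst G (c : R) : bm G (fun=> c).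
Proof. by split; [exact: msub_cst|exists `|c|]. Qed.

Lemma bmD G f g : bm G f -> bm G g -> bm G (fun o => f o + g o).
Proof.
move=> [mf [M fM]] [mg [N gN]]; split; first exact: msubD.
by exists (M + N) => o; rewrite (le_trans (ler_normD _ _))// lerD.
Qed.

Lemma bmM G f g : bm G f -> bm G g -> bm G (fun o => f o * g o).
Proof.
move=> [mf [M fM]] [mg [N gN]]; split; first exact: msubM.
by exists (M * N) => o; rewrite normrM ler_pM.
Qed.

Lemma bmN G f : bm G f -> bm G (fun o => - f o).
Proof.
move=> [mf [M fM]]; split; first exact: msubN.
by exists M => o; rewrite normrN.
Qed.

Lemma bm_cos G f : msub G f -> bm G (fun o => cos (f o)).
Proof. by move=> mf; split; [exact: msub_cos|exists 1 => o; exact: cos_max]. Qed.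

Lemma bm_sin G f : msub G f -> bm G (fun o => sin (f o)).
Proof. by move=> mf; split; [exact: msub_sin|exists 1 => o; exact: sin_max]. Qed.

Lemma bm_sum G (I : Type) (s : seq I) (F : I -> Om -> R) :
  (forall i, bm G (F i)) -> bm G (fun o => \sum_(i <- s) F i o).
Proof.
move=> bF; elim: s => [|i s IH].
  by under eq_fun do rewrite big_nil; exact: bm_cst.
by under eq_fun do rewrite big_cons; exact: bmD.
Qed.

Lemma bm_lt G f g : msub G f -> msub G g -> bm G (fun o => (f o < g o)%R%:R).
Proof.
move=> mf mg; split; first exact: msub_lt.
by exists 1 => o; case: ltP => _; rewrite ?normr1 ?normr0.
Qed.

Lemma bmS G H f : G `<=` H -> bm G f -> bm H f.
Proof. by move=> GH [mf bf]; split => //; exact: msubS mf. Qed.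

Lemma bm_indic G (S : set Om) : sigma_algebra setT G -> G S -> bm G (\1_S).
Proof.
move=> sG GS; split.
  by apply: measurable_indic; apply: sub_sigma_algebra.
by exists 1 => o; rewrite indicE; case: (_ \in _); rewrite ?normr1 ?normr0.
Qed.

(** The closure used in the functional monotone class theorem: linear combinations and uniformly
    bounded pointwise limits. The inductive form lets an identity be checked on generators and then
    carried over by dominated convergence. Products are not built in; [span_mul] recovers them. *)
Inductive span (M : set (Om -> R)) : (Om -> R) -> Prop :=
| span_base f : M f -> span M f
| span_add f g : span M f -> span M g -> span M (fun o => f o + g o)
| span_scale (c : R) f : span M f -> span M (fun o => c * f o)
| span_lim (fs : nat -> Om -> R) f (B : R) : (forall n, span M (fs n)) ->
    (forall n o, `|fs n o| <= B) -> (forall o, fs n o @[n --> \oo] --> f o) ->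
    span M f.

Lemma span_ext M f g : span M f -> (forall o, f o = g o) -> span M g.
Proof. by move=> sf fg; rewrite (_ : g = f)//; apply/funext => o; rewrite fg. Qed.

Lemma span_sum M (I : Type) (s : seq I) (F : I -> Om -> R) : span M (fun=> 0) ->
  (forall i, span M (F i)) -> span M (fun o => \sum_(i <- s) F i o).
Proof.
move=> s0 sF; elim: s => [|i s IH].
  by apply: (span_ext s0) => o; rewrite big_nil.
by apply: (span_ext (span_add (sF i) IH)) => o; rewrite big_cons.
Qed.

Lemma span_bounded M f : (forall g, M g -> exists B : R, forall o, `|g o| <= B) ->
  span M f -> exists B : R, forall o, `|f o| <= B.
Proof.
move=> bM; elim=> {f} [f /bM//|f g _ [B fB] _ [C gC]|c f _ [B fB]|fs f B _ _ fsB fsf].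
- by exists (B + C) => o; rewrite (le_trans (ler_normD _ _))// lerD.
- by exists (`|c| * B) => o; rewrite normrM ler_wpM2l.
- exists B => o; have fo : `|fs n o| @[n --> \oo] --> `|f o| by exact: cvg_norm.
  rewrite -(cvg_lim _ fo)//; apply: limr_le; first by apply/cvg_ex; eexists; exact: fo.
  exact: nearW.
Qed.

(** Two inductions, the first with a generator as one factor, the second in general. In each limit
    case the fixed factor is bounded, so the products remain uniformly bounded. *)
Lemma span_mul M : (forall g, M g -> exists B : R, forall o, `|g o| <= B) ->
  (forall f g, M f -> M g -> span M (fun o => f o * g o)) ->
  forall f g, span M f -> span M g -> span M (fun o => f o * g o).
Proof.
move=> bM MM.
have lim_mul f fs g B : (exists C : R, forall o, `|f o| <= C) ->
    (forall n, span M (fun o => f o * fs n o)) ->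
    (forall n o, `|fs n o| <= B) -> (forall o, fs n o @[n --> \oo] --> g o) ->
    span M (fun o => f o * g o).
  move=> [C fC] sfs fsB fsg.
  apply: (@span_lim M (fun n o => f o * fs n o) _ (C * B)) => // [n o|o].
    by rewrite normrM ler_pM.
  by apply: cvgM => //; exact: cvg_cst.
have base f g : M f -> span M g -> span M (fun o => f o * g o).
  move=> Mf; elim=> {g} [g Mg|g h _ Ig _ Ih|c g _ Ig|fs g B _ Ifs fsB fsg].
  - exact: MM.
  - by apply: (span_ext (span_add Ig Ih)) => o; rewrite mulrDr.
  - by apply: (span_ext (span_scale c Ig)) => o; rewrite mulrCA.
  - by apply: (lim_mul _ fs _ B) => //; exact: bM.
move=> f g + sg; elim=> {f} [f Mf|f h _ If _ Ih|c f _ If|fs f B _ Ifs fsB fsf].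
- exact: base.
- by apply: (span_ext (span_add If Ih)) => o; rewrite mulrDl.
- by apply: (span_ext (span_scale c If)) => o; rewrite mulrA.
- have bg := span_bounded bM sg.
  suff : span M (fun o => g o * f o) by move/span_ext; apply => o; rewrite mulrC.
  apply: (lim_mul _ fs _ B) => // n.
  by apply: (span_ext (Ifs n)) => o; rewrite mulrC.
Qed.

(** Since [Z] is integrable and the approximations are uniformly bounded, a multiple of [|Z|]
    dominates. This extends an identity from a class of test functions to its whole span. *)
Lemma span_null (P : probability Om R) M (Z : Om -> R) f :
  (forall g, M g -> exists B : R, forall o, `|g o| <= B) ->
  integ P Z -> (forall g, M g -> null P (fun o => g o * Z o)) ->
  span M f -> null P (fun o => f o * Z o).
Proof.
move=> bM IZ MZ; elim=> {f} [f /MZ//|f g _ nf _ ng|c f _ nf|fs f B sfs nfs fsB fsf].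
- by apply: (null_ext (nullD nf ng)) => o; rewrite mulrDl.
- by apply: (null_ext (nullZ c nf)) => o; rewrite mulrA.
- apply: (null_lim (fs := fun n o => fs n o * Z o) nfs (integZ B (integ_norm IZ))).
    by move=> n o; rewrite normrM ler_wpM2r.
  by move=> o; apply: cvgM => //; exact: cvg_cst.
Qed.

End SubSigmaAlgebra.

(** * Signs and ceilings as limits and sums of bounded functions *)

Section SignIteration.
Context (R : realType).
Implicit Types s t : R.

(* Iterating this odd cubic on [-1, 1] converges pointwise to the sign function:
   0 is repelling, 1 and -1 are attracting. *)
Definition cubic s : R := (3 * s - s ^+ 3) / 2.

Lemma iter_cubicN n s : iter n cubic (- s) = - iter n cubic s.
Proof.
elim: n => //= n ->; rewrite /cubic; ring.
Qed.

(** For [s <= u <= 1] the factorization of [1 - cubic u] leaves, besides [1 - u], the factor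
    [(1 - u)(2 + u)/2 = 1 - (u + u^2)/2], which is at most [1 - s/2]. Hence convergence to 1 is
    geometric once [s] is positive. *)
Lemma iter_cubic_itv n s : 0 <= s <= 1 ->
  s <= iter n cubic s <= 1 /\ 1 - iter n cubic s <= (1 - s / 2) ^+ n.
Proof.
move=> /andP[s0 s1]; elim: n => [|n [/andP[]]]; first by rewrite lexx s1 expr0; split => //=; lra.
rewrite iterS exprSr; move: (iter n cubic s) => u su u1 IH.
have v0 : 0 <= 1 - s / 2 by lra.
have e1 : 1 - cubic u = (1 - u) ^+ 2 * (2 + u) / 2 by rewrite /cubic; field.
have e2 : cubic u - u = u * (1 - u) * (1 + u) / 2 by rewrite /cubic; field.
have p1 : 0 <= (1 - u) ^+ 2 * (2 + u) / 2.
  by rewrite mulr_ge0 ?mulr_ge0 ?sqr_ge0//; lra.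
have p2 : 0 <= u * (1 - u) * (1 + u) / 2.
  by rewrite !mulr_ge0//; lra.
split; first by apply/andP; split; lra.
apply: (@le_trans _ _ ((1 - u) * (1 - s / 2))); last by rewrite ler_wpM2r.
rewrite e1 expr2 -!mulrA ler_wpM2l//; first lra.
rewrite mulrA; have : 0 <= u * u by rewrite mulr_ge0//; lra.
lra.
Qed.

Lemma iter_cubic_norm n s : `|s| <= 1 -> `|iter n cubic s| <= 1.
Proof.
wlog s0 : s / 0 <= s => [H|].
  have [s0|s0] := leP 0 s; first exact: H.
  by rewrite -normrN -[X in _ -> X <= _]normrN -iter_cubicN; apply: H; lra.
rewrite ger0_norm// => s1.
have [/andP[us u1] _] := iter_cubic_itv n (introT andP (conj s0 s1)).
by rewrite ger0_norm//; exact: le_trans us.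
Qed.

Lemma iter_cubic_cvg s : `|s| <= 1 -> iter n cubic s @[n --> \oo] --> Num.sg s.
Proof.
wlog s0 : s / 0 <= s => [H s1|].
  have [s0|s0] := leP 0 s; first exact: H.
  rewrite -[s]opprK sgrN; under eq_fun do rewrite iter_cubicN.
  by apply: cvgN; apply: H; rewrite ?normrN//; lra.
rewrite ger0_norm// => s1; move: s0; rewrite le_eqVlt => /predU1P[<-|s0].
  rewrite sgr0 (_ : (fun _ => _) = fun=> 0); first exact: cvg_cst.
  apply/funext; elim => //= n ->; rewrite /cubic; ring.
rewrite gtr0_sg//.
have g : (1 - s / 2) ^+ n @[n --> \oo] --> (0 : R).
  by apply: cvg_expr; rewrite ger0_norm; lra.
apply: (@squeeze_cvgr _ _ _ _ (fun n => 1 - (1 - s / 2) ^+ n) (fun=> 1)).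
- apply: nearW => n; have s01 : 0 <= s <= 1 by rewrite (ltW s0).
  have [/andP[_ ->] H] := iter_cubic_itv n s01; rewrite andbT.
  lra.
- rewrite -[X in _ --> X]subr0; apply: cvgB => //; exact: cvg_cst.
- exact: cvg_cst.
Qed.

(** For large [n] the argument lies within 2 of 0, where sine has the sign of its argument, so the
    sequence is eventually constant. In this way bounded periodic functions detect the sign of an
    unbounded variable. *)
Lemma sg_sin_cvg t : Num.sg (sin (n.+1%:R^-1 * t)) @[n --> \oo] --> Num.sg t.
Proof.
apply: cvg_near_cst.
wlog t0 : t / 0 <= t => [H|].
  have [t0|t0] := leP 0 t; first exact: H.
  have [|N _ NP] := H (- t); first lra.
  exists N => // n /NP /=; rewrite mulrN sinN !sgrN => /eqP.
  by rewrite eqr_opp => /eqP.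
move: t0; rewrite le_eqVlt => /predU1P[<-|t0].
  by apply: nearW => n; rewrite mulr0 sin0 sgr0.
near=> n; rewrite gtr0_sg ?gtr0_sg//.
apply: sin2_gt0; rewrite mulr_gt0 ?invr_gt0//= mulrC ltr_pdivrMr//.
have : t <= n%:R by near: n; exact: nbhs_infty_ger.
rewrite -natr1; lra.
Unshelve. all: by end_near. Qed.

(** The sum is the ceiling of [t], written with indicators of strict inequalities. It serves both to
    approximate a bounded function by level sets and to discretize the random threshold. *)
Lemma count_lt_bounds (N : nat) t : 0 <= t <= N%:R ->
  t <= (\sum_(i < N) (i%:R < t)%R%:R : R) <= t + 1.
Proof.
move=> /andP[t0 tN].
have bnd (k : nat) : (\sum_(i < k) (i%:R < t)%R%:R : R) <= k%:R.
  rewrite -[leRHS]mulr_natr mul1r -[in leRHS](card_ord k) -sum1_card natr_sum ler_sum// => i _.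
  by case: ltP.
(* Truncating at [N] removes the hypothesis [t <= N], which the induction on [N] would not
   preserve. *)
suff : Num.min t N%:R <= (\sum_(i < N) (i%:R < t)%R%:R : R) <= Num.min t N%:R + 1.
  by rewrite min_l.
elim: N {tN} => [|N IH]; first by rewrite big_ord0 min_r//; lra.
rewrite big_ord_recr/=; move: (bnd N) IH; set S := \sum_(i < N) _ => SN.
rewrite -natr1; have [Nt|tN] := ltP (N%:R : R) t.
  move=> /andP[S1 S2].
  have m1 : Num.min t (N%:R + 1) <= N%:R + 1 by rewrite ge_min lexx orbT.
  have m2 : N%:R <= Num.min t (N%:R + 1).
    by rewrite le_min (ltW Nt); lra.
  by apply/andP; split; rewrite /=; lra.
have -> : Num.min t (N%:R + 1) = t by rewrite min_l//; lra.
by rewrite addr0.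
Qed.

End SignIteration.

(** * Functional monotone class theorem *)

Section MonotoneClass.
Context (R : realType) (d : measure_display) (Om : measurableType d).
Variable M : set (Om -> R).
Hypothesis boundedM : forall g, M g -> exists B : R, forall o, `|g o| <= B.
Hypothesis mulM : forall f g, M f -> M g -> span M (fun o => f o * g o).
Hypothesis span1 : span M (fun=> 1).

Let spanM f g : span M f -> span M g -> span M (fun o => f o * g o).
Proof. exact: span_mul. Qed.

Let span_cst (c : R) : span M (fun=> c).
Proof. by apply: (span_ext (span_scale c span1)) => o; rewrite mulr1. Qed.

(** Countable unions come from products and bounded limits: the indicator of the union is the limit
    of one minus the product of the complementary indicators. *)
Lemma span_sigma_algebra : sigma_algebra setT [set S | span M \1_S].
Proof.
split => [|S /= sS|F /= sF].
- by apply: (span_ext (span_cst 0)) => o; rewrite indic0.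
- apply: (span_ext (span_add span1 (span_scale (-1) sS))) => o.
  rewrite !indicE in_setD in_setT/=; case: (_ \in _) => /=; ring.
- pose u n o : R := \prod_(i < n) (1 - \1_(F i) o).
  have su n : span M (u n).
    elim: n => [|n IH]; first by apply: (span_ext span1) => o; rewrite /u big_ord0.
    apply: (span_ext (spanM IH (span_add span1 (span_scale (-1) (sF n))))) => o.
    by rewrite /u big_ord_recr/= mulN1r.
  have u01 n o : 0 <= u n o <= 1.
    rewrite /u; elim/big_ind : _ => [|x y /andP[x0 x1] /andP[y0 y1]|i _].
    + by rewrite ler01 lexx.
    + by rewrite mulr_ge0//= mulr_ile1.
    + by rewrite indicE; case: (_ \in _); rewrite ?subrr ?subr0 ler01 lexx.
  apply: (@span_lim _ _ _ _ (fun n o => 1 + (-1) * u n o) _ 1) => [n|n o|o].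
  + by apply: span_add => //; exact: span_scale.
  + have /andP[u0 u1] := u01 n o; rewrite ger0_norm; lra.
  + apply: cvg_near_cst; have [[i _ Fio]|nF] := pselect ((\bigcup_i F i) o).
      exists i.+1 => // n /= ni; rewrite indicE mem_set; last by exists i.
      rewrite /u (bigD1 (Ordinal ni))//= indicE mem_set//= subrr mul0r mulr0 addr0.
      by [].
    apply: nearW => n; rewrite indicE memNset//= /u big1 ?mulr1 ?subrr// => i _.
    by rewrite indicE memNset ?subr0// => Fio; apply: nF; exists i.
Qed.

Lemma span_indic_generated (gen : set (set Om)) :
  (forall S, gen S -> span M \1_S) -> forall S, <<s gen >> S -> span M \1_S.
Proof. by move=> gS; apply: smallest_sub => //; exact: span_sigma_algebra. Qed.

(** The range of [f] is rescaled to an interval of length [n.+1]. The ceiling of the rescaled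
    function is a sum of indicators of sets [f @^-1] of rays, and after undoing the scaling the
    error is at most [2 C / n.+1]. *)
Lemma span_bm G f : sigma_algebra setT G -> (forall S, G S -> span M \1_S) ->
  bm G f -> span M f.
Proof.
move=> sG GM [/(msubE f sG) mf [B fB]].
(* The bound [B] may be 0; adding 1 makes [C] positive, so that dividing by [C * 2] is
   legitimate. *)
pose C := B + 1.
have C0 : 0 < C by rewrite /C; have := le_trans (normr_ge0 _) (fB point); lra.
pose t (n : nat) o : R := n%:R * ((f o + C) / (C * 2)).
have slt n (i : nat) : span M (fun o => (i%:R < t n o)%R%:R).
  case: n => [|n].
    apply: (span_ext (span_cst 0)) => o; rewrite /t mul0r.
    by rewrite ltNge ler0n.
  apply: (span_ext (GM (f @^-1` `]i%:R / n.+1%:R * (C * 2) - C, +oo[) _)).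
    by apply: mf; exact: measurable_itv.
  move=> o; rewrite indicE; congr (nat_of_bool _)%:R.
  have -> : (i%:R < t n.+1 o) = (i%:R / n.+1%:R * (C * 2) - C < f o).
    rewrite ltrBlDr -ltr_pdivlMr ?mulr_gt0// ltr_pdivrMr// /t.
    by rewrite [X in _ = (_ < X)]mulrC.
  by apply/idP/idP => [|H]; rewrite inE/= in_itv/= andbT.
have t_bnd n o : 0 <= t n o <= n%:R.
  have /andP[fl fu] : - B <= f o <= B by rewrite -ler_norml.
  rewrite /t mulr_ge0//=; last by rewrite divr_ge0 ?mulr_ge0 ?ltW// /C; lra.
  by rewrite ler_piMr// ler_pdivrMr ?mulr_gt0// /C; lra.
pose fs n o : R := (C * 2) / n.+1%:R * (\sum_(i < n.+1) (i%:R < t n.+1 o)%R%:R) - C.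
have fsE n o : f o <= fs n o <= f o + (C * 2) / n.+1%:R.
  have /andP[l u] := count_lt_bounds (t_bnd n.+1 o).
  have q0 : 0 <= (C * 2) / n.+1%:R :> R by rewrite divr_ge0 ?mulr_ge0 ?ltW.
  have -> : f o = (C * 2) / n.+1%:R * t n.+1 o - C.
    rewrite /t; field.
    by rewrite nat1r pnatr_eq0/= gt_eqF.
  by rewrite /fs lerD2r ler_wpM2l//= addrAC lerD2r -[X in _ <= _ + X]mulr1 -mulrDr ler_wpM2l.
apply: (@span_lim _ _ _ _ fs _ (B + C * 2)) => [n|n o|o].
- apply: (span_ext (span_add (span_scale (C * 2 / n.+1%:R)
    (span_sum (index_enum 'I_n.+1) (span_cst 0) (fun i : 'I_n.+1 => slt n.+1 i)))
    (span_cst (- C)))) => o.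
  by [].
- have /andP[fl fu] : - B <= f o <= B by rewrite -ler_norml.
  have /andP[l u] := fsE n o.
  have q : (C * 2) / n.+1%:R <= C * 2 :> R.
    rewrite ler_pdivrMr// -[leLHS]mulr1 ler_wpM2l ?ler1n//; lra.
  by rewrite ler_norml; apply/andP; split;
    move: l u q C0 fl fu; move: (fs n o) (C * 2 / _) => ? ? *; lra.
- apply: (@squeeze_cvgr _ _ _ _ (fun=> f o) (fun n => f o + C * 2 / n.+1%:R)).
  + exact: nearW.
  + exact: cvg_cst.
  + rewrite -[X in _ --> X]addr0; apply: cvgD; first exact: cvg_cst.
    rewrite -(mulr0 (C * 2)); apply: cvgM; first exact: cvg_cst.
    exact: cvg_harmonic.
Qed.

(** The iterated [cubic] is a polynomial, so it stays in the span, and its limit on a sine is the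
    sign of that sine; slowing the sine down then gives the sign of [f - c]. The indicator of
    positive reals is half the sum of the sign and its square. *)
Lemma span_indic_ray f (c : R) :
  (forall s a, span M (fun o => sin (s * (f o - a)))) ->
  span M \1_(f @^-1` `]c, +oo[).
Proof.
move=> ssin.
have ssg : span M (fun o => Num.sg (f o - c)).
  apply: (@span_lim _ _ _ _ (fun n o => Num.sg (sin (n.+1%:R^-1 * (f o - c)))) _ 1).
  - move=> n; pose g o := sin (n.+1%:R^-1 * (f o - c)).
    apply: (@span_lim _ _ _ _ (fun k o => iter k (@cubic R) (g o)) _ 1) => [k|k o|o].
    + elim: k => [|k IH]; first exact: ssin.
      apply: (span_ext (span_add (span_scale (3 / 2) IH)
        (span_scale (- 1 / 2) (spanM IH (spanM IH IH))))) => o /=.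
      by rewrite /cubic; field.
    + by apply: iter_cubic_norm; exact: sin_max.
    + by apply: iter_cubic_cvg; exact: sin_max.
  - by move=> n o; rewrite normr_sg; case: (_ != _).
  - by move=> o; exact: sg_sin_cvg.
apply: (span_ext (span_scale (1 / 2) (span_add ssg (spanM ssg ssg)))) => o.
have -> : \1_(f @^-1` `]c, +oo[) o = (0 < f o - c)%R%:R :> R.
  rewrite indicE; congr (nat_of_bool _)%:R.
  by rewrite subr_gt0; apply/idP/idP => [|H]; rewrite inE/= in_itv/= andbT.
by case: sgrP => _ /=; rewrite ?mulr1n ?mulr0n; field.
Qed.

(** For a fixed generator [f], the sets [B] such that the indicator of the preimage lies in the span
    form a sigma-algebra, so rays suffice. What remains to check for an enlarged information is only
    that sines of its generators are in the span. *)
Lemma span_sigma_gen (fs : set (Om -> R)) h :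
  (forall f, fs f -> forall s a, span M (fun o => sin (s * (f o - a)))) ->
  bm (sigma_gen fs) h -> span M h.
Proof.
move=> ssin; apply: span_bm; first exact: smallest_sigma_algebra.
apply: span_indic_generated => _ [f [B [ff [+ ->]]]].
move=> mB; have : (RGenOInfty.G (R := R)).-sigma.-measurable B.
  by rewrite -RGenOInfty.measurableE.
have := @smallest_sub _ (sigma_algebra setT) (RGenOInfty.G (R := R))
  [set B : set R | span M \1_(f @^-1` B)].
apply => [|_ [c ->]]; last exact: span_indic_ray (ssin f ff).
have [s0 sC sU] := span_sigma_algebra.
split => [|A sA|F sF] /=; first exact: s0.
- exact: (sC _ sA).
- by rewrite preimage_bigcup; exact: sU.
Qed.

End MonotoneClass.

(** * Independence *)

Section Independence.
Context (R : realType) (d : measure_display) (Om : measurableType d)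
  (P : probability Om R).
Implicit Types (f g h : Om -> R) (G H : set (set Om)).

Lemma bm_integM G f g : G `<=` measurable -> bm G f -> integ P g ->
  integ P (fun o => f o * g o).
Proof.
by move=> Gm [mf [M fM]]; apply: integM fM; exact: msub_measurable mf.
Qed.

Lemma bm_integ G f : G `<=` measurable -> bm G f -> integ P f.
Proof.
by move=> Gm [mf [M fM]]; apply: integ_bounded fM; exact: msub_measurable mf.
Qed.

Lemma mean_indic (S : set Om) : measurable S -> mean P \1_S = fine (P S).
Proof. by move=> mS; rewrite /mean /Rintegral integral_indic// setIT. Qed.

Lemma integ_indic (S : set Om) : measurable S -> integ P \1_S.
Proof.
move=> mS; apply: (@integ_bounded _ _ _ _ _ 1); first exact: measurable_indic.
by move=> o; rewrite indicE; case: (_ \in _); rewrite ?normr1 ?normr0.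
Qed.

Lemma indicM (A B : set Om) o : \1_A o * \1_B o = \1_(A `&` B) o :> R.
Proof. by rewrite indicI. Qed.

Lemma sigma_algebra_setI G : sigma_algebra setT G -> setI_closed G.
Proof. by move/sigma_algebraP => [|//]. Qed.

Lemma sigma_algebra_setT G : sigma_algebra setT G -> G setT.
Proof. by move/sigma_algebraP => [|//]. Qed.

Lemma null_indic_bm G (Z : Om -> R) g : sigma_algebra setT G ->
  integ P Z -> (forall S, G S -> null P (fun o => \1_S o * Z o)) ->
  bm G g -> null P (fun o => g o * Z o).
Proof.
move=> sG IZ GZ bg; pose M := [set f | exists2 S, G S & f = \1_S :> (Om -> R)].
have bM f : M f -> exists B : R, forall o, `|f o| <= B.
  move=> [S _ ->]; exists 1 => o.
  by rewrite indicE; case: (_ \in _); rewrite ?normr1 ?normr0.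
apply: (span_null bM IZ) => [_ [S GS ->]|]; first exact: GZ.
apply: (span_bm _ sG _ bg) => [|S GS].
- by apply: span_base; exists setT; [exact: sigma_algebra_setT|rewrite indicT].
- by apply: span_base; exists S.
Qed.

(** Stated for bounded functions, the form in which independence meets the test functions;
    [block_indep] derives it from the product formula for events. *)
Definition indep G H : Prop := forall f g, bm G f -> bm H g ->
  mean P (fun o => f o * g o) = mean P f * mean P g.

Lemma indepC G H : indep G H -> indep H G.
Proof.
move=> GH f g bf bg; rewrite mulrC -GH//; congr (mean _ _).
by apply/funext => o; rewrite mulrC.
Qed.

(* Truncating [F] reduces this to bounded functions. *)
Lemma indep_null G H (F : Om -> R) g : G `<=` measurable -> H `<=` measurable ->
  indep G H -> null P F -> msub G F -> bm H g -> null P (fun o => F o * g o).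
Proof.
move=> Gm Hm GH [IF F0] mF bg.
have IFg : integ P (fun o => F o * g o).
  by have := bm_integM Hm bg IF; under eq_fun do rewrite mulrC.
split => //.
pose Fn n o := Num.max (- n%:R) (Num.min (F o) n%:R).
have bFn n : bm G (Fn n).
  split.
    apply: measurable_maxr; first exact: measurable_cst.
    by apply: measurable_minr => //; exact: measurable_cst.
  exists n%:R => o; rewrite ler_norml /Fn le_max lexx/= ge_max ge_min lexx orbT andbT.
  by rewrite -subr_ge0 opprK addr_ge0.
have FnF n o : `|Fn n o| <= `|F o|.
  have /andP[F1 F2] : - `|F o| <= F o <= `|F o| by rewrite -ler_norml.
  have n0 : 0 <= n%:R :> R by [].
  rewrite ler_norml /Fn le_max ge_max le_min ge_min F1 F2/= andbT.
  by apply/andP; split; [apply/orP; right|]; lra.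
have cFn o : Fn n o @[n --> \oo] --> F o.
  apply: cvg_near_cst; near=> n.
  have : `|F o| <= n%:R by near: n; exact: nbhs_infty_ger.
  by rewrite ler_norml => /andP[h1 h2]; rewrite /Fn min_l// max_r.
have [_ c1] := mean_dominated (fun n => msub_measurable Gm (bFn n).1)
  (integ_norm IF) FnF cFn.
have [mg [B gB]] := bg.
have [_ c2] : integ P (fun o => F o * g o) /\
    mean P (fun o => Fn n o * g o) @[n --> \oo] --> mean P (fun o => F o * g o).
  apply: (mean_dominated _ (integZ B (integ_norm IF))) => [n|n o|o].
  - exact: measurable_funM (msub_measurable Gm (bFn n).1) (msub_measurable Hm mg).
  - by rewrite normrM mulrC ler_pM.
  - by apply: cvgM (cFn o) _; exact: cvg_cst.
rewrite -(cvg_lim _ c2)//; apply/cvg_lim => //.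
under eq_fun do rewrite GH//.
by rewrite -(mul0r (mean P g)) -F0; apply: cvgM c1 _; exact: cvg_cst.
Unshelve. all: by end_near. Qed.

Section Blocks.
Context (I : eqType) (F : I -> set (set Om)).
Hypothesis sF : forall i, sigma_algebra setT (F i).
Hypothesis Fm : forall i, F i `<=` measurable.
Hypothesis indF : mutually_independent P F.

Definition block (J : seq I) : set (set Om) :=
  <<s [set S | exists2 i, i \in J & F i S] >>.

Lemma block_sigma_algebra J : sigma_algebra setT (block J).
Proof. exact: smallest_sigma_algebra. Qed.

Lemma block_measurable J : block J `<=` measurable.
Proof.
apply: smallest_sub; first exact: sigma_algebra_measurable.
by move=> S [i _ /Fm].
Qed.

Lemma sub_block i J : i \in J -> F i `<=` block J.
Proof. by move=> iJ S FS; apply: sub_sigma_algebra; exists i. Qed.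

Lemma block_mono J J' : {subset J <= J'} -> block J `<=` block J'.
Proof. by move=> JJ'; apply: sub_sigma_algebra2 => S [i /JJ' iJ FS]; exists i. Qed.

(** Indicators of intersections of one event per source in [J] form a multiplicative class
    generating the block, and the product formula handles these against an event of [F s]. The
    monotone class argument then extends the first factor, and [null_indic_bm] the second. *)
Lemma block_indep s J : uniq (s :: J) -> indep (block J) (F s).
Proof.
move=> /= /andP[sJ uJ].
pose cap (E : I -> set Om) := \big[setI/setT]_(i <- J) E i.
have capm E : (forall i, i \in J -> F i (E i)) -> measurable (cap E).
  move=> FE; rewrite /cap big_seq; elim/big_ind : _ => //.
  - by move=> A B; exact: measurableI.
  - by move=> i iJ; apply: Fm; exact: FE.
pose M := [set f | exists2 E, (forall i, i \in J -> F i (E i)) &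
  f = \1_(cap E) :> (Om -> R)].
have bM f : M f -> exists B : R, forall o, `|f o| <= B.
  move=> [S _ ->]; exists 1 => o.
  by rewrite indicE; case: (_ \in _); rewrite ?normr1 ?normr0.
have MM f g : M f -> M g -> span M (fun o => f o * g o).
  move=> [A FA ->] [B FB ->]; apply: span_base.
  exists (fun i => A i `&` B i) => [i iJ|].
    by apply: sigma_algebra_setI => //; [exact: FA|exact: FB].
  by apply/funext => o; rewrite indicM /cap big_split.
have s1 : span M (fun=> 1).
  apply: span_base; exists (fun=> setT) => [i iJ|]; first exact: sigma_algebra_setT.
  by rewrite /cap big1// indicT.
have bl f : bm (block J) f -> span M f.
  apply: (span_bm s1 (block_sigma_algebra J)).
  apply: (span_indic_generated bM MM s1) => S [i iJ FS].
  apply: span_base; exists (fun j => if j == i then S else setT) => [j jJ|].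
      by case: eqP => [->//|_]; exact: sigma_algebra_setT.
    congr indic; rewrite /cap (bigD1_seq i)//= eqxx big1 ?setIT// => j.
    by case: eqP.
have fE f E : bm (block J) f -> F s E ->
    null P (fun o => f o * (\1_E o - fine (P E))).
  move=> /bl sf FE; have mE := Fm FE.
  have IZ : integ P (fun o => \1_E o - fine (P E)).
    by apply: integD; [exact: integ_indic|exact: integ_cst].
  apply: (span_null bM IZ _ sf) => _ [A FA ->]; have mA := capm _ FA.
  have IA : integ P (fun o => \1_(cap A) o * (\1_E o - fine (P E))).
    apply: (@integM _ _ _ _ (\1_(cap A)) _ 1 _ _ IZ); first exact: measurable_indic.
    by move=> o; rewrite indicE; case: (_ \in _); rewrite ?normr1 ?normr0.
  split => //.
  have -> : (fun o => \1_(cap A) o * (\1_E o - fine (P E))) =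
      (fun o => \1_(cap A `&` E) o + (- fine (P E)) * \1_(cap A) o :> R).
    by apply/funext => o; rewrite -indicM; ring.
  rewrite meanD; [|exact/integ_indic/measurableI|exact/integZ/integ_indic].
  rewrite meanZ ?mean_indic//; [|exact: measurableI|exact: integ_indic].
  (* As [s] is not in [J], the event [E] can be added to the family at index [s] without changing
     the others. *)
  pose A' i := if i == s then E else A i.
  have A'J i : i \in J -> A' i = A i.
    by rewrite /A'; case: eqP => // ->; rewrite (negbTE sJ).
  have c1 : P (cap A) = (\prod_(i <- J) P (A i))%E by apply: indF.
  have c2 : P (cap A `&` E) = (P E * P (cap A))%E.
    have := indF (J := s :: J) (E := A'); rewrite !big_cons /A' eqxx.
    rewrite -/A' c1 setIC /cap.
    rewrite (eq_big_seq A A'J) => ->.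
    - congr (_ * _)%E; apply: eq_big_seq => i iJ; congr (P _).
      exact: A'J.
    - by rewrite /= sJ.
    - move=> i; rewrite inE; case: eqP => [->//|_ /= iJ]; exact: FA.
  by rewrite c2 fineM ?fin_num_measure//; ring.
move=> f g bf bg.
have If : integ P f by apply: bm_integ bf; exact: block_measurable.
have IZ : integ P (fun o => f o - mean P f) by apply: integD => //; exact: integ_cst.
(* Moving the centring from [\1_E] to [f] makes the identity linear in the indicator of an event of
   [F s], ready for extension to [g]. *)
have [] := @null_indic_bm (F s) (fun o => f o - mean P f) g (sF s) IZ _ bg.
  move=> E FE; have mE := Fm FE.
  have IE : integ P \1_E by exact: integ_indic.
  have [I0 m0] := fE f E bf FE.
  apply: (null_ext (nullD (conj I0 m0) _ : null P
    (fun o => f o * (\1_E o - fine (P E)) +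
      (fine (P E) * f o + (- mean P f) * \1_E o)))) => [|o]; last by ring.
  split; first by apply: integD; exact: integZ.
  by rewrite meanD; [rewrite !meanZ// mean_indic//; ring|exact: integZ|exact: integZ].
have Ig : integ P g by apply: bm_integ bg; exact: Fm.
have Ifg : integ P (fun o => f o * g o).
  by apply: bm_integM bf Ig; exact: block_measurable.
have -> : (fun o => g o * (f o - mean P f)) =
    (fun o => f o * g o + (- mean P f) * g o) by apply/funext => o; ring.
move=> _; rewrite meanD//; last exact: integZ.
by rewrite meanZ// => /eqP; rewrite mulNr subr_eq0 => /eqP.
Qed.

End Blocks.

End Independence.

(** * Elementary limits *)

Section Limits.
Context (R : realType).
Implicit Types t u : R.

Lemma MVT0 (f df : R -> R) t : (forall x : R, is_derive x 1 f (df x)) ->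
  exists2 c, `|c| <= `|t| & f t - f 0 = df c * t.
Proof.
move=> fdf.
have cf A : {within A, continuous f}.
  apply: continuous_subspaceT => x; apply: differentiable_continuous.
  by apply/derivable1_diffP; have [] := fdf x.
have [t0|t0] := leP 0 t.
  have [c] := MVT_segment t0 (fun x _ => fdf x) (cf _).
  rewrite in_itv/= => /andP[c0 ct]; rewrite subr0 => e.
  by exists c => //; rewrite !ger0_norm.
have [c] := MVT_segment (ltW t0) (fun x _ => fdf x) (cf _).
rewrite in_itv/= => /andP[ct c0] e; exists c; last by rewrite -opprB e sub0r mulrN opprK.
by rewrite !ler0_norm ?(ltW t0)// lerN2.
Qed.

Lemma sin_lip1 t : `|sin t| <= `|t|.
Proof.
have [c _] := MVT0 t (@is_derive_sin R); rewrite sin0 subr0 => ->.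
by rewrite normrM ler_piMl// cos_max.
Qed.

(** The mean value theorem, used for sine and then for cosine, gives a quadratic error. This
    suffices: at [t / N] and multiplied by [N] it is [t^2 / N]. *)
Lemma sin_sub_id t : `|sin t - t| <= t ^+ 2.
Proof.
have [c ct] := MVT0 t (@is_derive_sin R); rewrite sin0 subr0 => ->.
have [b bc] := MVT0 c (@is_derive_cos R); rewrite cos0 => e.
rewrite -[X in _ - X]mul1r -mulrBl e !normrM normrN -mulrA.
apply: (@le_trans _ _ (1 * (`|t| * `|t|))).
  by rewrite ler_pM ?mulr_ge0 ?sin_max// ler_wpM2r.
by rewrite mul1r -expr2 real_normK ?num_real.
Qed.

Lemma sin_scaled_le (n : nat) t : `|n.+1%:R * sin (t / n.+1%:R)| <= `|t|.
Proof.
have n0 : 0 < n.+1%:R :> R by [].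
rewrite normrM gtr0_norm// -ler_pdivlMl// (le_trans (sin_lip1 _))//.
by rewrite normrM mulrC normfV (gtr0_norm n0).
Qed.

Lemma sin_scaled_cvg t : n.+1%:R * sin (t / n.+1%:R) @[n --> \oo] --> t.
Proof.
have hc : t ^+ 2 / n.+1%:R @[n --> \oo] --> (0 : R).
  rewrite -(mulr0 (t ^+ 2)); apply: cvgM; first exact: cvg_cst.
  exact: cvg_harmonic.
apply: (@squeeze_cvgr _ _ _ _ (fun n => t - t ^+ 2 / n.+1%:R)
  (fun n => t + t ^+ 2 / n.+1%:R)).
- apply: nearW => n; rewrite -ler_distl.
  have n0 : 0 < n.+1%:R :> R by [].
  have -> : n.+1%:R * sin (t / n.+1%:R) - t =
    n.+1%:R * (sin (t / n.+1%:R) - t / n.+1%:R).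
    by field; rewrite nat1r.
  rewrite normrM gtr0_norm// -ler_pdivlMl// (le_trans (sin_sub_id _))//.
  by rewrite le_eqVlt; apply/orP; left; apply/eqP; field; rewrite nat1r.
- by rewrite -[X in _ --> X]subr0; apply: cvgB => //; exact: cvg_cst.
- by rewrite -[X in _ --> X]addr0; apply: cvgD => //; exact: cvg_cst.
Qed.

(** The inequality [1 + x <= expR x] at [r] and at [- r] gives [r <= expR r - 1 <= r * expR r]. *)
Lemma expR_scaled_cvg (r : nat -> R) u :
  n.+1%:R * r n @[n --> \oo] --> u ->
  n.+1%:R * (expR (r n) - 1) @[n --> \oo] --> u.
Proof.
move=> ru.
have r0 : r n @[n --> \oo] --> (0 : R).
  have -> : r = (fun n => n.+1%:R^-1 * (n.+1%:R * r n)).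
    by apply/funext => n; rewrite mulKf.
  by rewrite -(mul0r u); apply: cvgM => //; exact: cvg_harmonic.
apply: (@squeeze_cvgr _ _ _ _ (fun n => n.+1%:R * r n)
  (fun n => n.+1%:R * r n * expR (r n))) => //; last first.
  rewrite (_ : u = u * expR 0); last by rewrite expR0 mulr1.
  apply: cvgM => //.
  by apply: continuous_cvg => //; exact: continuous_expR.
apply: nearW => n; rewrite -mulrA !ler_wpM2l//.
  have := expR_ge1Dx (- r n); rewrite -(ler_pM2r (expR_gt0 (r n))) -expRD addNr expR0.
  lra.
have := expR_ge1Dx (r n); lra.
Qed.

Lemma expr_sub_le (n : nat) (a b : R) : `|a| <= 1 -> `|b| <= 1 ->
  `|a ^+ n - b ^+ n| <= n%:R * `|a - b|.
Proof.
move=> a1 b1; elim: n => [|n IH]; first by rewrite !expr0 subrr normr0 mul0r.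
have -> : a ^+ n.+1 - b ^+ n.+1 = a * (a ^+ n - b ^+ n) + (a - b) * b ^+ n.
  by rewrite !exprS; ring.
rewrite (le_trans (ler_normD _ _))// -natr1 [leRHS]mulrDl mul1r lerD//.
  by rewrite normrM (le_trans _ IH)// ler_piMl.
by rewrite normrM ler_piMr// normrX exprn_ile1.
Qed.

(* With [c = 2 sin^2 (t / 2N)] the power is [(1 - c)^(N^2)], and [N^2 c -> t^2 / 2]. *)
Lemma cosX_cvg t : cos (t / n.+1%:R) ^+ (n.+1 ^ 2) @[n --> \oo] -->
  expR (- (t ^+ 2 / 2)).
Proof.
pose s n := n.+1%:R * sin (t / 2 / n.+1%:R).
pose c n := 2 * sin (t / 2 / n.+1%:R) ^+ 2.
have sc n : (n.+1 ^ 2)%:R * c n = 2 * s n ^+ 2.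
  by rewrite /c /s natrX; ring.
have cosE n : cos (t / n.+1%:R) = 1 - c n.
  have -> : t / n.+1%:R = t / 2 / n.+1%:R + t / 2 / n.+1%:R by field; rewrite nat1r.
  by rewrite cosD /c -!expr2 cos2sin2; ring.
have cs : 2 * s n ^+ 2 @[n --> \oo] --> t ^+ 2 / 2.
  have -> : t ^+ 2 / 2 = 2 * (t / 2) ^+ 2 by field.
  apply: cvgM; first exact: cvg_cst.
  rewrite expr2; under eq_fun do rewrite expr2.
  by apply: cvgM; exact: sin_scaled_cvg.
have e1 : expR (- (2 * s n ^+ 2)) @[n --> \oo] --> expR (- (t ^+ 2 / 2)).
  by apply: continuous_cvg; [exact: continuous_expR|exact: cvgN].
pose C := (t / 2) ^+ 2 * 2.
have C0 : 0 <= C by rewrite mulr_ge0// sqr_ge0.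
have c0 n : 0 <= c n by rewrite mulr_ge0// sqr_ge0.
have s2C n : 2 * s n ^+ 2 <= C.
  rewrite mulrC ler_wpM2r// -real_normK ?num_real// -[leRHS]real_normK ?num_real//.
  by rewrite lerXn2r// ?nnegrE// sin_scaled_le.
(* Both bases have modulus at most 1 and differ by at most [c^2], so with [N = n.+1] the powers
   differ by at most [N^2 c^2 = (N^2 c)^2 / N^2], where [N^2 c <= C]. *)
have diff n : `|cos (t / n.+1%:R) ^+ (n.+1 ^ 2) - expR (- (2 * s n ^+ 2))| <=
    C ^+ 2 / n.+1%:R.
  have -> : expR (- (2 * s n ^+ 2)) = expR (- c n) ^+ (n.+1 ^ 2).
    by rewrite -expRM_natl mulrN sc.
  apply: le_trans (expr_sub_le _ _ _) _; first exact: cos_max.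
    by rewrite ger0_norm ?expR_ge0// -[leRHS]expR0 ler_expR oppr_le0.
  rewrite cosE distrC ger0_norm; last by have := expR_ge1Dx (- c n); lra.
  have le1 : expR (- c n) - (1 - c n) <= c n ^+ 2.
    rewrite expRN; apply: (@le_trans _ _ ((1 + c n)^-1 - (1 - c n))).
      by rewrite lerD2r lef_pV2 ?posrE ?expR_gt0 ?expR_ge1Dx//; have := c0 n; lra.
    rewrite -(ler_pM2l (_ : 0 < 1 + c n)); last by have := c0 n; lra.
    rewrite mulrBr mulfV; last by apply: lt0r_neq0; have := c0 n; lra.
    have : 0 <= c n * c n * c n by apply: mulr_ge0; [apply: mulr_ge0|]; exact: c0.
    rewrite expr2; lra.
  apply: (@le_trans _ _ ((n.+1 ^ 2)%:R * c n ^+ 2)); first by rewrite ler_wpM2l.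
  have N0 : 0 < n.+1%:R :> R by [].
  have -> : (n.+1 ^ 2)%:R * c n ^+ 2 = ((n.+1 ^ 2)%:R * c n) ^+ 2 / n.+1%:R ^+ 2.
    by rewrite natrX; field; rewrite nat1r.
  rewrite sc; apply: ler_pM.
  - exact: sqr_ge0.
  - by rewrite invr_ge0 sqr_ge0.
  - by rewrite lerXn2r// ?nnegrE// mulr_ge0// sqr_ge0.
  - by rewrite lef_pV2 ?posrE ?exprn_gt0// ler_eXnr// ler1n.
have d0 : C ^+ 2 / n.+1%:R @[n --> \oo] --> (0 : R).
  rewrite -(mulr0 (C ^+ 2)); apply: cvgM; first exact: cvg_cst.
  exact: cvg_harmonic.
apply: (@squeeze_cvgr _ _ _ _ (fun n => expR (- (2 * s n ^+ 2)) - C ^+ 2 / n.+1%:R)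
  (fun n => expR (- (2 * s n ^+ 2)) + C ^+ 2 / n.+1%:R)).
- by apply: nearW => n; rewrite -ler_distl; exact: diff.
- by rewrite -[X in _ --> X]subr0; exact: cvgB.
- by rewrite -[X in _ --> X]addr0; exact: cvgD.
Qed.

(** The exponent lowered by one comes from differentiating the power in [cosX_cvg]; the missing
    cosine factor tends to 1. *)
Lemma cosX_pred_cvg (t : R) :
  cos (t / k.+1%:R) ^+ (k.+1 ^ 2).-1 @[k --> \oo] --> expR (- (t ^+ 2 / 2)).
Proof.
pose C k := cos (t / k.+1%:R).
have c1 : 1 - C k @[k --> \oo] --> (0 : R).
  rewrite -(subrr (1 : R)); apply: cvgB; first exact: cvg_cst.
  rewrite -[L in _ --> L]cos0; apply: continuous_cvg; first exact: continuous_cos.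
  rewrite -(mulr0 t); apply: cvgM; [exact: cvg_cst|exact: cvg_harmonic].
have nc : `|1 - C k| @[k --> \oo] --> (0 : R).
  by rewrite -(normr0 R); apply: cvg_norm.
have key k : `|C k ^+ (k.+1 ^ 2).-1 - C k ^+ (k.+1 ^ 2)| <= `|1 - C k|.
  rewrite -[in X in _ - X](@prednK (k.+1 ^ 2)) ?expn_gt0//.
  by rewrite exprSr -[X in X - _]mulr1 -mulrBr normrM ler_piMl// normrX exprn_ile1// cos_max.
have c2 := @cosX_cvg t.
apply: (@squeeze_cvgr _ _ _ _ (fun k => C k ^+ (k.+1 ^ 2) - `|1 - C k|)
  (fun k => C k ^+ (k.+1 ^ 2) + `|1 - C k|)).
- by apply: nearW => k; rewrite -ler_distl; exact: key.
- by rewrite -[L in _ --> L]subr0; exact: cvgB.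
- by rewrite -[L in _ --> L]addr0; exact: cvgD.
Qed.

End Limits.

(** * Stein's identity for Gaussian vectors *)

Section DotProduct.
Context (R : realType).

Definition dotv n (a x : 'cV[R]_n) : R := (a^T *m x) ord0 ord0.

Lemma dotvE n (a x : 'cV[R]_n) : dotv a x = \sum_i a i ord0 * x i ord0.
Proof. by rewrite /dotv mxE; apply: eq_bigr => i _; rewrite mxE. Qed.

Lemma dotvC n (a x : 'cV[R]_n) : dotv a x = dotv x a.
Proof. by rewrite !dotvE; apply: eq_bigr => i _; rewrite mulrC. Qed.

Lemma dotvDl n (a b x : 'cV[R]_n) : dotv (a + b) x = dotv a x + dotv b x.
Proof. by rewrite /dotv linearD mulmxDl mxE. Qed.

Lemma dotvDr n (a x y : 'cV[R]_n) : dotv a (x + y) = dotv a x + dotv a y.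
Proof. by rewrite /dotv mulmxDr mxE. Qed.

Lemma dotvZl n (k : R) (a x : 'cV[R]_n) : dotv (k *: a) x = k * dotv a x.
Proof. by rewrite /dotv linearZ/= -scalemxAl mxE. Qed.

Lemma dotvZr n (k : R) (a x : 'cV[R]_n) : dotv a (k *: x) = k * dotv a x.
Proof. by rewrite dotvC dotvZl dotvC. Qed.

Lemma dotvNl n (a x : 'cV[R]_n) : dotv (- a) x = - dotv a x.
Proof. by rewrite -scaleN1r dotvZl mulN1r. Qed.

Lemma dotvNr n (a x : 'cV[R]_n) : dotv a (- x) = - dotv a x.
Proof. by rewrite dotvC dotvNl dotvC. Qed.

Lemma dotv0l n (x : 'cV[R]_n) : dotv 0 x = 0.
Proof. by rewrite -(scale0r 0) dotvZl mul0r. Qed.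

Lemma dotv_delta n i (x : 'cV[R]_n) : dotv (delta_mx i ord0) x = x i ord0.
Proof.
rewrite dotvE (bigD1 i)//= mxE !eqxx mul1r big1 ?addr0// => j ji.
by rewrite mxE (negbTE ji) mul0r.
Qed.

Lemma mulmx_delta m n (A : 'M[R]_(m, n)) i j :
  (A *m delta_mx j (ord0 : 'I_1)) i ord0 = A i j.
Proof.
rewrite mxE (bigD1 j)//= mxE !eqxx mulr1 big1 ?addr0// => k kj.
by rewrite mxE (negbTE kj) mulr0.
Qed.

Lemma dotv_mulmx m n (A : 'M[R]_(m, n)) a x : dotv a (A *m x) = dotv (A^T *m a) x.
Proof. by rewrite /dotv trmx_mul trmxK mulmxA. Qed.

End DotProduct.

Section Stein.
Context (R : realType) (d : measure_display) (Om : measurableType d)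
  (P : probability Om R) (n : nat) (X : Om -> 'cV[R]_n) (S : 'M[R]_n).
Hypothesis mX : forall i, measurable_fun setT (fun o => X o i ord0).
Hypothesis gX : gaussian0 P X S.
Hypothesis sS : S^T = S.

Let q (a : 'cV[R]_n) : R := dotv a (S *m a).

Lemma measurable_dotv a : measurable_fun setT (fun o => dotv a (X o)).
Proof.
under eq_fun do rewrite dotvE.
by apply: measurable_sum => i; apply: measurable_funM => //; exact: measurable_cst.
Qed.

Let mcos a (th : R) : measurable_fun setT (fun o => cos (dotv a (X o) + th)).
Proof.
apply: measurableT_comp; first by apply: continuous_measurable_fun; exact: continuous_cos.
by apply: measurable_funD; [exact: measurable_dotv|exact: measurable_cst].
Qed.

Let Icos a (th : R) : integ P (fun o => cos (dotv a (X o) + th)).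
Proof. by apply: (@integ_bounded _ _ _ _ _ 1 (mcos a th)) => o; exact: cos_max. Qed.

Let mean_cos a (th : R) :
  mean P (fun o => cos (dotv a (X o) + th)) = cos th * expR (- q a / 2).
Proof.
have [c s] := gX a.
have Ic : integ P (fun o => cos (dotv a (X o))).
  by have := Icos a 0; under eq_fun do rewrite addr0.
have Is : integ P (fun o => sin (dotv a (X o))).
  by have := Icos a (- (pi / 2)); under eq_fun do rewrite cosBpihalf.
have -> : (fun o => cos (dotv a (X o) + th)) =
    (fun o => cos th * cos (dotv a (X o)) + (- sin th) * sin (dotv a (X o))).
  by apply/funext => o; rewrite cosD; ring.
rewrite meanD ?meanZ//; try exact: integZ.
have -> : mean P (fun o => cos (dotv a (X o))) = expR (- q a / 2).
  by rewrite /mean /Rintegral /dotv c/= /q /dotv mulmxA.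
have -> : mean P (fun o => sin (dotv a (X o))) = 0.
  by rewrite /mean /Rintegral /dotv s.
by rewrite mulr0 addr0.
Qed.

Let q_shift a i (t : R) : q (a + t *: delta_mx i ord0) =
  q a + 2 * t * (S *m a) i ord0 + t ^+ 2 * S i i.
Proof.
rewrite /q mulmxDr -scalemxAr !dotvDl !dotvDr !dotvZl !dotvZr !dotv_delta.
rewrite (dotv_mulmx S a (delta_mx i ord0)) sS (dotvC (S *m a)) dotv_delta.
rewrite mulmx_delta.
ring.
Qed.

(** The characteristic function gives no moment directly. With [N = k.+1], [f k] equals
    [2 N^2 (1 - cos (X_i / N))], whose mean is at most [S i i] and which converges to [X_i^2].
    Fatou's lemma bounds the second moment, hence the first is finite. *)
Lemma gaussian_integ i : integ P (fun o => X o i ord0).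
Proof.
pose f (k : nat) o := (2 * k.+1%:R * sin (X o i ord0 / 2 / k.+1%:R)) ^+ 2.
have fE k : f k = fun o => 2 * k.+1%:R ^+ 2 * 1 + (- (2 * k.+1%:R ^+ 2)) *
    cos (dotv (k.+1%:R^-1 *: delta_mx i ord0) (X o) + 0).
  apply/funext => o; rewrite addr0 dotvZl dotv_delta.
  have -> : k.+1%:R^-1 * X o i ord0 = X o i ord0 / 2 / k.+1%:R + X o i ord0 / 2 / k.+1%:R.
    by field; rewrite nat1r.
  by rewrite cosD -!expr2 cos2sin2 /f; ring.
have If k : integ P (f k).
  by rewrite fE; apply: integD; [exact: integ_cst|exact: integZ].
have fle k : mean P (f k) <= S i i.
  rewrite fE meanD; [|exact: integ_cst|exact: integZ].
  rewrite mean_cst meanZ// mean_cos cos0 mul1r -[_ *: _]add0r q_shift.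
  rewrite /q dotv0l mulmx0 mxE mulr0 !add0r.
  have N0 : 0 < k.+1%:R :> R by [].
  have := expR_ge1Dx (- (k.+1%:R^-1 ^+ 2 * S i i) / 2).
  set E := expR _ => Ege.
  have -> : 2 * k.+1%:R ^+ 2 * 1 + - (2 * k.+1%:R ^+ 2) * E =
    2 * k.+1%:R ^+ 2 * (1 - E) by ring.
  rewrite -ler_pdivlMl ?mulr_gt0 ?exprn_gt0//.
  have -> : (2 * k.+1%:R ^+ 2)^-1 * S i i = k.+1%:R^-1 ^+ 2 * S i i / 2.
    by field; rewrite nat1r.
  move: @E Ege => /=; move: (k.+1%:R^-1 ^+ 2 * S i i) => z; move: (expR _) => E; lra.
have fX o : f k o @[k --> \oo] --> (X o i ord0) ^+ 2.
  have c : 2 * k.+1%:R * sin (X o i ord0 / 2 / k.+1%:R) @[k --> \oo] --> X o i ord0.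
    rewrite [X in _ --> X](_ : _ = 2 * (X o i ord0 / 2)); last by field.
    under eq_fun do rewrite -mulrA.
    by apply: cvgM; [exact: cvg_cst|exact: sin_scaled_cvg].
  by rewrite expr2 /f; under eq_fun do rewrite expr2; exact: cvgM.
have mX2 : measurable_fun setT (fun o => (X o i ord0) ^+ 2) by exact: measurable_funX.
have IX2 : integ P (fun o => (X o i ord0) ^+ 2).
  apply/integrableP; split; first exact/measurable_EFinP.
  have mf k : measurable_fun setT (fun o => (f k o)%:E).
    exact/measurable_EFinP/integ_measurable.
  have f0 k o : [set: Om] o -> (0 <= (f k o)%:E)%E by rewrite lee_fin sqr_ge0.
  have := @fatou _ _ _ P setT measurableT _ mf f0.
  under eq_integral => o _.
    rewrite (_ : limn_einf _ = ((X o i ord0) ^+ 2)%:E); last first.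
      have c : (f k o)%:E @[k --> \oo] --> ((X o i ord0) ^+ 2)%:E.
        by apply/cvg_EFin; [exact: nearW|exact: fX].
      rewrite is_cvg_limn_einfE; first exact: cvg_lim c.
      by apply/cvg_ex; eexists; exact: c.
    over.
  move=> le; under eq_integral do rewrite /= ger0_norm ?sqr_ge0//.
  apply: (le_lt_trans le); apply: (@le_lt_trans _ _ (S i i)%:E); last exact: ltry.
  rewrite limn_einf_lim; apply: lime_le; first exact: is_cvg_einfs.
  apply: nearW => k; apply: (@le_trans _ _ (mean P (f k))%:E).
    by apply: ereal_inf_lbound; exists k => //=; rewrite meanE.
  by rewrite lee_fin.
apply: (@integ_le _ _ _ _ _ (fun o => 1 + (X o i ord0) ^+ 2)) => //.
  by apply: integD => //; exact: integ_cst.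
move=> o; move: (X o i ord0) => u.
have u0 := sqr_ge0 u; rewrite [leRHS]ger0_norm; last lra.
rewrite -real_normK ?num_real//; have := sqr_ge0 (`|u| - 1); rewrite sqrrB1.
by have := normr_ge0 u; lra.
Qed.

(** The characteristic function is differentiated under the integral: the difference quotients [D k]
    of [cos (a.X + th)] along the i-th basis vector are dominated by [|X_i|], and their means are
    explicit. *)
Lemma stein a (th : R) i : null P (fun o =>
  X o i ord0 * cos (dotv a (X o) + th) + (S *m a) i ord0 * sin (dotv a (X o) + th)).
Proof.
(* Differentiating a cosine produces this sine form; a phase shift by [pi / 2] exchanges the two. *)
suff H : forall th' : R, null P (fun o =>
    X o i ord0 * sin (dotv a (X o) + th') + (- (S *m a) i ord0) * cos (dotv a (X o) + th')).
  apply: (null_ext (H (th + pi / 2))) => o.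
  by rewrite addrA sinDpihalf cosDpihalf; ring.
move=> {}th; have IX := gaussian_integ i.
pose D (k : nat) o := k.+1%:R *
  (cos (dotv (a + k.+1%:R^-1 *: delta_mx i ord0) (X o) + th) - cos (dotv a (X o) + th)).
(* Writing the difference of cosines as a product makes the bound by [|X_i|] visible. *)
have DE k o : D k o = (- 1) * (k.+1%:R * 2 * sin (X o i ord0 / 2 / k.+1%:R)) *
    sin (dotv a (X o) + th + X o i ord0 / 2 / k.+1%:R).
  rewrite /D dotvDl dotvZl dotv_delta; set u := _ / k.+1%:R.
  have -> : dotv a (X o) + k.+1%:R^-1 * X o i ord0 + th = dotv a (X o) + th + u + u.
    by rewrite /u; field; rewrite nat1r.
  have -> : dotv a (X o) + th = dotv a (X o) + th + u - u by ring.
  move: (dotv a (X o) + th) => v; rewrite cosD [cos (_ - _)]cosB subrK; ring.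
have Db k o : `|D k o| <= `|X o i ord0|.
  rewrite DE normrM -[leRHS]mulr1; apply: ler_pM => //; last exact: sin_max.
  rewrite mulN1r normrN mulrAC normrM [X in _ * X]ger0_norm// -ler_pdivlMr//.
  apply: le_trans (sin_scaled_le _ _) _.
  by rewrite normrM [X in _ * X]ger0_norm ?invr_ge0.
have Dc o : D k o @[k --> \oo] --> - (X o i ord0 * sin (dotv a (X o) + th)).
  under eq_fun do rewrite DE.
  have -> : - (X o i ord0 * sin (dotv a (X o) + th)) =
    -1 * X o i ord0 * sin (dotv a (X o) + th) by ring.
  have c0 : X o i ord0 / 2 / k.+1%:R @[k --> \oo] --> (0 : R).
    rewrite -(mulr0 (X o i ord0 / 2)); apply: cvgM; first exact: cvg_cst.
    exact: cvg_harmonic.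
  apply: cvgM.
    apply: cvgM; first exact: cvg_cst.
    have -> : (fun k => k.+1%:R * 2 * sin (X o i ord0 / 2 / k.+1%:R)) =
      (fun k => 2 * (k.+1%:R * sin (X o i ord0 / 2 / k.+1%:R))).
      by apply/funext => k; ring.
    rewrite [L in _ --> L](_ : _ = 2 * (X o i ord0 / 2)); last by field.
    by apply: cvgM; [exact: cvg_cst|exact: sin_scaled_cvg].
  apply: continuous_cvg; first exact: continuous_sin.
  rewrite -[X in _ --> X]addr0; apply: cvgD => //; exact: cvg_cst.
have ID k : integ P (D k).
  rewrite /D; apply: integZ; apply: integD => //.
  by under eq_fun do rewrite -mulN1r; exact: integZ.
have [Is cs] := mean_dominated (fun k => integ_measurable (ID k)) (integ_norm IX) Db Dc.
have mD k : mean P (D k) = cos th * expR (- q a / 2) * (k.+1%:R *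
    (expR (- (k.+1%:R^-1 * (S *m a) i ord0) - k.+1%:R^-1 ^+ 2 * S i i / 2) - 1)).
  rewrite /D meanZ; last first.
    apply: integD => //.
    by under eq_fun do rewrite -mulN1r; exact: integZ.
  rewrite [mean P _](_ : _ = mean P (fun o =>
    cos (dotv (a + k.+1%:R^-1 *: delta_mx i ord0) (X o) + th) +
    (-1) * cos (dotv a (X o) + th))); last first.
    by congr (mean P _); apply/funext => o; rewrite mulN1r.
  rewrite meanD//; last exact: integZ.
  rewrite meanZ// !mean_cos q_shift.
  rewrite (_ : - (q a + _ + _) / 2 = - q a / 2 + (- (k.+1%:R^-1 * (S *m a) i ord0)
     - k.+1%:R^-1 ^+ 2 * S i i / 2)); last by field; rewrite nat1r.
  by rewrite expRD; ring.
have lim2 : mean P (D k) @[k --> \oo] -->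
    cos th * expR (- q a / 2) * (- (S *m a) i ord0).
  under eq_fun do rewrite mD.
  apply: cvgM; first exact: cvg_cst.
  apply: expR_scaled_cvg.
  have -> : (fun k => k.+1%:R * (- (k.+1%:R^-1 * (S *m a) i ord0) - k.+1%:R^-1 ^+ 2 * S i i / 2))
     = (fun k => - (S *m a) i ord0 - (S i i / 2) * k.+1%:R^-1).
    by apply/funext => k; field; rewrite nat1r.
  rewrite -[X in _ --> X]subr0 -(mulr0 (S i i / 2)).
  apply: cvgB; first exact: cvg_cst.
  by apply: cvgM; [exact: cvg_cst|exact: cvg_harmonic].
have e : mean P (fun o => - (X o i ord0 * sin (dotv a (X o) + th))) =
    cos th * expR (- q a / 2) * (- (S *m a) i ord0).
  by rewrite -(cvg_lim _ cs)// (cvg_lim _ lim2).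
have Is' : integ P (fun o => X o i ord0 * sin (dotv a (X o) + th)).
  have := integZ (-1) Is; rewrite (_ : (fun o => _) = (fun o =>
    X o i ord0 * sin (dotv a (X o) + th)))//.
  by apply/funext => o; rewrite mulN1r opprK.
split; first by apply: integD => //; exact: integZ.
rewrite meanD//; last exact: integZ.
rewrite meanZ// mean_cos.
have : mean P (fun o => -1 * (X o i ord0 * sin (dotv a (X o) + th))) =
    cos th * expR (- q a / 2) * (- (S *m a) i ord0).
  by rewrite -e; congr (mean P _); apply/funext => o; rewrite mulN1r.
rewrite meanZ// mulN1r => /eqP; rewrite eqr_oppLR => /eqP ->; ring.
Qed.

End Stein.

(** * Quadratic exponential weights *)

Section PsdSquares.
Context (R : realType).

Lemma quadE n (Y : 'M[R]_n) u : (u^T *m Y *m u) ord0 ord0 = dotv u (Y *m u).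
Proof. by rewrite /dotv mulmxA. Qed.

Lemma dotv_sym n (Y : 'M[R]_n) u v : Y^T = Y -> dotv u (Y *m v) = dotv v (Y *m u).
Proof. by move=> sY; rewrite dotv_mulmx sY dotvC. Qed.

Lemma psd_diag_ge0 n (Y : 'M[R]_n) i : psd Y -> 0 <= Y i i.
Proof.
by move=> [_ /(_ (delta_mx i ord0))]; rewrite quadE dotv_delta mulmx_delta.
Qed.

Lemma psd_quad_delta n (Y : 'M[R]_n) u i (t : R) : Y^T = Y ->
  dotv (u + t *: delta_mx i ord0) (Y *m (u + t *: delta_mx i ord0)) =
  dotv u (Y *m u) + 2 * t * (Y *m u) i ord0 + t ^+ 2 * Y i i.
Proof.
move=> sY; rewrite mulmxDr -scalemxAr !dotvDl !dotvDr !dotvZl !dotvZr.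
rewrite (dotv_sym u (delta_mx i ord0)) // !dotv_delta mulmx_delta; ring.
Qed.

(** With zero diagonal, the form at [e_j + t e_i] is [2 t Y_ij], linear in [t] yet nonnegative;
    [t = - Y_ij] forces the entry to vanish. *)
Lemma psd_diag0 n (Y : 'M[R]_n) : psd Y -> (forall i, Y i i = 0) -> Y = 0.
Proof.
move=> [sY pY] Y0; apply/matrixP => j i; rewrite mxE.
have H t : 0 <= 2 * t * Y i j.
  have := pY (delta_mx j ord0 + t *: delta_mx i ord0).
  by rewrite quadE psd_quad_delta// dotv_delta !mulmx_delta !Y0 mulr0 add0r addr0.
have e : Y j i = Y i j by rewrite -[in LHS]sY mxE.
have := H (- Y i j); have := sqr_ge0 (Y i j) => h1 h2.
apply/eqP; rewrite e -sqrf_eq0 eq_le h1 andbT; lra.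
Qed.

Lemma dotv_outer n (l u : 'cV[R]_n) : l *m l^T *m u = dotv l u *: l.
Proof. by rewrite -mulmxA [l^T *m u]mx11_scalar mul_mx_scalar. Qed.

(* Gaussian elimination on the diagonal: subtracting the square of a row clears
   that row and keeps the matrix positive semidefinite. *)
Lemma psd_sum_squares n (Y : 'M[R]_n) : psd Y ->
  exists L : seq 'cV[R]_n, Y = \sum_(l <- L) l *m l^T.
Proof.
move=> pY; have : forall i, i \notin enum 'I_n -> Y i i = 0.
  by move=> i; rewrite mem_enum.
elim: (enum 'I_n) Y pY => [|i s IH] Y pY Y0.
  by exists [::]; rewrite big_nil; apply: psd_diag0 => // i; exact: Y0.
have [Yi0|Yi0] := eqVneq (Y i i) 0.
  apply: IH => // j js; have [->//|ji] := eqVneq j i.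
  by apply: Y0; rewrite inE negb_or ji.
have Yi : 0 < Y i i by rewrite lt_neqAle eq_sym Yi0 psd_diag_ge0.
have [sY qY] := pY.
pose l : 'cV[R]_n := (Num.sqrt (Y i i))^-1 *: (Y *m delta_mx i ord0).
have lu u : dotv l u = (Num.sqrt (Y i i))^-1 * (Y *m u) i ord0.
  by rewrite /l dotvZl dotvC dotv_sym// dotv_delta.
have sq : (Num.sqrt (Y i i))^-1 ^+ 2 = (Y i i)^-1 by rewrite exprVn sqr_sqrtr ?ltW.
have pY1 : psd (Y - l *m l^T).
  split; first by rewrite linearB/= trmx_mul trmxK sY.
  move=> u; rewrite quadE mulmxBl dotv_outer dotvDr dotvNr dotvZr (dotvC u l) -expr2 lu.
  rewrite exprMn sq.
  (* The coefficient minimizes the form of [Y] along [u + t e_i], and the minimum is the form of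
     [Y - l l^T] at [u]. *)
  have := qY (u + (- (Y *m u) i ord0 / Y i i) *: delta_mx i ord0).
  rewrite quadE psd_quad_delta//; move: (dotv u (Y *m u)) ((Y *m u) i ord0) => a b.
  rewrite (_ : a + _ + _ = a - (Y i i)^-1 * b ^+ 2)//; field.
  exact: Yi0.
have diagE (u : 'cV[R]_n) j : (Y - u *m u^T) j j = Y j j - (u j ord0) ^+ 2.
  by rewrite !mxE big_ord1 !mxE -expr2.
have [j js|L YL] := IH _ pY1; last first.
  by exists (l :: L); rewrite big_cons -YL addrC subrK.
apply/eqP; rewrite eq_le psd_diag_ge0// andbT diagE.
have [->|ji] := eqVneq j i.
  rewrite -(dotv_delta i l) dotvC lu mulmx_delta exprMn sq expr2 mulKf//.
  by rewrite subrr.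
by rewrite Y0 ?inE ?negb_or ?ji// sub0r oppr_le0 sqr_ge0.
Qed.

End PsdSquares.

(** * Stein's identity under Gaussian reweighting *)

Section GaussianWeight.
Context (R : realType) (d : measure_display) (Om : measurableType d)
  (P : probability Om R) (G : set (set Om)) (n m : nat).
Variables (x : Om -> 'cV[R]_n) (y : Om -> 'cV[R]_m) (xi : Om -> R)
  (al : Om -> 'cV[R]_n) (be : Om -> 'cV[R]_m).
Hypothesis Gm : G `<=` measurable.
Hypothesis Ixi : integ P xi.
Hypothesis Iy : forall i, integ P (fun o => y o i ord0).
Hypothesis bal : forall i, bm G (fun o => al o i ord0).
Hypothesis bbe : forall i, bm G (fun o => be o i ord0).

Let phi a b (th : R) o := dotv a (x o) + dotv b (y o) + th.
Let kap a b o := dotv (al o) a + dotv (be o) b.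

(** Stein's identity for [xi] against [cos (phi) * g], where [dg] stands for the gradient of the
    weight [g] in [y], and [al], [be] for the conditional covariances of [xi] with [x] and [y]. No
    differentiability is imposed: [g] and [dg] are carried along as a pair, so that limits can be
    taken in both. *)
Definition weighted_stein (g : Om -> R) (dg : Om -> 'cV[R]_m) : Prop :=
  forall h, bm G h -> forall a b (th : R), null P (fun o => h o *
    (xi o * cos (phi a b th o) * g o + kap a b o * sin (phi a b th o) * g o
     - dotv (be o) (dg o) * cos (phi a b th o))).

Lemma weighted_stein_ext g dg g' dg' : weighted_stein g dg ->
  (forall o, g o = g' o) -> (forall o, dg o = dg' o) -> weighted_stein g' dg'.
Proof.
move=> W gg' dd' h bh a b th; apply: (null_ext (W h bh a b th)) => o.
by rewrite gg' dd'.
Qed.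

(** By product-to-sum, a cosine factor in the weight is the average of the identities at frequencies
    [b + c] and [b - c]. *)
Lemma weighted_stein_cos g dg c : weighted_stein g dg ->
  weighted_stein (fun o => g o * cos (dotv c (y o)))
    (fun o => cos (dotv c (y o)) *: dg o - (sin (dotv c (y o)) * g o) *: c).
Proof.
move=> W h bh a b th.
apply: (null_ext (nullZ (1 / 2) (nullD (W h bh a (b + c) th) (W h bh a (b - c) th)))) => o.
have -> : phi a (b + c) th o = phi a b th o + dotv c (y o).
  by rewrite /phi dotvDl; ring.
have -> : phi a (b - c) th o = phi a b th o - dotv c (y o).
  by rewrite /phi dotvDl dotvNl; ring.
by rewrite /kap !dotvDr !dotvNr !dotvZr cosD cosB sinD sinB; field.
Qed.

Lemma weighted_stein_cosX g dg c N : weighted_stein g dg ->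
  weighted_stein (fun o => g o * cos (dotv c (y o)) ^+ N)
    (fun o => cos (dotv c (y o)) ^+ N *: dg o -
      (N%:R * sin (dotv c (y o)) * cos (dotv c (y o)) ^+ N.-1 * g o) *: c).
Proof.
move=> W; elim: N => [|N IH].
  apply: (weighted_stein_ext W) => o; first by rewrite expr0 mulr1.
  by rewrite expr0 scale1r !mul0r scale0r subr0.
apply: (weighted_stein_ext (weighted_stein_cos c IH)) => o.
  by rewrite exprSr mulrA.
move: (cos _) (sin _) => C S; rewrite scalerBr !scalerA -exprS -addrA -opprD -scalerDl.
congr (_ - _ *: _); rewrite -natr1 /=.
case: N {IH} => [|N]; first by rewrite !expr0; ring.
rewrite /= exprS; ring.
Qed.

Let integ_kap a b : integ P (kap a b).
Proof.
rewrite /kap; under eq_fun do rewrite !dotvE.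
apply: (bm_integ P Gm); apply: bmD; apply: bm_sum => i; apply: bmM => //; exact: bm_cst.
Qed.

Lemma weighted_stein_gauss g dg c : weighted_stein g dg ->
  (forall o, `|g o| <= 1) -> integ P (fun o => dotv (be o) (dg o)) ->
  weighted_stein (fun o => g o * expR (- (dotv c (y o) ^+ 2 / 2)))
    (fun o => expR (- (dotv c (y o) ^+ 2 / 2)) *: dg o -
      (dotv c (y o) * expR (- (dotv c (y o) ^+ 2 / 2)) * g o) *: c).
Proof.
move=> W g1 Idg h bh a b th; have [mh [B hB]] := bh.
have Ibcy : integ P (fun o => dotv (be o) c * dotv c (y o)).
  under eq_fun do rewrite (dotvE (be _)).
  apply: (bm_integM (G := G)) => //.
    by apply: bm_sum => i; apply: bmM => //; exact: bm_cst.
  under eq_fun do rewrite dotvE.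
  by apply: integ_sum => i; exact: integZ.
pose e2 t : R := expR (- (t ^+ 2 / 2)).
pose N k : R := k.+1%:R.
pose t o := dotv c (y o).
pose C k o := cos (t o / N k).
pose s k o := N k * sin (t o / N k).
have e2_le1 u : e2 u <= 1.
  by rewrite /e2 -[leRHS]expR0 ler_expR oppr_le0 divr_ge0 ?sqr_ge0.
have cC k o j : `|C k o ^+ j| <= 1 by rewrite normrX exprn_ile1// cos_max.
pose F k o := h o * (xi o * cos (phi a b th o) * (g o * C k o ^+ (k.+1 ^ 2)%N)
  + kap a b o * sin (phi a b th o) * (g o * C k o ^+ (k.+1 ^ 2)%N)
  - (C k o ^+ (k.+1 ^ 2)%N * dotv (be o) (dg o)
     - s k o * C k o ^+ (k.+1 ^ 2).-1 * g o * dotv (be o) c) * cos (phi a b th o)).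
have nF k : null P (F k).
  apply: (null_ext (weighted_stein_cosX ((N k)^-1 *: c) (k.+1 ^ 2) W bh a b th)) => o.
  rewrite /F /s /C !dotvDr !dotvNr !dotvZr dotvZl -/(t o) [(N k)^-1 * t o]mulrC natrX -/(N k).
  have : N k != 0 by rewrite pnatr_eq0.
  move: (N k) (cos (t o / N k) ^+ _) (cos (t o / N k) ^+ _) (sin (t o / N k)).
  by move=> N1 C1 C2 S1 N10; field.
pose D o := B * (`|xi o| + `|kap a b o| +
  (`|dotv (be o) (dg o)| + `|dotv (be o) c * t o|)).
have ID : integ P D.
  by apply: integZ; do 2? apply: integD; do ? apply: integD; apply: integ_norm.
apply: (null_lim nF ID) => [k o|o].
  rewrite /F /D normrM; apply: ler_pM => //.
  have cosb := cos_max (phi a b th o); have sinb := sin_max (phi a b th o).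
  have gC : `|g o * C k o ^+ (k.+1 ^ 2)| <= 1 by rewrite normrM mulr_ile1.
  apply: le_trans (ler_normB _ _) (lerD (le_trans (ler_normD _ _) (lerD _ _)) _).
  - by rewrite !normrM -mulrA ler_piMr// mulr_ile1// -normrM.
  - by rewrite !normrM -mulrA ler_piMr// mulr_ile1// -normrM.
  - rewrite normrM; apply: le_trans (ler_piMr _ cosb) _ => //.
    apply: le_trans (ler_normB _ _) (lerD _ _); first by rewrite normrM ler_piMl.
    rewrite mulrC !normrM -!mulrA ler_wpM2l//.
    apply: le_trans (sin_scaled_le k (t o)); rewrite -normrM -/(s k o).
    by rewrite mulrA -normrM ler_piMr// normrM mulr_ile1.
have cs : s k o @[k --> \oo] --> t o by exact: sin_scaled_cvg.
have cC1 : C k o ^+ (k.+1 ^ 2)%N @[k --> \oo] --> e2 (t o) by exact: cosX_cvg.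
have cC2 : C k o ^+ (k.+1 ^ 2).-1 @[k --> \oo] --> e2 (t o) by exact: cosX_pred_cvg.
rewrite !dotvDr !dotvNr !dotvZr -/(t o) -/(e2 (t o)).
apply: cvgM; first exact: cvg_cst.
apply: cvgB; last first.
  apply: cvgM; last exact: cvg_cst.
  apply: cvgB; first by apply: cvgM => //; exact: cvg_cst.
  apply: cvgM; last exact: cvg_cst.
  by apply: cvgM; [exact: cvgM|exact: cvg_cst].
by apply: cvgD; apply: cvgM; (try exact: cvg_cst);
  apply: cvgM => //; exact: cvg_cst.
Qed.

(** The exponential factors over the squares [(l.y)^2], which are introduced one at a time; the
    gradients add up to [- Y y] times the weight. *)
Lemma weighted_stein_sum_squares (L : seq 'cV[R]_m) (Y : 'M[R]_m) :
  Y = \sum_(l <- L) l *m l^T -> weighted_stein (fun=> 1) (fun=> 0) ->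
  weighted_stein (fun o => expR (- (dotv (y o) (Y *m y o) / 2)))
    (fun o => - (expR (- (dotv (y o) (Y *m y o) / 2)) *: (Y *m y o))).
Proof.
move=> -> W1; elim: L => [|l L IH].
  apply: (weighted_stein_ext W1) => o.
    by rewrite big_nil mul0mx dotvC dotv0l mul0r oppr0 expR0.
  by rewrite big_nil mul0mx scaler0 oppr0.
set Y' := \sum_(l <- L) _ in IH *.
have q0 o : 0 <= dotv (y o) (Y' *m y o).
  rewrite /Y'; elim: L {IH Y'} => [|k L IHL].
    by rewrite big_nil mul0mx dotvC dotv0l.
  by rewrite big_cons mulmxDl dotvDr dotv_outer dotvZr dotvC -expr2 addr_ge0 ?sqr_ge0.
have g1 o : expR (- (dotv (y o) (Y' *m y o) / 2)) <= 1.
  by rewrite -[leRHS]expR0 ler_expR oppr_le0 divr_ge0.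
have Ib : integ P (fun o => dotv (be o)
    (- (expR (- (dotv (y o) (Y' *m y o) / 2)) *: (Y' *m y o)))).
  have Idot : integ P (fun o => dotv (be o) (Y' *m y o)).
    under eq_fun do rewrite dotvE.
    apply: integ_sum => i; apply: (bm_integM (G := G)) => //.
    under eq_fun do rewrite mxE.
    by apply: integ_sum => j; exact: integZ.
  under eq_fun do rewrite dotvNr dotvZr -mulNr.
  apply: (@integM _ _ _ _ _ _ 1) => // [|o]; last first.
    by rewrite normrN ger0_norm ?expR_ge0.
  have my i : msub measurable (fun o => y o i ord0).
    apply/msubE => [|S mS]; first exact: sigma_algebra_measurable.
    by rewrite -[_ @^-1` _]setTI; exact: (integ_measurable (Iy i)).
  apply: (msub_measurable (@subset_refl _ measurable)).
  apply: msubN; apply: msub_expR; apply: msubN; apply: msubM; last exact: msub_cst.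
  under eq_fun do rewrite dotvE.
  apply: msub_sum => i; apply: msubM => //.
  under eq_fun do rewrite mxE.
  by apply: msub_sum => j; apply: msubM => //; exact: msub_cst.
have g1' o : `|expR (- (dotv (y o) (Y' *m y o) / 2))| <= 1.
  by rewrite ger0_norm ?expR_ge0.
have eE o : expR (- (dotv (y o) (Y' *m y o) / 2)) * expR (- (dotv l (y o) ^+ 2 / 2)) =
    expR (- (dotv (y o) ((\sum_(l <- l :: L) l *m l^T) *m y o) / 2)).
  rewrite big_cons mulmxDl dotvDr dotv_outer dotvZr (dotvC (y o) l) -expr2 -expRD.
  by congr expR; rewrite -/Y'; field.
apply: (weighted_stein_ext (weighted_stein_gauss l IH g1' Ib)) => o; first exact: eE.
rewrite -eE big_cons mulmxDl dotv_outer -/Y' scalerDr !scalerA scalerN !scalerA.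
rewrite opprD addrC; congr (- (_ *: _) - _ *: _); ring.
Qed.


End GaussianWeight.

(** * Randomized thresholds *)

Section UniformThreshold.
Context (R : realType) (d : measure_display) (Om : measurableType d)
  (P : probability Om R).

(** The variant of [indep_null] in which the centred factor is the bounded one; subtracting its mean
    from [F] reduces to that case. *)
Lemma indep_null_bm (G H : set (set Om)) (F Z : Om -> R) :
  G `<=` measurable -> H `<=` measurable -> indep P G H ->
  integ P F -> msub G F -> bm H Z -> null P Z -> null P (fun o => F o * Z o).
Proof.
move=> Gm Hm GH IF mF bZ nZ.
have nF : null P (fun o => F o - mean P F).
  split; first by apply: integD => //; exact: integ_cst.
  by rewrite meanD ?mean_cst ?subrr//; exact: integ_cst.
have mF' : msub G (fun o => F o - mean P F) by apply: msubB => //; exact: msub_cst.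
apply: (null_ext (nullD (indep_null Gm Hm GH nF mF' bZ) (nullZ (mean P F) nZ))) => o.
ring.
Qed.

Lemma uniform01_gt (z : Om -> R) (a : R) : measurable_fun setT z ->
  uniform01 P z -> 0 <= a <= 1 ->
  null P (fun o => (a < z o)%R%:R - (1 - a)).
Proof.
move=> mz uz /andP[a0 a1].
have e : (fun o => (a < z o)%R%:R : R) = \1_(z @^-1` `]a, +oo[).
  apply/funext => o; rewrite indicE; congr (nat_of_bool _)%:R.
  by apply/idP/idP => [H|]; rewrite inE/= in_itv/= andbT.
have mB : measurable (z @^-1` `]a, +oo[).
  by rewrite -[X in measurable X]setTI; apply: mz => //; exact: measurable_itv.
have Ie : integ P (fun o => (a < z o)%R%:R) by rewrite e; exact: integ_indic.
split; first by apply: integD => //; exact: integ_cst.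
rewrite meanD//; last exact: integ_cst.
rewrite mean_cst e mean_indic// uz; last exact: measurable_itv.
have -> : `]a, +oo[ `&` `[0, 1] = `]a, 1]%classic :> set R.
  apply/seteqP; split => u /=; rewrite !in_itv/= andbT.
    by move=> [-> /andP[_ ->]].
  by move=> /andP[au ->]; rewrite au andbT (ltW (le_lt_trans a0 au)).
rewrite lebesgue_measure_itv/= lte_fin; move: a1; rewrite le_eqVlt => /predU1P[->|a1].
  by rewrite ltxx/=; ring.
by rewrite a1/=; ring.
Qed.

(* Discretize the threshold [U] from above; each discretized event factorizes by
   independence. *)
Lemma uniform_threshold (G H : set (set Om)) (z U F : Om -> R) :
  G `<=` measurable -> H `<=` measurable -> indep P G H ->
  msub H z -> uniform01 P z -> msub G U -> (forall o, 0 <= U o <= 1) ->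
  integ P F -> msub G F ->
  null P (fun o => F o * ((U o < z o)%R%:R - (1 - U o))).
Proof.
move=> Gm Hm GH mz uz mU U01 IF mF.
pose c (N : nat) o : nat := (\sum_(i < N.+1) ((i%:R < N.+1%:R * U o)%R : nat))%N.
have cR N o : (c N o)%:R = \sum_(i < N.+1) (i%:R < N.+1%:R * U o)%R%:R :> R.
  by rewrite /c natr_sum.
pose q N o : R := (c N o)%:R / N.+1%:R.
have cN N o : (c N o < N.+2)%N.
  rewrite ltnS /c -[leqRHS](card_ord N.+1) -sum1_card leq_sum// => i _.
  by case: (_ < _).
have qU N o : U o <= q N o <= U o + N.+1%:R^-1.
  have N0 : 0 < N.+1%:R :> R by [].
  have /andP[U0 U1] := U01 o.
  have := @count_lt_bounds R N.+1 (N.+1%:R * U o).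
  rewrite -cR mulr_ge0//= ler_piMr// => /(_ isT) /andP[h1 h2].
  rewrite /q ler_pdivlMr// mulrC h1/= ler_pdivrMr// mulrDl mulVf ?lt0r_neq0//.
  by rewrite [U o * _]mulrC.
pose ind N (j : nat) o : R := ((c N o)%:R == j%:R :> R)%:R.
have mind N j : bm G (ind N j).
  split; last by exists 1 => o; rewrite /ind; case: (_ == _); rewrite ?normr1 ?normr0.
  have mc : msub G (fun o => (c N o)%:R : R).
    under eq_fun do rewrite cR.
    apply: msub_sum => i; apply: msub_lt; first exact: msub_cst.
    by apply: msubM => //; exact: msub_cst.
  have mb : measurable_fun setT
    ((fun o => (c N o)%:R == j%:R :> R) : g_sigma_algebraType G -> bool).
    by apply: measurable_fun_eqr => //; exact: measurable_cst.
  by apply: (@measurableT_comp _ _ _ _ _ _ (fun b : bool => b%:R : R) _ _ _ mb).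
(* The ceiling [c N] takes the [N.+2] values [0, ..., N.+1]. Splitting along them freezes the
   threshold at [j / N.+1], where the law of [z] applies. *)
pose T N o := \sum_(j < N.+2) (F o * ind N j o) *
  ((j%:R / N.+1%:R < z o)%R%:R - (1 - j%:R / N.+1%:R)).
have mz' : measurable_fun setT z by exact: msub_measurable mz.
have nT N : null P (T N).
  apply: null_sum => j; apply: (indep_null_bm Gm Hm GH).
  - have := bm_integM Gm (mind N j) IF; rewrite (_ : (fun o => _) = fun o => F o * ind N j o)//.
    by apply/funext => o; rewrite mulrC.
  - by apply: msubM => //; exact: (mind N j).1.
  - apply: bmD; last exact: bm_cst.
    by apply: bm_lt => //; exact: msub_cst.
  apply: uniform01_gt => //; rewrite divr_ge0//= ler_pdivrMr// mul1r ler_nat.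
  by rewrite -ltnS.
have TE N o : T N o = F o * ((q N o < z o)%R%:R - (1 - q N o)).
  rewrite /T (bigD1 (Ordinal (cN N o)))//= {1}/ind eqxx mulr1 -/(q N o) big1 ?addr0//.
  move=> j jc; rewrite /ind eqr_nat; case: eqP => [e|_]; last by rewrite mulr0 mul0r.
  by move/eqP: jc => []; apply/val_inj; rewrite /= e.
apply: (null_lim nT (integZ 2 (integ_norm IF))) => [N o|o].
  rewrite TE normrM mulrC ler_wpM2r//.
  have /andP[q0 q1] : 0 <= q N o <= 1.
    rewrite /q divr_ge0//= ler_pdivrMr// mul1r ler_nat -ltnS; exact: cN.
  by rewrite ler_norml; apply/andP; split; case: (_ < _) => /=; lra.
under eq_fun do rewrite TE.
have cq : q N o @[N --> \oo] --> U o.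
  apply: (@squeeze_cvgr _ _ _ _ (fun=> U o) (fun N => U o + N.+1%:R^-1)).
  - exact: nearW.
  - exact: cvg_cst.
  - rewrite -[L in _ --> L]addr0; apply: cvgD; first exact: cvg_cst.
    exact: cvg_harmonic.
apply: cvgM; first exact: cvg_cst.
apply: cvgB; last by apply: cvgB => //; exact: cvg_cst.
(* Here the approximation from above matters: if [z <= U], ties included, then [z <= q N] for every
   [N], so the strict comparison stays false. *)
apply: cvg_near_cst; have [Uz|zU] := ltP (U o) (z o).
  by near=> N; rewrite (_ : q N o < z o)//; near: N; exact: (cvgr_lt _ cq).
apply: nearW => N; have /andP[h _] := qU N o.
by rewrite ltNge (le_trans zU h).
Unshelve. all: by end_near. Qed.

End UniformThreshold.

(** * Conditional Stein identities and the time update *)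

Section PositiveDefinite.
Context (R : realType).

Lemma pd_unitmx n (M : 'M[R]_n) : pd M -> M \in unitmx.
Proof.
move=> [sM pM]; rewrite -row_free_unit -kermx_eq0; apply/eqP/row_matrixP => i.
rewrite row0; apply: contraTeq isT => r0.
have := pM (row i (kermx M))^T; rewrite trmx_eq0 trmxK => /(_ r0).
have -> : row i (kermx M) *m M = 0 by apply/sub_kermxP; exact: row_sub.
by rewrite mul0mx mxE ltxx.
Qed.

Lemma pd_psd n (M : 'M[R]_n) : pd M -> psd M.
Proof.
move=> [sM pM]; split => // u; have [->|/pM/ltW//] := eqVneq u 0.
by rewrite mulmx0 mxE.
Qed.

Lemma pdD_psd n (M N : 'M[R]_n) : pd M -> psd N -> pd (M + N).
Proof.
move=> [sM pM] [sN pN]; split; first by rewrite linearD/= sM sN.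
by move=> u u0; rewrite mulmxDr mulmxDl mxE ltr_wpDr ?pM.
Qed.

Lemma psdD n (M N : 'M[R]_n) : psd M -> psd N -> psd (M + N).
Proof.
move=> [sM pM] [sN pN]; split; first by rewrite linearD/= sM sN.
by move=> u; rewrite mulmxDr mulmxDl mxE addr_ge0.
Qed.

Lemma psd_conj m n (A : 'M[R]_(m, n)) (M : 'M[R]_n) : psd M -> psd (A *m M *m A^T).
Proof.
move=> [sM pM]; split; first by rewrite !trmx_mul trmxK sM mulmxA.
by move=> u; have := pM (A^T *m u); rewrite trmx_mul trmxK !mulmxA.
Qed.

Lemma psd_invmx n (M : 'M[R]_n) : pd M -> psd (invmx M).
Proof.
move=> pM; have uM := pd_unitmx pM; have [sM _] := pM.
have := psd_conj (invmx M) (pd_psd pM).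
by rewrite mulVmx// mul1mx trmx_inv sM.
Qed.

Lemma psdZ n (k : R) (M : 'M[R]_n) : 0 <= k -> psd M -> psd (k *: M).
Proof.
move=> k0 [sM pM]; split; first by rewrite linearZ/= sM.
by move=> u; rewrite -scalemxAr -scalemxAl mxE mulr_ge0.
Qed.

Section Gain.
Context (n m : nat) (C : 'M[R]_(m, n)) (Rv Y : 'M[R]_m).
Hypothesis pRv : pd Rv.
Hypothesis pY : pd Y.

Lemma innovation_pd (b : bool) (M : 'M[R]_n) : psd M ->
  pd (C *m M *m C^T + Rv + (1 - (b%:R : R)) *: invmx Y).
Proof.
move=> pM; apply: pdD_psd; last first.
  by apply: psdZ; [case: b; rewrite ?subrr ?subr0|exact: psd_invmx].
by rewrite addrC; apply: pdD_psd => //; exact: psd_conj.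
Qed.

(* Joseph form: M - K C M = (1 - K C) M (1 - K C)^T + K R' K^T with
   K (C M C^T + R') = M C^T. *)
Lemma gain_psd (a b : bool) (M : 'M[R]_n) : psd M ->
  psd (M - gain C Rv Y a b M *m C *m M).
Proof.
move=> pM; rewrite /gain; case: a; last by rewrite scale0r !mul0mx subr0.
rewrite scale1r; have pS := innovation_pd b pM.
set R' := Rv + (1 - (b%:R : R)) *: invmx Y.
rewrite -addrA -/R' in pS *; set S := C *m M *m C^T + R' in pS *.
set K := M *m C^T *m invmx S.
have pR' : psd R'.
  apply: psdD; first exact: pd_psd.
  by apply: psdZ; [case: (b); rewrite ?subrr ?subr0|exact: psd_invmx].
have KS : K *m S = M *m C^T by rewrite /K mulmxKV// pd_unitmx.
have -> : M - K *m C *m M =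
    (1%:M - K *m C) *m M *m (1%:M - K *m C)^T + K *m R' *m K^T.
  rewrite linearB/= trmx1 trmx_mul mulmxBr mulmx1 mulmxBl mul1mx.
  have : K *m S *m K^T = M *m C^T *m K^T by rewrite KS.
  rewrite /S mulmxDr mulmxDl !mulmxA => e.
  by rewrite 2!mulmxBl -e (addrC (K *m C *m M *m C^T *m K^T)) addrK subrK.
by apply: psdD; exact: psd_conj.
Qed.
End Gain.
End PositiveDefinite.

Section SteinFamilies.
Context (R : realType) (d : measure_display) (Om : measurableType d)
  (P : probability Om R).
Implicit Types (G H K : set (set Om)).

(** Zero conditional mean given [G], expressed by test functions so that no conditional expectation
    has to be constructed. *)
Definition nullv G p (W : Om -> 'cV[R]_p) : Prop :=
  forall h, bm G h -> forall l, null P (fun o => h o * W o l ord0).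

Lemma nullv_ext G p (W W' : Om -> 'cV[R]_p) : nullv G W ->
  (forall o, W o = W' o) -> nullv G W'.
Proof. by move=> nW e h bh l; apply: (null_ext (nW h bh l)) => o; rewrite e. Qed.

Lemma nullvD G p (W W' : Om -> 'cV[R]_p) : nullv G W -> nullv G W' ->
  nullv G (fun o => W o + W' o).
Proof.
move=> nW nW' h bh l; apply: (null_ext (nullD (nW h bh l) (nW' h bh l))) => o.
by rewrite mxE mulrDr.
Qed.

Lemma nullv_mulmx G p q (M : Om -> 'M[R]_(q, p)) (W : Om -> 'cV[R]_p) :
  (forall i j, bm G (fun o => M o i j)) -> nullv G W ->
  nullv G (fun o => M o *m W o).
Proof.
move=> bM nW h bh i.
apply: (null_ext (null_sum (index_enum 'I_p)
  (fun l => nW _ (bmM bh (bM i l)) l))) => o.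
by rewrite mxE mulr_sumr; apply: eq_bigr => l _; rewrite mulrA.
Qed.

Lemma nullvB G p (W W' : Om -> 'cV[R]_p) : nullv G W -> nullv G W' ->
  nullv G (fun o => W o - W' o).
Proof.
move=> nW nW' h bh l; apply: (null_ext (nullB (nW h bh l) (nW' h bh l))) => o.
by rewrite !mxE mulrBr.
Qed.

(** The integrand for the test function [cos (a.x + th)], whose gradient is [- sin (a.x + th) a];
    the free phase covers sines too. *)
Definition steinv n (x c : Om -> 'cV[R]_n) (M : Om -> 'M[R]_n) a (th : R) o :=
  cos (dotv a (x o) + th) *: (x o - c o) + sin (dotv a (x o) + th) *: (M o *m a).

(* Stein's identity: given [G], [x] is Gaussian with mean [c] and covariance [M]. *)
Definition cond_stein G n (x c : Om -> 'cV[R]_n) (M : Om -> 'M[R]_n) : Prop :=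
  forall a (th : R), nullv G (steinv x c M a th).

Definition msubmx G p q (M : Om -> 'M[R]_(p, q)) : Prop :=
  forall i j, msub G (fun o => M o i j).

Lemma msubmx_cst G p q (M : 'M[R]_(p, q)) : msubmx G (fun=> M).
Proof. by move=> i j; exact: msub_cst. Qed.

Lemma msubmxD G p q (M N : Om -> 'M[R]_(p, q)) : msubmx G M -> msubmx G N ->
  msubmx G (fun o => M o + N o).
Proof. by move=> mM mN i j; under eq_fun do rewrite mxE; exact: msubD. Qed.

Lemma msubmxB G p q (M N : Om -> 'M[R]_(p, q)) : msubmx G M -> msubmx G N ->
  msubmx G (fun o => M o - N o).
Proof. by move=> mM mN i j; under eq_fun do rewrite !mxE; exact: msubB. Qed.

Lemma msubmxM G p q r (M : Om -> 'M[R]_(p, q)) (N : Om -> 'M[R]_(q, r)) :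
  msubmx G M -> msubmx G N -> msubmx G (fun o => M o *m N o).
Proof. exact: msub_mulmx. Qed.

Lemma msubmxZ G p q h (M : Om -> 'M[R]_(p, q)) : msub G h -> msubmx G M ->
  msubmx G (fun o => h o *: M o).
Proof. by move=> mh mM i j; under eq_fun do rewrite mxE; exact: msubM. Qed.

Lemma msubmx_tr G p q (M : Om -> 'M[R]_(p, q)) : msubmx G M ->
  msubmx G (fun o => (M o)^T).
Proof. by move=> mM i j; under eq_fun do rewrite mxE; exact: mM. Qed.

Lemma msub_dotv G p (a x : Om -> 'cV[R]_p) : msubmx G a -> msubmx G x ->
  msub G (fun o => dotv (a o) (x o)).
Proof. by move=> ma mx; exact: (msub_mulmx (msubmx_tr ma) mx). Qed.

Lemma msub_phase G p a (x : Om -> 'cV[R]_p) (th : R) : msubmx G x ->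
  msub G (fun o => dotv a (x o) + th).
Proof.
move=> mx; apply: msubD; last exact: msub_cst.
by apply: msub_dotv => //; exact: msubmx_cst.
Qed.

Lemma msubmx_steinv G n (x c : Om -> 'cV[R]_n) (M : Om -> 'M[R]_n) a th :
  msubmx G x -> msubmx G c -> msubmx G M -> msubmx G (steinv x c M a th).
Proof.
move=> mx mc mM; apply: msubmxD; apply: msubmxZ.
- by apply: msub_cos; exact: msub_phase.
- exact: msubmxB.
- by apply: msub_sin; exact: msub_phase.
- by apply: msubmxM => //; exact: msubmx_cst.
Qed.

Section Noise.
Context (G K H : set (set Om)) (n p : nat).
Variables (x c : Om -> 'cV[R]_n) (M : Om -> 'M[R]_n) (u : Om -> 'cV[R]_p)
  (U : 'M[R]_p).
Hypothesis GK : G `<=` K.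
Hypothesis Km : K `<=` measurable.
Hypothesis Hm : H `<=` measurable.
Hypothesis KH : indep P K H.
Hypothesis mx : msubmx K x.
Hypothesis mc : msubmx K c.
Hypothesis mM : msubmx K M.
Hypothesis mu : msubmx H u.
Hypothesis su : forall a th l, null P (fun o =>
  u o l ord0 * cos (dotv a (u o) + th) + (U *m a) l ord0 * sin (dotv a (u o) + th)).
Hypothesis sx : cond_stein G x c M.

(** The addition formulas write the integrand as the identity for [x] at phases [th] and
    [th + pi / 2], multiplied by the independent bounded factors [cos (b.u)] and [sin (b.u)]. *)
Lemma stein_noise_state a b th : nullv G (fun o =>
  cos (dotv a (x o) + dotv b (u o) + th) *: (x o - c o) +
  sin (dotv a (x o) + dotv b (u o) + th) *: (M o *m a)).
Proof.
move=> h bh i; have bhK := bmS GK bh.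
have mF th' : msub K (fun o => h o * steinv x c M a th' o i ord0).
  by apply: msubM; [exact: bhK.1|exact: msubmx_steinv].
have mbu : msub H (fun o => dotv b (u o)).
  by apply: msub_dotv => //; exact: msubmx_cst.
have n1 := indep_null Km Hm KH (sx a th bh i) (mF th) (bm_cos mbu).
have n2 := indep_null Km Hm KH (sx a (th + pi / 2) bh i) (mF _) (bm_sin mbu).
apply: (null_ext (nullD n1 n2)) => o.
rewrite /steinv; move: (M o *m a) => r; rewrite !mxE.
rewrite [_ + dotv b _ + th]addrAC [_ + (th + _)]addrA cosDpihalf sinDpihalf.
move: (dotv a (x o) + th) (dotv b (u o)) => s t; rewrite cosD sinD; ring.
Qed.

(** The same splitting with the roles exchanged: the identity for [u] is unconditional, and [h]
    joins the bounded factors on the side of [K]. *)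
Lemma stein_noise_noise a b th : nullv G (fun o =>
  cos (dotv a (x o) + dotv b (u o) + th) *: u o +
  sin (dotv a (x o) + dotv b (u o) + th) *: (U *m b)).
Proof.
move=> h bh i; have bhK := bmS GK bh.
have max : msub K (fun o => dotv a (x o) + th) by exact: msub_phase.
have mZ th' : msub H (fun o =>
    u o i ord0 * cos (dotv b (u o) + th') + (U *m b) i ord0 * sin (dotv b (u o) + th')).
  apply: msubD; apply: msubM; [exact: mu| | exact: msub_cst|].
    by apply: msub_cos; exact: msub_phase.
  by apply: msub_sin; exact: msub_phase.
have n1 := indep_null Hm Km (indepC KH) (su b 0 i) (mZ 0) (bmM bhK (bm_cos max)).
have n2 := indep_null Hm Km (indepC KH) (su b (pi / 2) i) (mZ _) (bmM bhK (bm_sin max)).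
apply: (null_ext (nullD n1 n2)) => o.
move: (U *m b) => r; rewrite !mxE.
rewrite !addr0 cosDpihalf sinDpihalf [_ + dotv b _ + th]addrAC.
move: (dotv a (x o) + th) (dotv b (u o)) => s t; rewrite cosD sinD; ring.
Qed.

(** The two noise identities at frequencies [A^T a] and [B^T a], multiplied by [A] and [B]. It gives
    the time update with [B = 1], and the initial Gaussian state with [A = 0]. *)
Lemma cond_stein_time q (A : 'M[R]_(q, n)) (B : 'M[R]_(q, p)) : cond_stein G
  (fun o => A *m x o + B *m u o) (fun o => A *m c o)
  (fun o => A *m M o *m A^T + B *m U *m B^T).
Proof.
move=> a th.
have n1 := nullv_mulmx (fun i j => bm_cst G (A i j)) (stein_noise_state (A^T *m a) (B^T *m a) th).
have n2 := nullv_mulmx (fun i j => bm_cst G (B i j)) (stein_noise_noise (A^T *m a) (B^T *m a) th).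
apply: (nullv_ext (nullvD n1 n2)) => o.
rewrite /steinv dotvDr !dotv_mulmx !mulmxDr -!scalemxAr mulmxBr mulmxDl !mulmxA.
by rewrite addrACA -!scalerDr (addrAC (A *m x o)).
Qed.

End Noise.

End SteinFamilies.

(** * Measurement update *)

Section WeightedVector.
Context (R : realType) (d : measure_display) (Om : measurableType d)
  (P : probability Om R) (G : set (set Om)) (n m p : nat).
Variables (x : Om -> 'cV[R]_n) (y : Om -> 'cV[R]_m) (xi : Om -> 'cV[R]_p)
  (al : Om -> 'M[R]_(p, n)) (be : Om -> 'M[R]_(p, m)) (Y : 'M[R]_m).
Hypothesis Gm : G `<=` measurable.
Hypothesis Iy : forall i, integ P (fun o => y o i ord0).
Hypothesis bal : forall i j, bm G (fun o => al o i j).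
Hypothesis bbe : forall i j, bm G (fun o => be o i j).
Hypothesis pY : psd Y.

Let phi a b (th : R) o := dotv a (x o) + dotv b (y o) + th.
Let U o := expR (- (dotv (y o) (Y *m y o) / 2)).

(** Taken row by row. The extra term is [be] applied to minus the logarithmic gradient of [U], which
    is [Y y]. *)
Lemma weighted_steinv :
  (forall a b th, nullv P G (fun o => cos (phi a b th o) *: xi o +
     sin (phi a b th o) *: (al o *m a + be o *m b))) ->
  forall a b th, nullv P G (fun o => (cos (phi a b th o) * U o) *: xi o +
     (sin (phi a b th o) * U o) *: (al o *m a + be o *m b) +
     (cos (phi a b th o) * U o) *: (be o *m (Y *m y o))).
Proof.
move=> sxi a b th h bh l.
have rowE q (A : 'M[R]_(p, q)) u : dotv (row l A)^T u = (A *m u) l ord0.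
  by rewrite /dotv trmxK -row_mul mxE.
have Ixi : integ P (fun o => xi o l ord0).
  (* At zero frequencies and phase with test function 1 the identity reduces to [xi] itself, which
     exposes its integrability. *)
  have [] := sxi 0 0 0 _ (bm_cst G 1) l.
  rewrite (_ : (fun o => _) = (fun o => xi o l ord0))//; apply/funext => o.
  by rewrite /phi !dotv0l !addr0 cos0 sin0 scale0r addr0 mul1r mxE mul1r.
have [L YL] := psd_sum_squares pY.
have W := @weighted_stein_sum_squares _ _ _ P G n m x y (fun o => xi o l ord0)
  (fun o => (row l (al o))^T) (fun o => (row l (be o))^T) Gm Ixi Iy _ _ L Y YL _.
apply: (null_ext (W _ _ _ h bh a b th)).
- by move=> j; under eq_fun do rewrite !mxE; exact: bal.
- by move=> j; under eq_fun do rewrite !mxE; exact: bbe.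
- move=> g bg a' b' th'; apply: (null_ext (sxi a' b' th' g bg l)) => o.
  rewrite !rowE -/(phi _ _ _ o) mulmx0.
  move: (al o *m a') (be o *m b') => u w; rewrite !mxE; ring.
- move=> o; rewrite !dotvNr !dotvZr !rowE -/(phi _ _ _ o) -/(U o).
  move: (al o *m a) (be o *m b) (be o *m _) => u w r; rewrite !mxE; ring.
Qed.

End WeightedVector.

Section Measurement.
Context (R : realType) (d : measure_display) (Om : measurableType d)
  (P : probability Om R) (G K H1 K1 H2 K2 H3 : set (set Om)) (n m : nat).
Variables (x c : Om -> 'cV[R]_n) (M : Om -> 'M[R]_n) (v y : Om -> 'cV[R]_m)
  (C : 'M[R]_(m, n)) (Rv Y : 'M[R]_m) (zeta : Om -> R) (eta eps : Om -> bool).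
(** The chain adds one source at a time: [K] carries the state and the past information [G], [H1]
    the noise [v], [H2] the variable [zeta], and [H3] the arrival [eta]. *)
Hypotheses (GK : G `<=` K) (KK1 : K `<=` K1) (K1K2 : K1 `<=` K2)
  (K2m : K2 `<=` measurable) (H1K1 : H1 `<=` K1) (H2K2 : H2 `<=` K2)
  (H3m : H3 `<=` measurable).
Hypotheses (i1 : indep P K H1) (i2 : indep P K1 H2) (i3 : indep P K2 H3).
Hypotheses (mx : msubmx K x) (mc : msubmx G c) (mv : msubmx H1 v)
  (mz : msub H2 zeta) (me : msub H3 (fun o => (eta o)%:R : R)).
Hypothesis bM : forall F : 'M[R]_n -> R, bm G (fun o => F (M o)).
Hypothesis pM : forall o, psd (M o).
Hypotheses (pRv : pd Rv) (pY : pd Y) (uz : uniform01 P zeta).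
Hypothesis sv : forall a th l, null P (fun o =>
  v o l ord0 * cos (dotv a (v o) + th) + (Rv *m a) l ord0 * sin (dotv a (v o) + th)).
Hypothesis sx : cond_stein P G x c M.
Hypothesis Ix : forall i, integ P (fun o => x o i ord0).
Hypothesis Iy : forall i, integ P (fun o => y o i ord0).
Hypothesis yE : forall o, y o = C *m x o + v o.
Hypothesis epsE : forall o, eps o =
  (expR (- (1 / 2) * ((y o)^T *m Y *m y o) ord0 ord0) < zeta o).

Let phi a b (th : R) o := dotv a (x o) + dotv b (y o) + th.
Let U o := expR (- (dotv (y o) (Y *m y o) / 2)).

Let K1m : K1 `<=` measurable. Proof. exact: subset_trans K1K2 K2m. Qed.
Let Km : K `<=` measurable. Proof. exact: subset_trans KK1 K1m. Qed.
Let Gm : G `<=` measurable. Proof. exact: subset_trans GK Km. Qed.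
Let GK1 : G `<=` K1. Proof. exact: subset_trans GK KK1. Qed.

Let bmF p q (F : 'M[R]_n -> 'M[R]_(p, q)) i j : bm G (fun o => F (M o) i j).
Proof. exact: (bM (fun M => F M i j)). Qed.

Let mcK : msubmx K c. Proof. by move=> i j; exact: msubS (mc i j). Qed.
Let mMK : msubmx K M. Proof. by move=> i j; apply: msubS GK _; exact: (bmF id i j).1. Qed.

Let phiE a b th o : phi a b th o = dotv (a + C^T *m b) (x o) + dotv b (v o) + th.
Proof. by rewrite /phi yE dotvDl dotvDr dotv_mulmx addrA. Qed.

(** Substituting [y = C x + v] turns the phase into [(a + C^T b).x + b.v], so this is the identity
    for a state plus noise. The coefficient of [b] is the conditional covariance of state and
    observation. *)
Lemma stein_state_obs a b th : nullv P G (fun o => cos (phi a b th o) *: (x o - c o) +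
  sin (phi a b th o) *: (M o *m a + M o *m C^T *m b)).
Proof.
have := stein_noise_state GK Km (subset_trans H1K1 K1m) i1 mx mcK mMK mv sx
  (a + C^T *m b) b th.
by move/nullv_ext; apply => o; rewrite -phiE mulmxDr mulmxA.
Qed.

(** The term [0 *m a] records that the noise is uncorrelated with the state, in the shape expected
    by [weighted_steinv]. *)
Lemma stein_noise_obs a b th : nullv P G (fun o => cos (phi a b th o) *: v o +
  sin (phi a b th o) *: (0 *m a + Rv *m b)).
Proof.
have := stein_noise_noise GK Km (subset_trans H1K1 K1m) i1 mx mv sv
  (a + C^T *m b) b th.
by move/nullv_ext; apply => o; rewrite -phiE mul0mx add0r.
Qed.

Lemma innovation_nullv : nullv P G (fun o => y o - C *m c o).
Proof.
have nE := nullv_mulmx (fun i j => bm_cst G (C i j)) (stein_state_obs 0 0 0).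
apply: (nullv_ext (nullvD nE (stein_noise_obs 0 0 0))) => o.
rewrite /phi !dotv0l !addr0 cos0 sin0 !scale0r !scale1r !addr0 yE mulmxBr.
by rewrite addrAC.
Qed.

Let S o := C *m M o *m C^T + Rv.
(** The values of the gain on arrival, for a received observation and, next, for a silence; the
    indices match the indicators [n2] and [n1] below. *)
Let gain2 o := M o *m C^T *m invmx (S o).
Let gain1 o := M o *m C^T *m invmx (S o + invmx Y).

Let S_unit o : S o \in unitmx.
Proof.
have := innovation_pd C pRv pY true (pM o).
by rewrite subrr scale0r addr0 => /pd_unitmx.
Qed.

Let SY_unit o : S o + invmx Y \in unitmx.
Proof.
have := innovation_pd C pRv pY false (pM o).
by rewrite subr0 scale1r => /pd_unitmx.
Qed.

Let innov o : y o - C *m c o = C *m (x o - c o) + v o.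
Proof. by rewrite yE mulmxBr addrAC. Qed.

Let bgain2 i j : bm G (fun o => gain2 o i j).
Proof. exact: (bmF (fun M => M *m C^T *m invmx (C *m M *m C^T + Rv)) i j). Qed.

Let bgain1 i j : bm G (fun o => gain1 o i j).
Proof. exact: (bmF (fun M => M *m C^T *m invmx (C *m M *m C^T + Rv + invmx Y)) i j). Qed.

(* The residual after regressing the state on the innovation no longer
   correlates with the observation, hence no [b] term. *)
Lemma stein_received a b th : nullv P G (fun o =>
  cos (phi a b th o) *: (x o - c o - gain2 o *m (y o - C *m c o)) +
  sin (phi a b th o) *: ((M o - gain2 o *m C *m M o) *m a + (0 : 'M[R]_(n, m)) *m b)).
Proof.
have nE := stein_state_obs a b th.
have nI := nullvD (nullv_mulmx (fun i j => bm_cst G (C i j)) nE) (stein_noise_obs a b th).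
apply: (nullv_ext (nullvB nE (nullv_mulmx bgain2 nI))) => o.
have g : gain2 o *m S o = M o *m C^T by rewrite /gain2 mulmxKV.
have -> : C *m (cos (phi a b th o) *: (x o - c o) +
    sin (phi a b th o) *: (M o *m a + M o *m C^T *m b)) +
    (cos (phi a b th o) *: v o + sin (phi a b th o) *: (0 *m a + Rv *m b)) =
    cos (phi a b th o) *: (y o - C *m c o) +
    sin (phi a b th o) *: (C *m M o *m a + S o *m b).
  rewrite innov; move: (x o - c o) => e.
  rewrite mul0mx add0r mulmxDr -!scalemxAr mulmxDr /S mulmxDl !mulmxA.
  by rewrite addrACA -!scalerDr addrA.
move: (y o - C *m c o) => w.
rewrite mulmxDr -!scalemxAr mulmxDr !mulmxA g mulmxBl mul0mx addr0.
move: (gain2 o *m _) (M o *m a) (M o *m C^T *m b) (gain2 o *m C *m M o *m a) => r s t q.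
by apply/matrixP => i j; rewrite !mxE; ring.
Qed.

(** The residual has zero covariance with the observation, so reweighting by a function of [y] adds
    no gradient term. *)
Lemma stein_received_weighted a b th : nullv P G (fun o =>
  (cos (phi a b th o) * U o) *: (x o - c o - gain2 o *m (y o - C *m c o)) +
  (sin (phi a b th o) * U o) *: ((M o - gain2 o *m C *m M o) *m a)).
Proof.
have b1 i j : bm G (fun o => (M o - gain2 o *m C *m M o) i j).
  exact: (bmF (fun M => M - M *m C^T *m invmx (C *m M *m C^T + Rv) *m C *m M) i j).
have b2 i j : bm G (fun o : Om => (0 : 'M[R]_(n, m)) i j) by exact: bm_cst.
have := weighted_steinv Gm Iy b1 b2 (pd_psd pY) stein_received a b th.
by move/nullv_ext; apply => o; rewrite !mul0mx scaler0 !addr0.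
Qed.

(** Put [z = Y y]. The weighted identities for state and innovation contain [M C^T z] and
    [y + S z = (S + Y^-1) z]; subtracting [gain1] times the second cancels [z], because
    [gain1 (S + Y^-1) = M C^T]. What is left involves no observation. *)
Lemma stein_silent a th : nullv P G (fun o => U o *:
  steinv x (fun o => (1%:M - gain1 o *m C) *m c o)
    (fun o => M o - gain1 o *m C *m M o) a th o).
Proof.
have nE := weighted_steinv Gm Iy (bmF id) (bmF (fun M => M *m C^T)) (pd_psd pY)
  stein_state_obs a 0 th.
have nV := weighted_steinv Gm Iy (fun i j => bm_cst G ((0 : 'M[R]_(m, n)) i j))
  (fun i j => bm_cst G (Rv i j)) (pd_psd pY) stein_noise_obs a 0 th.
have nI := nullvD (nullv_mulmx (fun i j => bm_cst G (C i j)) nE) nV.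
apply: (nullv_ext (nullvB nE (nullv_mulmx bgain1 nI))) => o.
rewrite -/(phi a 0 th o) -/(U o) !mulmx0 !addr0 mul0mx scaler0 addr0.
have ph : phi a 0 th o = dotv a (x o) + th by rewrite /phi dotv0l addr0.
rewrite ph /steinv.
have uY := pd_unitmx pY.
set D := cos _ * U o; set s := sin _ * U o; set z := Y *m y o.
have -> : C *m (D *: (x o - c o) + s *: (M o *m a) + D *: (M o *m C^T *m z)) +
    (D *: v o + D *: (Rv *m z)) =
    D *: (y o + S o *m z - C *m c o) + s *: (C *m M o *m a).
  have -> : y o + S o *m z - C *m c o = C *m (x o - c o) + v o + S o *m z.
    by rewrite -innov addrAC.
  move: (x o - c o) => e; rewrite /S mulmxDl !mulmxDr -!scalemxAr !mulmxA.
  move: (C *m e) (C *m M o *m C^T *m z) (Rv *m z) (C *m M o *m a) => r1 r2 r3 r4.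
  by apply/matrixP => i j; rewrite !mxE; ring.
have yz : y o = invmx Y *m z by rewrite /z mulKmx.
have g : gain1 o *m (y o + S o *m z) = M o *m C^T *m z.
  by rewrite yz -mulmxDl addrC mulmxA /gain1 mulmxKV.
rewrite mulmxDr -!scalemxAr mulmxBr g !mulmxA !mulmxBl mul1mx opprB.
rewrite /D /s; move: (cos _) (sin _) (U o) => k1 k2 k3.
move: (M o *m C^T *m z) (M o *m a) (gain1 o *m C *m M o *m a) (gain1 o *m C *m c o) => r1 r2 r3 r4.
by apply/matrixP => i j; rewrite !mxE; ring.
Qed.

(** Indicators of the three outcomes: no arrival, arrival of a silence, arrival of the
    observation. *)
Let n0 o : R := (~~ eta o)%:R.
Let n1 o : R := (eta o && ~~ eps o)%:R.
Let n2 o : R := (eta o && eps o)%:R.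

Let gainE o := gain C Rv Y (eta o) (eps o) (M o).

Definition post_mean o := (1%:M - gainE o *m C) *m c o + (eps o)%:R *: (gainE o *m y o).

Definition post_cov o := M o - gainE o *m C *m M o.

Let mxK1 : msubmx K1 x. Proof. by move=> i j; exact: msubS (mx i j). Qed.
Let mcK1 : msubmx K1 c. Proof. by move=> i j; exact: msubS (mc i j). Qed.
Let myK1 : msubmx K1 y.
Proof.
move=> i j; under eq_fun do rewrite yE.
apply: msubmxD; last by move=> k l; exact: msubS (mv k l).
by apply: msubmxM => //; exact: msubmx_cst.
Qed.
Let mFK1 p q (F : 'M[R]_n -> 'M[R]_(p, q)) : msubmx K1 (fun o => F (M o)).
Proof. by move=> i j; apply: msubS GK1 _; exact: (bmF F i j).1. Qed.

Let mU : msub K1 U.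
Proof.
apply: msub_expR; apply: msubN; apply: msubM; last exact: msub_cst.
apply: msub_dotv => //; apply: msubmxM => //; exact: msubmx_cst.
Qed.

Let U01 o : 0 <= U o <= 1.
Proof.
rewrite /U expR_ge0/= -[leRHS]expR0 ler_expR oppr_le0 divr_ge0//.
by rewrite -quadE; exact: (pd_psd pY).2.
Qed.

Let epsU o : eps o = (U o < zeta o).
Proof. by rewrite epsE quadE /U; congr (expR _ < _); field. Qed.

Let null_arrival F : null P F -> msub K2 F -> null P (fun o => F o * (eta o)%:R).
Proof.
move=> nF mF; apply: (indep_null K2m H3m i3 nF mF); split => //.
by exists 1 => o; case: (eta o); rewrite ?normr1 ?normr0.
Qed.

Let meps : msub K2 (fun o => (eps o)%:R : R).
Proof.
under eq_fun do rewrite epsU; apply: msub_lt; first exact: msubS mU.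
exact: msubS mz.
Qed.

Let null_threshold F : integ P F -> msub K1 F ->
  null P (fun o => F o * ((eps o)%:R - (1 - U o))).
Proof.
move=> IF mF.
have H2m : H2 `<=` measurable by exact: subset_trans H2K2 K2m.
apply: (null_ext (uniform_threshold K1m H2m i2 mz uz mU U01 IF mF)) => o.
by rewrite epsU.
Qed.

(** Integrating out [zeta] turns the indicator of silence into the weight [U]; the independent
    arrival is then attached. *)
Let null_silent F : integ P F -> msub K1 F -> null P (fun o => U o * F o) ->
  null P (fun o => F o * n1 o).
Proof.
move=> IF mF nFU.
have nF : null P (fun o => F o * (1 - (eps o)%:R)).
  apply: (null_ext (nullB nFU (null_threshold IF mF))) => o; ring.
have mF' : msub K2 (fun o => F o * (1 - (eps o)%:R)).
  by apply: msubM; [exact: msubS mF|apply: msubB => //; exact: msub_cst].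
apply: (null_ext (null_arrival nF mF')) => o; rewrite /n1.
by case: (eta o); case: (eps o); rewrite /=; ring.
Qed.

(** Reception has conditional weight [1 - U], so the identity is required both without weight and
    with weight [U]. *)
Let null_received F : msub K1 F -> null P F -> null P (fun o => U o * F o) ->
  null P (fun o => F o * n2 o).
Proof.
move=> mF nF nFU.
have nF' : null P (fun o => F o * (eps o)%:R).
  apply: (null_ext (nullD (nullB nF nFU) (null_threshold nF.1 mF))) => o; ring.
have mF' : msub K2 (fun o => F o * (eps o)%:R).
  by apply: msubM; [exact: msubS mF|exact: meps].
apply: (null_ext (null_arrival nF' mF')) => o; rewrite /n2.
by case: (eta o); case: (eps o); rewrite /=; ring.
Qed.

Let null_absent F : msub K1 F -> null P F -> null P (fun o => F o * n0 o).
Proof.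
move=> mF nF; have mF2 : msub K2 F by exact: msubS mF.
apply: (null_ext (nullB nF (null_arrival nF mF2))) => o; rewrite /n0.
by case: (eta o); rewrite /=; ring.
Qed.

Let steinv_cases a th o :
  [/\ n0 o *: steinv x post_mean post_cov a th o = n0 o *: steinv x c M a th o,
  n1 o *: steinv x post_mean post_cov a th o = n1 o *:
    steinv x (fun o => (1%:M - gain1 o *m C) *m c o)
      (fun o => M o - gain1 o *m C *m M o) a th o &
  n2 o *: steinv x post_mean post_cov a th o = n2 o *:
    (cos (phi a 0 th o) *: (x o - c o - gain2 o *m (y o - C *m c o)) +
     sin (phi a 0 th o) *: ((M o - gain2 o *m C *m M o) *m a))].
Proof.
rewrite /n0 /n1 /n2 /steinv /post_mean /post_cov /gainE /gain /phi dotv0l addr0.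
case: (eta o); case: (eps o); rewrite /= ?scale0r; split => //; rewrite !scale1r.
- rewrite subrr !scale0r !addr0 -/(S o) -/(gain2 o).
  congr (_ *: _ + _); rewrite mulmxBl mul1mx mulmxBr mulmxA.
  move: (gain2 o *m C *m c o) (gain2 o *m y o) => r s.
  by apply/matrixP => i j; rewrite !mxE; ring.
- by rewrite subr0 ?scale0r ?addr0 ?scale1r -/(S o) -/(gain1 o).
- by rewrite ?scale0r !mul0mx !subr0 mul1mx ?scaler0 ?scale0r addr0.
- by rewrite ?scale0r !mul0mx !subr0 mul1mx ?scaler0 ?scale0r addr0.
Qed.

Let Ic j : integ P (fun o => c o j ord0).
Proof.
have [Ie _] := sx 0 0 (bm_cst G 1) j.
have -> : (fun o => c o j ord0) =
    (fun o => x o j ord0 + (-1) * (1 * steinv x c M 0 0 o j ord0)).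
  apply/funext => o; rewrite /steinv dotv0l addr0 cos0 sin0 scale0r addr0 scale1r.
  by rewrite !mxE; ring.
by apply: integD => //; exact: integZ.
Qed.

(** A multiplicative generating class for the updated information. The three indicators are
    disjoint, so mixed products vanish, and cosines with free frequency and phase multiply by
    product-to-sum. *)
Definition info_test : set (Om -> R) := [set f |
  exists h b (t : R), bm G h /\ (f = (fun o => h o * n0 o) \/
    f = (fun o => h o * n1 o) \/ f = (fun o => h o * cos (dotv b (y o) + t) * n2 o))].

Lemma info_test_null f a th i : info_test f ->
  null P (fun o => f o * steinv x post_mean post_cov a th o i ord0).
Proof.
have scE (k : R) (W W' : 'cV[R]_n) : k *: W = k *: W' -> k * W i ord0 = k * W' i ord0.
  by move/(congr1 (fun W : 'cV[R]_n => W i ord0)); rewrite !mxE.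
move=> [h [b [t [bh [->|[->|->]]]]]]; have mh : msub K1 h by exact: (bmS GK1 bh).1.
- apply: (null_ext (null_absent (F := fun o => h o * steinv x c M a th o i ord0) _ (sx a th bh i))).
    by apply: msubM => //; apply: msubmx_steinv => //; exact: (mFK1 id).
  move=> o; have [/scE e _ _] := steinv_cases a th o.
  by rewrite mulrAC -!mulrA e.
- pose Z := steinv x (fun o => (1%:M - gain1 o *m C) *m c o)
    (fun o => M o - gain1 o *m C *m M o) a th.
  have mZ : msubmx K1 Z.
    apply: msubmx_steinv => //.
      apply: msubmxM => //.
      exact: (mFK1 (fun M => 1%:M - M *m C^T *m invmx (C *m M *m C^T + Rv + invmx Y) *m C)).
    exact: (mFK1 (fun M => M - M *m C^T *m invmx (C *m M *m C^T + Rv + invmx Y) *m C *m M)).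
  (* [stein_silent] controls only [U * Z], while the threshold argument needs [Z] itself to be
     integrable; this is read off from its expression in [x] and [c]. *)
  have IZ : integ P (fun o => h o * Z o i ord0).
    have bhK : bm K h by exact: bmS bh.
    have mph : msub K (fun o => dotv a (x o) + th) by exact: msub_phase.
    have -> : (fun o => h o * Z o i ord0) = (fun o =>
        h o * cos (dotv a (x o) + th) * (x o i ord0 +
          (-1) * ((1%:M - gain1 o *m C) *m c o) i ord0) +
        h o * sin (dotv a (x o) + th) * ((M o - gain1 o *m C *m M o) *m a) i ord0).
      apply/funext => o; rewrite /Z /steinv.
      move: (_ *m a) ((1%:M - gain1 o *m C) *m c o) => r1 r2; rewrite !mxE; ring.
    apply: integD; apply: (bm_integM Km).
    - by apply: bmM => //; exact: bm_cos.
    - apply: integD => //; apply: integZ; under eq_fun do rewrite mxE.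
      apply: integ_sum => j; apply: (bm_integM Gm) (Ic j).
      exact: (bmF (fun M => 1%:M - M *m C^T *m invmx (C *m M *m C^T + Rv + invmx Y) *m C)).
    - by apply: bmM => //; exact: bm_sin.
    - apply: (bm_integ P Gm).
      exact: (bmF (fun M => (M - M *m C^T *m invmx (C *m M *m C^T + Rv + invmx Y)
        *m C *m M) *m a)).
  apply: (null_ext (null_silent IZ _ _)).
  + by apply: msubM => //; exact: mZ.
  + apply: (null_ext (stein_silent a th bh i)) => o.
    by rewrite mxE mulrCA.
  + move=> o; have [_ /scE e _] := steinv_cases a th o.
    by rewrite mulrAC -!mulrA e.
- pose Z o := cos (phi a 0 th o) *: (x o - c o - gain2 o *m (y o - C *m c o)) +
     sin (phi a 0 th o) *: ((M o - gain2 o *m C *m M o) *m a).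
  have mZ : msubmx K1 Z.
    have mph : msub K1 (phi a 0 th).
      apply: msubD; last exact: msub_cst.
      by apply: msubD; apply: msub_dotv => //; exact: msubmx_cst.
    apply: msubmxD; apply: msubmxZ; [exact: msub_cos| |exact: msub_sin|].
      apply: msubmxB; first exact: msubmxB.
      apply: msubmxM.
        exact: (mFK1 (fun M => M *m C^T *m invmx (C *m M *m C^T + Rv))).
      by apply: msubmxB => //; apply: msubmxM => //; exact: msubmx_cst.
    apply: msubmxM; last exact: msubmx_cst.
    exact: (mFK1 (fun M => M - M *m C^T *m invmx (C *m M *m C^T + Rv) *m C *m M)).
  have mct : msub K1 (fun o => cos (dotv b (y o) + t)).
    by apply: msub_cos; exact: msub_phase.
  (* Averaging the identities at frequencies [b], [- b] with phases [th + t], [th - t] produces the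
     factor [cos (b.y + t)]. *)
  have phB o : phi a b (th + t) o = phi a 0 th o + (dotv b (y o) + t).
    by rewrite /phi dotv0l; ring.
  have phN o : phi a (- b) (th - t) o = phi a 0 th o - (dotv b (y o) + t).
    by rewrite /phi dotv0l dotvNl; ring.
  apply: (null_ext (null_received (F := fun o => h o * cos (dotv b (y o) + t) * Z o i ord0) _ _ _)).
  + by apply: msubM; [exact: msubM|exact: mZ].
  + apply: (null_ext (nullZ (1 / 2) (nullD (stein_received a b (th + t) bh i)
      (stein_received a (- b) (th - t) bh i)))) => o.
    rewrite /Z phB phN !mul0mx !addr0; move: (phi a 0 th o) (dotv b (y o) + t) => s r.
    move: (_ - gain2 o *m _) (_ *m a) => w1 w2; rewrite !mxE cosD cosB sinD sinB.
    by field.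
  + apply: (null_ext (nullZ (1 / 2) (nullD (stein_received_weighted a b (th + t) bh i)
      (stein_received_weighted a (- b) (th - t) bh i)))) => o.
    rewrite /Z phB phN; move: (phi a 0 th o) (dotv b (y o) + t) => s r.
    move: (_ - gain2 o *m _) (_ *m a) => w1 w2; rewrite !mxE cosD cosB sinD sinB.
    by field.
  + move=> o; have [_ _ /scE e] := steinv_cases a th o.
    by rewrite -[in RHS]mulrA e mulrA mulrAC.
Qed.

Lemma info_test_bounded f : info_test f -> exists B : R, forall o, `|f o| <= B.
Proof.
have ind01 (b : bool) : `|b%:R : R| <= 1 by case: b; rewrite ?normr1 ?normr0.
move=> [h [b [t [[_ [B hB]] fE]]]]; exists B => o.
have B0 := le_trans (normr_ge0 _) (hB o).
case: fE => [->|[->|->]].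
- by rewrite normrM -[leRHS]mulr1 ler_pM//; exact: ind01.
- by rewrite normrM -[leRHS]mulr1 ler_pM//; exact: ind01.
- rewrite -mulrA normrM -[leRHS]mulr1 ler_pM// normrM mulr_ile1 ?cos_max//.
  exact: ind01.
Qed.

Lemma info_test_mul f g : info_test f -> info_test g ->
  span info_test (fun o => f o * g o).
Proof.
have s0 : span info_test (fun=> 0).
  apply: span_base; exists (fun=> 0), 0, 0; split; first exact: bm_cst.
  by left; apply/funext => o; rewrite mul0r.
move=> [h [b [t [bh fE]]]] [h' [b' [t' [bh' gE]]]]; have bhh := bmM bh bh'.
case: fE => [->|[->|->]]; case: gE => [->|[->|->]].
- apply: span_base; exists (fun o => h o * h' o), 0, 0; split => //; left.
  by apply/funext => o; rewrite /n0; case: (eta o) => /=; ring.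
- by apply: (span_ext s0) => o; rewrite /n0 /n1; case: (eta o); case: (eps o) => /=; ring.
- by apply: (span_ext s0) => o; rewrite /n0 /n2; case: (eta o); case: (eps o) => /=; ring.
- by apply: (span_ext s0) => o; rewrite /n0 /n1; case: (eta o); case: (eps o) => /=; ring.
- apply: span_base; exists (fun o => h o * h' o), 0, 0; split => //; right; left.
  by apply/funext => o; rewrite /n1; case: (eta o); case: (eps o) => /=; ring.
- by apply: (span_ext s0) => o; rewrite /n1 /n2; case: (eta o); case: (eps o) => /=; ring.
- by apply: (span_ext s0) => o; rewrite /n0 /n2; case: (eta o); case: (eps o) => /=; ring.
- by apply: (span_ext s0) => o; rewrite /n1 /n2; case: (eta o); case: (eps o) => /=; ring.
- have sp b1 t1 : span info_test
      (fun o => h o * h' o * cos (dotv b1 (y o) + t1) * n2 o).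
    by apply: span_base; exists (fun o => h o * h' o), b1, t1; split => //; right; right.
  apply: (span_ext (span_scale (1 / 2) (span_add (sp (b + b') (t + t'))
    (sp (b - b') (t - t'))))) => o.
  have -> : dotv (b + b') (y o) + (t + t') = (dotv b (y o) + t) + (dotv b' (y o) + t').
    by rewrite dotvDl; ring.
  have -> : dotv (b - b') (y o) + (t - t') = (dotv b (y o) + t) - (dotv b' (y o) + t').
    by rewrite dotvDl dotvNl; ring.
  rewrite cosD cosB /n2; case: (eta o); case: (eps o) => /=; by field.
Qed.

Lemma span_info_test h : bm G h -> span info_test h.
Proof.
move=> bh.
have t0 : span info_test (fun o => h o * n0 o).
  by apply: span_base; exists h, 0, 0; split => //; left.
have t1 : span info_test (fun o => h o * n1 o).
  by apply: span_base; exists h, 0, 0; split => //; right; left.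
have t2 : span info_test (fun o => h o * cos (dotv 0 (y o) + 0) * n2 o).
  by apply: span_base; exists h, 0, 0; split => //; right; right.
apply: (span_ext (span_add t0 (span_add t1 t2))) => o.
rewrite dotv0l addr0 cos0 /n0 /n1 /n2.
by case: (eta o); case: (eps o) => /=; ring.
Qed.

(** The shape of the sine of a newly revealed quantity: constant without arrival, constant on
    silence, trigonometric in [y] on reception. *)
Lemma span_info_test_case (r0 r1 : R) b (t : R) :
  span info_test (fun o => if eta o then
    if eps o then cos (dotv b (y o) + t) else r1 else r0).
Proof.
have t0 : span info_test (fun o => r0 * n0 o).
  by apply: span_base; exists (fun=> r0), 0, 0; split; [exact: bm_cst|left].
have t1 : span info_test (fun o => r1 * n1 o).
  by apply: span_base; exists (fun=> r1), 0, 0; split; [exact: bm_cst|right; left].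
have t2 : span info_test (fun o => 1 * cos (dotv b (y o) + t) * n2 o).
  by apply: span_base; exists (fun=> 1), b, t; split; [exact: bm_cst|right; right].
apply: (span_ext (span_add t0 (span_add t1 t2))) => o.
by rewrite /n0 /n1 /n2; case: (eta o); case: (eps o) => /=; ring.
Qed.

Lemma cond_stein_span G' : (forall h, bm G' h -> span info_test h) ->
  cond_stein P G' x post_mean post_cov.
Proof.
move=> G'M a th h /G'M sh i.
apply: (span_null info_test_bounded) sh => [|g Mg]; last exact: info_test_null.
have t0 : info_test (fun o => 1 * n0 o).
  by exists (fun=> 1), 0, 0; split; [exact: bm_cst|left].
have t1 : info_test (fun o => 1 * n1 o).
  by exists (fun=> 1), 0, 0; split; [exact: bm_cst|right; left].
have t2 : info_test (fun o => 1 * cos (dotv 0 (y o) + 0) * n2 o).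
  by exists (fun=> 1), 0, 0; split; [exact: bm_cst|right; right].
(* The three indicators sum to 1, so the three cases together give the integrability required by
   [span_null]. *)
have [] : null P (fun o => steinv x post_mean post_cov a th o i ord0).
  apply: (null_ext (nullD (info_test_null a th i t0) (nullD (info_test_null a th i t1)
    (info_test_null a th i t2)))) => o.
  rewrite dotv0l addr0 cos0 /n0 /n1 /n2.
  by case: (eta o); case: (eps o) => /=; ring.
by [].
Qed.

End Measurement.

(** * Identification of conditional expectations *)

Section ConditionalExpectation.
Context (R : realType) (d : measure_display) (Om : measurableType d)
  (P : probability Om R).

(** Measurability of [g] is assumed because [P] may be incomplete, and a change on a null set could
    destroy it. *)
Lemma integ_ae (f g : Om -> R) : integ P f -> measurable_fun setT g ->
  {ae P, forall o, f o = g o} -> integ P g.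
Proof.
move=> If mg fg; have mf := integ_measurable If.
apply/integrableP; split; first exact/measurable_EFinP.
move/integrableP : If => [_]; congr (_ < _)%E; apply: ae_eq_integral => //.
- by apply: measurableT_comp => //; exact/measurable_EFinP.
- by apply: measurableT_comp => //; exact/measurable_EFinP.
- by apply: filterS fg => o /= -> _.
Qed.

Lemma null_ae (f g : Om -> R) : null P f -> measurable_fun setT g ->
  {ae P, forall o, f o = g o} -> null P g.
Proof.
move=> [If f0] mg fg; have Ig := integ_ae If mg fg; split => //.
rewrite -f0 /mean /Rintegral; congr fine; apply: ae_eq_integral => //.
- exact/measurable_EFinP.
- by apply/measurable_EFinP; exact: integ_measurable If.
- by apply: filterS fg => o /= -> _.
Qed.

(** Testing against the sign of [Z], which is bounded and measurable for [G], shows that [|Z|] has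
    mean zero. *)
Lemma null_indic_ae0 (G : set (set Om)) (Z : Om -> R) : sigma_algebra setT G ->
  G `<=` measurable -> msub G Z -> integ P Z ->
  (forall S, G S -> null P (fun o => \1_S o * Z o)) -> {ae P, forall o, Z o = 0}.
Proof.
move=> sG Gm mZ IZ nZ.
pose g o : R := (0 < Z o)%R%:R - (Z o < 0)%R%:R.
have bg : bm G g.
  by apply: bmD; [|apply: bmN]; apply: bm_lt => //; exact: msub_cst.
have [I0 m0] : null P (fun o => `|Z o|).
  apply: (null_ext (null_indic_bm sG IZ nZ bg)) => o; rewrite /g.
  case: (ltrgtP (Z o) 0) => [h|h|->] /=; rewrite ?normr0 ?mulr0//.
  - by rewrite ltr0_norm//; ring.
  - by rewrite gtr0_norm//; ring.
have := meanE I0; rewrite m0 => e.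
have mZ' : measurable_fun setT (EFin \o Z) by apply/measurable_EFinP; exact: integ_measurable IZ.
have [+ _] := ae_eq_integral_abs P measurableT mZ'.
move=> /(_ e); apply: filterS => o /= /(_ Logic.I) [].
by [].
Qed.

Lemma cond_exp_null (G : set (set Om)) (X g : Om -> R) (S : set Om) :
  G `<=` measurable -> cond_exp_version P G X g -> G S ->
  null P (fun o => \1_S o * (X o - g o)).
Proof.
move=> Gm [mg [IX [Ig eS]]] GS; have mS := Gm S GS.
have restr f : integ P f -> integ P (fun o => \1_S o * f o) /\
    mean P (fun o => \1_S o * f o) = fine (\int[P]_(o in S) (f o)%:E)%E.
  move=> If; split.
    apply: (@integM _ _ _ _ (\1_S) _ 1 _ _ If); first exact: measurable_indic.
    by move=> o; rewrite indicE; case: (_ \in _); rewrite ?normr1 ?normr0.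
  rewrite /mean -/(Rintegral P S f) [RHS]Rintegral_mkcond; congr (Rintegral _ _ _).
  by apply/funext => o; rewrite patchE indicE; case: (_ \in _); rewrite ?mul1r ?mul0r.
have [I1 m1] := restr _ IX; have [I2 m2] := restr _ Ig.
have e : (fun o => \1_S o * (X o - g o)) =
    (fun o => \1_S o * X o + (-1) * (\1_S o * g o)).
  by apply/funext => o; ring.
rewrite e; split; first by apply: integD => //; exact: integZ.
rewrite meanD//; last exact: integZ.
by rewrite meanZ// m1 m2 eS//; ring.
Qed.

Section Versions.
Context (G : set (set Om)).
Hypothesis sG : sigma_algebra setT G.
Hypothesis Gm : G `<=` measurable.

Lemma cond_exp_unique (X g c : Om -> R) : cond_exp_version P G X g -> msub G c ->
  (forall S, G S -> null P (fun o => \1_S o * (X o - c o))) ->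
  {ae P, forall o, g o = c o}.
Proof.
move=> ce mc nc; have [/(msubE g sG) mg [IX [Ig _]]] := ce.
have nZ S : G S -> null P (fun o => \1_S o * (g o - c o)).
  move=> GS; apply: (null_ext (nullB (nc S GS) (cond_exp_null Gm ce GS))) => o; ring.
have IZ : integ P (fun o => g o - c o).
  have [I1 _] := nZ _ (sigma_algebra_setT sG).
  by move: I1; under eq_fun do rewrite indicT mul1r.
have := null_indic_ae0 sG Gm (msubB mg mc) IZ nZ.
by apply: filterS => o /eqP; rewrite subr_eq0 => /eqP.
Qed.

Lemma ae_matrix p q (g c : Om -> 'M[R]_(p, q)) :
  (forall i j, {ae P, forall o, g o i j = c o i j}) -> {ae P, forall o, g o = c o}.
Proof.
move=> gc.
have : \forall o \ae P, forall ij : 'I_p * 'I_q, g o ij.1 ij.2 = c o ij.1 ij.2.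
  by apply: filter_forall => -[i j]; exact: gc.
by apply: filterS => o e; apply/matrixP => i j; exact: (e (i, j)).
Qed.

Lemma cond_exp_nullv p (X g c : Om -> 'cV[R]_p) : cond_exp_mx P G X g ->
  msubmx G c -> nullv P G (fun o => X o - c o) -> {ae P, forall o, g o = c o}.
Proof.
move=> ce mc nc; apply: ae_matrix => i j; rewrite (ord1 j).
apply: (cond_exp_unique (ce i ord0) (mc i ord0)) => S GS.
apply: (null_ext (nc _ (bm_indic R sG GS) i)) => o.
by rewrite !mxE.
Qed.

Lemma cond_stein_nullv n (x c : Om -> 'cV[R]_n) (M : Om -> 'M[R]_n) :
  cond_stein P G x c M -> nullv P G (fun o => x o - c o).
Proof.
move=> sx; apply: (nullv_ext (sx 0 0)) => o.
by rewrite /steinv dotv0l addr0 cos0 sin0 scale0r addr0 scale1r.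
Qed.

(* Second moments come from Stein's identity along [a = e_j / N], [N -> oo]. *)
Lemma cond_stein_second n (x c : Om -> 'cV[R]_n) (M : Om -> 'M[R]_n) i j h :
  cond_stein P G x c M -> msubmx G c -> bm G (fun o => M o i j) ->
  integ P (fun o => (x o - c o) i ord0 * (x o - c o) j ord0) -> bm G h ->
  null P (fun o => h o * ((x o - c o) i ord0 * (x o - c o) j ord0 - M o i j)).
Proof.
move=> sx mc bM Ie bh; have [mh [B hB]] := bh.
pose e k o := (x o - c o) k ord0.
pose t (N : nat) : R := N.+1%:R^-1.
have mtc N : msub G (fun o => t N * c o j ord0).
  by apply: msubM; [exact: msub_cst|exact: mc].
pose F N o := h o * (e i o * (N.+1%:R * sin (e j o / N.+1%:R)) -
  M o i j * cos (e j o / N.+1%:R)).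
have nF N : null P (F N).
  (* The test functions involve [x], not [x - c]. As [c] is measurable for [G], the cosine and sine
     of [t N * c] go into [h], and the addition formulas recentre the phase. *)
  have s1 := sx (t N *: delta_mx j ord0) (pi / 2) _ (bmM bh (bm_cos (mtc N))) i.
  have s2 := sx (t N *: delta_mx j ord0) 0 _ (bmM bh (bm_sin (mtc N))) i.
  apply: (null_ext (nullZ (- N.+1%:R) (nullD s1 s2))) => o.
  rewrite /F /steinv -scalemxAr dotvZl dotv_delta addr0 cosDpihalf sinDpihalf.
  have MjE := mulmx_delta (M o) i j.
  have -> : e j o / N.+1%:R = t N * x o j ord0 - t N * c o j ord0.
    by rewrite /e !mxE /t; ring.
  move: MjE; move: (M o *m delta_mx j ord0) => r rE; rewrite /e.
  move: (x o - c o) => u; rewrite !mxE rE sinB cosB /t.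
  by field; rewrite nat1r.
have ID : integ P (fun o => B * (`|e i o * e j o| + `|M o i j|)).
  by apply: integZ; apply: integD; apply: integ_norm => //; exact: bm_integ bM.
apply: (null_lim nF ID) => [N o|o].
  rewrite /F normrM ler_pM// (le_trans (ler_normB _ _))// lerD//.
    by rewrite !normrM ler_wpM2l// -normrM sin_scaled_le.
  by rewrite normrM ler_piMr// cos_max.
apply: cvgM; first exact: cvg_cst.
apply: cvgB.
  by apply: cvgM; [exact: cvg_cst|exact: sin_scaled_cvg].
rewrite -[X in _ --> X]mulr1; apply: cvgM; first exact: cvg_cst.
rewrite -[X in _ --> X]cos0; apply: continuous_cvg; first exact: continuous_cos.
rewrite -(mulr0 (e j o)); apply: cvgM; [exact: cvg_cst|exact: cvg_harmonic].
Qed.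

(** The hypothesis on [D] centres at the version [g], Stein's identity at [c]. They agree almost
    surely, which also transfers the integrability of the second moments. *)
Lemma cond_stein_cov n (x c g : Om -> 'cV[R]_n) (M D : Om -> 'M[R]_n) :
  (forall i, measurable_fun setT (fun o => x o i ord0)) ->
  cond_stein P G x c M -> msubmx G c -> (forall i j, bm G (fun o => M o i j)) ->
  cond_exp_mx P G x g ->
  cond_exp_mx P G (fun o => (x o - g o) *m (x o - g o)^T) D ->
  {ae P, forall o, D o = M o}.
Proof.
move=> mx sx mc bM ceg ceD.
have gc := cond_exp_nullv ceg mc (cond_stein_nullv sx).
have me i : measurable_fun setT (fun o => (x o - c o) i ord0).
  under eq_fun do rewrite !mxE.
  by apply: measurable_funB => //; exact: msub_measurable (mc i ord0).
have outer (u : 'cV[R]_n) i j : (u *m u^T) i j = u i ord0 * u j ord0.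
  by rewrite mxE big_ord1 mxE.
apply: ae_matrix => i j; have ce := ceD i j.
have [mD [Ixx [ID _]]] := ce.
have Ie : integ P (fun o => (x o - c o) i ord0 * (x o - c o) j ord0).
  apply: (integ_ae Ixx); first exact: measurable_funM.
  by apply: filterS gc => o ->; rewrite outer.
apply: (cond_exp_unique ce (bM i j).1) => S GS.
have mS : measurable_fun setT (\1_S : Om -> R).
  by apply: measurable_indic; exact: Gm.
apply: (null_ae (cond_stein_second sx mc (bM i j) Ie (bm_indic R sG GS))).
  apply: measurable_funM => //; apply: measurable_funB.
    by apply: integ_measurable; exact: Ixx.
  exact: msub_measurable (bM i j).1.
by apply: filterS gc => o ->; rewrite outer.
Qed.

End Versions.

End ConditionalExpectation.

(** * The filter *)

Section Process.
Context (R : realType) (n m : nat) (d : measure_display)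
  (Om : measurableType d) (P : probability Om R)
  (A Q Sigma : 'M[R]_n) (C : 'M[R]_(m, n)) (Rv Y : 'M[R]_m)
  (x0 : Om -> 'cV[R]_n) (w : nat -> Om -> 'cV[R]_n) (v : nat -> Om -> 'cV[R]_m)
  (eta : nat -> Om -> bool) (zeta : nat -> Om -> R)
  (x : nat -> Om -> 'cV[R]_n) (y : nat -> Om -> 'cV[R]_m)
  (eps : nat -> Om -> bool).
Hypotheses (pQ : psd Q) (pRv : pd Rv) (pS : psd Sigma) (pY : pd Y).
Hypothesis mx0 : forall i : 'I_n, measurable_fun setT (fun o => x0 o i ord0).
Hypothesis mw : forall k (i : 'I_n), measurable_fun setT (fun o => w k o i ord0).
Hypothesis mv : forall k (i : 'I_m), measurable_fun setT (fun o => v k o i ord0).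
Hypothesis meta : forall k, measurable [set o | eta k o].
Hypothesis mzeta : forall k, measurable_fun setT (zeta k).
Hypothesis gx0 : gaussian0 P x0 Sigma.
Hypothesis gw : forall k, gaussian0 P (w k) Q.
Hypothesis gv : forall k, gaussian0 P (v k) Rv.
Hypothesis uzeta : forall k, uniform01 P (zeta k).
Hypothesis ind : mutually_independent P (src_sigma x0 w v eta zeta).
Hypothesis x0E : forall o, x 0%N o = x0 o.
Hypothesis xSE : forall k o, x k.+1 o = A *m x k o + w k o.
Hypothesis yE : forall k o, y k o = C *m x k o + v k o.
Hypothesis epsE : forall k o, eps k o =
  (expR (- (1 / 2) * ((y k o)^T *m Y *m y k o) ord0 ord0) < zeta k o).
Hypothesis Ix : forall k i, integ P (fun o => x k o i ord0).
Hypothesis Iy : forall k i, integ P (fun o => y k o i ord0).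

(** The Riccati recursion run along the observed [eta] and [eps]. It does not involve [y] otherwise,
    so at each time it takes finitely many values. *)
Fixpoint pred_cov k o : 'M[R]_n := if k is j.+1 then
  A *m post_cov (pred_cov j) C Rv Y (eta j) (eps j) o *m A^T + Q else Sigma.

Fixpoint pred_mean k o : 'cV[R]_n := if k is j.+1 then
  A *m post_mean (pred_mean j) (pred_cov j) (y j) C Rv Y (eta j) (eps j) o else 0.

Definition cur_mean k := post_mean (pred_mean k) (pred_cov k) (y k) C Rv Y (eta k) (eps k).

Definition cur_cov k := post_cov (pred_cov k) C Rv Y (eta k) (eps k).

Lemma pred_cov_psd k o : psd (pred_cov k o).
Proof.
elim: k => //= k IH; apply: psdD => //; apply: psd_conj.
exact: gain_psd.
Qed.

Let F := src_sigma x0 w v eta zeta.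
Let I k := info eta eps y k.

Let sigma_gen_sigma (fs : set (Om -> R)) : sigma_algebra setT (sigma_gen fs).
Proof. exact: smallest_sigma_algebra. Qed.

Let msub_sigma_gen (fs : set (Om -> R)) f : fs f -> msub (sigma_gen fs) f.
Proof.
move=> ff; apply/msubE => [//|B mB]; apply: sub_sigma_algebra.
by exists f, B.
Qed.

Let sigma_gen_sub (fs : set (Om -> R)) (G : set (set Om)) : sigma_algebra setT G ->
  (forall f, fs f -> msub G f) -> sigma_gen fs `<=` G.
Proof.
move=> sG fG; apply: smallest_sub => // _ [f [B [ff [mB ->]]]].
by move/(msubE f sG) : (fG f ff); exact.
Qed.

Let sF s : sigma_algebra setT (F s).
Proof. by case: s => [|k|k|k|k]; exact: sigma_gen_sigma. Qed.

Let msub_full (f : Om -> R) : measurable_fun setT f -> msub (@measurable d Om) f.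
Proof.
move=> mf; apply/msubE => [|B mB]; first exact: sigma_algebra_measurable.
by rewrite -[_ @^-1` _]setTI; exact: mf.
Qed.

Let Fm s : F s `<=` measurable.
Proof.
have sm := sigma_algebra_measurable Om.
case: s => [|k|k|k|k]; apply: sigma_gen_sub => // f.
- by move=> [i ->]; apply: msub_full.
- by move=> [i ->]; apply: msub_full.
- by move=> [i ->]; apply: msub_full.
- move=> ->; apply: msub_full.
  have -> : (fun o => (eta k o)%:R : R) = \1_[set o | eta k o].
    apply/funext => o; rewrite indicE; congr (nat_of_bool _)%:R.
    by apply/idP/idP => [e|]; rewrite inE.
  exact: measurable_indic.
- by move=> ->; apply: msub_full.
Qed.

(** Each head is independent of the block of its tail, so the order encodes the filter step: [v],
    then [zeta], then [eta], then [w]. *)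
Fixpoint sources k : seq src := if k is j.+1 then
  [:: Sw j, Seta j, Szeta j, Sv j & sources j] else [:: Sx0].

Let before k s := match s with
  Sx0 => true | Sw j | Sv j | Seta j | Szeta j => (j < k)%N end.

Let sources_before k s : s \in sources k -> before k s.
Proof.
elim: k => [|k IH] /=; first by rewrite inE => /eqP ->.
rewrite !inE => /or4P[/eqP->|/eqP->|/eqP->|/orP[/eqP->|/IH]] //=.
by case: s {IH} => //= j /ltnW.
Qed.

Let uniq_sources k : uniq (sources k).
Proof.
elim: k => //= k ->; rewrite !inE !andbT /=.
have no s : ~~ before k s -> s \notin sources k by apply: contra => /sources_before.
by rewrite !no/= ?ltnn.
Qed.

Let B J := block F J.

Let infoS k : I k `<=` I k.+1.
Proof.
apply: sub_sigma_algebra2 => _ [f [S [[j [jk fE]] [mS ->]]]].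
by exists f, S; split => //; exists j; split => //; exact: leq_trans jk _.
Qed.

Let meta_info k : msub (I k.+1) (fun o => (eta k o)%:R : R).
Proof. by apply: msub_sigma_gen; exists k; split => //; left. Qed.

Let meps_info k : msub (I k.+1) (fun o => (eta k o && eps k o)%:R : R).
Proof. by apply: msub_sigma_gen; exists k; split => //; right; left. Qed.

Let my_info k i : msub (I k.+1) (fun o => (eta k o && eps k o)%:R * y k o i ord0).
Proof. by apply: msub_sigma_gen; exists k; split => //; right; right; exists i. Qed.

Let sI k : sigma_algebra setT (I k). Proof. exact: sigma_gen_sigma. Qed.

(* Functions of the covariance are finite-valued, hence bounded and measurable:
   no measurability of matrix inversion is needed. *)
Let bm_case k (Fn : bool -> bool -> 'M[R]_n -> R) :
  (forall (H : 'M[R]_n -> R), bm (I k) (fun o => H (pred_cov k o))) ->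
  bm (I k.+1) (fun o => Fn (eta k o) (eta k o && eps k o) (pred_cov k o)).
Proof.
move=> IH; have bH (H : 'M[R]_n -> R) : bm (I k.+1) (fun o => H (pred_cov k o)).
  by apply: bmS (IH H); exact: infoS.
have b1 : bm (I k.+1) (fun o => (eta k o)%:R : R).
  by split => //; exists 1 => o; case: (eta k o); rewrite ?normr1 ?normr0.
have b2 : bm (I k.+1) (fun o => (eta k o && eps k o)%:R : R).
  by split => //; exists 1 => o; case: (_ && _); rewrite ?normr1 ?normr0.
have := bmD (bmD
  (bmM (bmD (bm_cst _ 1) (bmN b1)) (bH (Fn false false)))
  (bmM (bmD b1 (bmN b2)) (bH (Fn true false))))
  (bmM b2 (bH (Fn true true))).
congr (bm _ _); apply/funext => o.
by case: (eta k o); case: (eps k o) => /=; ring.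
Qed.

(** Only the product of [eta] and [eps] is revealed; without arrival the gain is 0, so [eps] can be
    replaced by that product and the gain is a function of the information. *)
Let gain_eps (a b : bool) (M : 'M[R]_n) :
  gain C Rv Y a b M = gain C Rv Y a (a && b) M.
Proof. by case: a => //; rewrite /gain !scale0r. Qed.

Let bm_pred_cov k (H : 'M[R]_n -> R) : bm (I k) (fun o => H (pred_cov k o)).
Proof.
elim: k H => [|k IH] H; first exact: (bm_cst _ (H Sigma)).
have := bm_case (fun a b M => H (A *m (M - gain C Rv Y a b M *m C *m M) *m A^T + Q)) IH.
congr (bm _ _); apply/funext => o /=.
by rewrite /post_cov (gain_eps (eta k o) (eps k o)).
Qed.

Let bm_cur_cov k i j : bm (I k.+1) (fun o => cur_cov k o i j).
Proof.
have := bm_case (fun a b M => (M - gain C Rv Y a b M *m C *m M) i j) (@bm_pred_cov k).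
congr (bm _ _); apply/funext => o /=.
by rewrite /cur_cov /post_cov (gain_eps (eta k o) (eps k o)).
Qed.

Let msubmx_cur_mean k : msubmx (I k) (pred_mean k) -> msubmx (I k.+1) (cur_mean k).
Proof.
move=> mc.
have bg p q (H : 'M[R]_(n, m) -> 'M[R]_(p, q)) : msubmx (I k.+1)
    (fun o => H (gain C Rv Y (eta k o) (eps k o) (pred_cov k o))).
  move=> i j; have [+ _] := bm_case (fun a b M => H (gain C Rv Y a b M) i j) (@bm_pred_cov k).
  congr (msub _ _); apply/funext => o /=.
  by rewrite (gain_eps (eta k o) (eps k o)).
(* The factor [eta] in the gain lets [y] enter only through the revealed product. *)
have -> : cur_mean k = (fun o =>
    (1%:M - gain C Rv Y (eta k o) (eps k o) (pred_cov k o) *m C) *m pred_mean k o +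
    gain C Rv Y (eta k o) (eps k o) (pred_cov k o) *m
      ((eta k o && eps k o)%:R *: y k o)).
  apply/funext => o; rewrite /cur_mean /post_mean; congr (_ + _).
  rewrite -scalemxAr; case: (eta k o) => //=.
  by rewrite /gain scale0r !mul0mx !scaler0.
apply: msubmxD; apply: msubmxM.
- exact: (bg _ _ (fun g => 1%:M - g *m C)).
- by move=> i j; apply: msubS (mc i j); exact: infoS.
- exact: (bg _ _ id).
- by move=> i j; rewrite (ord1 j); under eq_fun do rewrite mxE; exact: my_info.
Qed.

Let msubmx_pred_mean k : msubmx (I k) (pred_mean k).
Proof.
elim: k => [|k IH]; first exact: msubmx_cst.
apply: msubmxM; first exact: msubmx_cst.
exact: msubmx_cur_mean.
Qed.

Let msubmx_source p s (u : Om -> 'cV[R]_p) J :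
  (forall i, msub (F s) (fun o => u o i ord0)) -> s \in J -> msubmx (B J) u.
Proof.
move=> mu sJ i j; rewrite (ord1 j); apply: msubS (mu i).
exact: sub_block.
Qed.

Let mv_src k i : msub (F (Sv k)) (fun o => v k o i ord0).
Proof. by apply: msub_sigma_gen; exists i. Qed.

Let mw_src k i : msub (F (Sw k)) (fun o => w k o i ord0).
Proof. by apply: msub_sigma_gen; exists i. Qed.

Let mx0_src i : msub (F Sx0) (fun o => x0 o i ord0).
Proof. by apply: msub_sigma_gen; exists i. Qed.

Let mx_block k : msubmx (B (sources k)) (x k).
Proof.
elim: k => [|k IH].
  have -> : x 0 = x0 by apply/funext.
  by apply: (msubmx_source mx0_src); rewrite inE.
have -> : x k.+1 = (fun o => A *m x k o + w k o) by apply/funext.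
apply: msubmxD; last by apply: (@msubmx_source _ (Sw k) (w k)); [exact: mw_src|rewrite inE eqxx].
apply: msubmxM; first exact: msubmx_cst.
move=> i j; apply: msubS (IH i j); apply: block_mono => s sJ.
by rewrite !inE sJ !orbT.
Qed.

Let my_block k : msubmx (B (Sv k :: sources k)) (y k).
Proof.
have -> : y k = (fun o => C *m x k o + v k o) by apply/funext.
apply: msubmxD; last by apply: (@msubmx_source _ (Sv k) (v k)); [exact: mv_src|rewrite inE eqxx].
apply: msubmxM; first exact: msubmx_cst.
move=> i j; apply: msubS (mx_block i j); apply: block_mono => s sJ.
by rewrite !inE sJ !orbT.
Qed.

Let meta_src k : msub (F (Seta k)) (fun o => (eta k o)%:R : R).
Proof. exact: msub_sigma_gen. Qed.

Let mzeta_src k : msub (F (Szeta k)) (zeta k).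
Proof. exact: msub_sigma_gen. Qed.

Let sources_mono j k : (j <= k)%N -> {subset sources j <= sources k}.
Proof.
move=> jk; rewrite -(subnK jk) addnC; elim: (k - j)%N => [|i IH] s sJ.
  by rewrite addn0.
by rewrite addnS/= !inE IH ?orbT.
Qed.

(** What the information before time [k] may depend on. Leaving out the latest process noise [w]
    keeps it independent of that information in the time update. *)
Definition obs_sources k : seq src := if k is j.+1 then
  [:: Seta j, Szeta j, Sv j & sources j] else [::].

Let obs_sources_mono j k : (j < k)%N -> {subset obs_sources j.+1 <= obs_sources k}.
Proof.
case: k => // k; rewrite ltnS leq_eqVlt => /predU1P[->//|jk] s sJ.
have : s \in sources j.+1 by rewrite inE -/(obs_sources j.+1) sJ orbT.
by move/(sources_mono jk) => sk; rewrite !inE sk !orbT.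
Qed.

Let obs_sources_sub k : {subset obs_sources k <= sources k}.
Proof. by case: k => // k s sJ; rewrite inE -/(obs_sources k.+1) sJ orbT. Qed.

Let info_obs k : I k `<=` B (obs_sources k).
Proof.
apply: sigma_gen_sub => [|f [j [jk fE]]]; first exact: block_sigma_algebra.
have sub J : {subset J <= obs_sources j.+1} -> B J `<=` B (obs_sources k).
  by move=> JJ; apply: block_mono => s /JJ; exact: obs_sources_mono.
have me : msub (B (obs_sources k)) (fun o => (eta j o)%:R : R).
  apply: (@msubS _ _ _ (F (Seta j))); last exact: meta_src.
  apply: subset_trans (sub [:: Seta j] _).
    by apply: sub_block; rewrite inE.
  by move=> s; rewrite !inE => ->.
have my : msubmx (B (obs_sources k)) (y j).
  move=> i l; apply: msubS (@my_block j i l); apply: sub => s sJ.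
  by rewrite /obs_sources !inE; move: sJ; rewrite inE => ->; rewrite !orbT.
have mz : msub (B (obs_sources k)) (zeta j).
  apply: (@msubS _ _ _ (F (Szeta j))); last exact: mzeta_src.
  apply: subset_trans (sub [:: Szeta j] _).
    by apply: sub_block; rewrite inE.
  by move=> s; rewrite !inE => ->; rewrite !orbT.
have mp : msub (B (obs_sources k)) (fun o => (eps j o)%:R : R).
  under eq_fun do rewrite epsE; apply: msub_lt => //.
  apply: msub_expR; apply: msubM; first exact: msub_cst.
  under eq_fun do rewrite quadE; apply: msub_dotv => //.
  by apply: msubmxM => //; exact: msubmx_cst.
have mep : msub (B (obs_sources k)) (fun o => (eta j o && eps j o)%:R : R).
  have -> : (fun o => (eta j o && eps j o)%:R : R) =
      (fun o => (eta j o)%:R * (eps j o)%:R).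
    by apply/funext => o; case: (eta j o); rewrite ?mul1r ?mul0r.
  exact: msubM.
case: fE => [->//|[->//|[i ->]]].
by apply: msubM => //; exact: my.
Qed.

Let info_block k : I k `<=` B (sources k).
Proof.
by apply: subset_trans (@info_obs k) _; apply: block_mono; exact: obs_sources_sub.
Qed.

Let Bm J : B J `<=` measurable.
Proof. exact: block_measurable. Qed.

Let Im k : I k `<=` measurable.
Proof. exact: subset_trans (@info_block k) (@Bm (sources k)). Qed.

Let Bcons s J : B J `<=` B (s :: J).
Proof. by apply: block_mono => t tJ; rewrite inE tJ orbT. Qed.

Let FB s J : F s `<=` B (s :: J).
Proof. by apply: sub_block; rewrite inE eqxx. Qed.

Let uniq4 k : [/\ uniq (Sv k :: sources k), uniq [:: Szeta k, Sv k & sources k],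
  uniq [:: Seta k, Szeta k, Sv k & sources k] &
  uniq [:: Sw k, Seta k, Szeta k, Sv k & sources k]].
Proof.
have u := uniq_sources k.+1; split => //.
- by move: u => /= /and4P[_ _ _ ->].
- by move: u => /= /and4P[_ _ -> ->].
- by move: u => /= /and4P[_ -> -> ->].
Qed.

Let stein_v k := stein (mv k) (gv k) pRv.1.
Let stein_w k := stein (mw k) (gw k) pQ.1.

Lemma cond_stein_cur k : cond_stein P (I k) (x k) (pred_mean k) (pred_cov k) ->
  cond_stein P (I k.+1) (x k) (cur_mean k) (cur_cov k).
Proof.
move=> sx; have [u1 u2 u3 u4] := uniq4 k.
have i1 := block_indep sF Fm ind u1.
have i2 := block_indep sF Fm ind u2.
have i3 := block_indep sF Fm ind u3.
have mvS : msubmx (F (Sv k)) (v k) by move=> i j; rewrite (ord1 j); exact: mv_src.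
refine (cond_stein_span (@info_block k) (@Bcons _ _) (@Bcons _ _) (@Bm _) (@FB _ _)
  (@FB _ _) (@Fm _) i1 i2 i3 (@mx_block k) (@msubmx_pred_mean k) mvS (@mzeta_src k)
  (@meta_src k) (@bm_pred_cov k) (pred_cov_psd k) pRv pY (uzeta k) (stein_v k) sx (Ix k)
  (Iy k) (yE k) (epsE k) _).
move=> h; apply: span_sigma_gen.
- exact: info_test_bounded.
- exact: info_test_mul.
- by apply: span_info_test; exact: bm_cst.
move=> f [j [jk fE]] s a.
have [jk'|kj] := ltnP j k.
  apply: span_info_test; apply: bm_sin; apply: msubM; first exact: msub_cst.
  apply: msubB; last exact: msub_cst.
  by apply: msub_sigma_gen; exists j.
have jE : j = k by apply/eqP; rewrite eqn_leq kj andbT -ltnS.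
rewrite {}jE in fE.
(* Sine is written as cosine with phase lowered by [pi / 2]; for the two binary generators frequency
   0 makes the value on reception constant. *)
case: fE => [->|[->|[i ->]]].
- apply: (span_ext (span_info_test_case _ _ _ _ (sin (s * (0 - a))) (sin (s * (1 - a)))
    0 (s * (1 - a) - pi / 2))) => o.
  by rewrite dotv0l add0r cosBpihalf; case: (eta k o); case: (eps k o).
- apply: (span_ext (span_info_test_case _ _ _ _ (sin (s * (0 - a))) (sin (s * (0 - a)))
    0 (s * (1 - a) - pi / 2))) => o.
  by rewrite dotv0l add0r cosBpihalf; case: (eta k o); case: (eps k o).
- apply: (span_ext (span_info_test_case _ _ _ _ (sin (s * (0 - a))) (sin (s * (0 - a)))
    (s *: delta_mx i ord0) (- (s * a) - pi / 2))) => o.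
  rewrite dotvZl dotv_delta addrA cosBpihalf.
  case: (eta k o); case: (eps k o); rewrite /= ?mul0r// mul1r.
  by congr sin; ring.
Qed.

Lemma cond_stein_pred k : cond_stein P (I k) (x k) (pred_mean k) (pred_cov k).
Proof.
elim: k => [|k IH].
  have u0 : uniq [:: Sx0] by [].
  have i0 := block_indep sF Fm ind u0.
  have GK : I 0 `<=` B [::].
    apply: sigma_gen_sub => [|f [j []]//]; exact: block_sigma_algebra.
  (* The initial state is treated as a time update of the deterministic state 0, with [x0] as the
     noise. *)
  have s0 : cond_stein P (I 0) (fun=> 0 : 'cV[R]_n) (fun=> 0) (fun=> 0).
    move=> a th h bh i; apply: (null_ext (null0 P)) => o.
    by rewrite /steinv subrr mul0mx !scaler0 addr0 mxE mulr0.
  have mx0' : msubmx (F Sx0) x0 by move=> i j; rewrite (ord1 j); exact: mx0_src.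
  have := cond_stein_time GK (@Bm _) (@Fm _) i0 (@msubmx_cst _ _ _ _ _ _ 0)
    (@msubmx_cst _ _ _ _ _ _ 0) (@msubmx_cst _ _ _ _ _ _ 0) mx0'
    (stein mx0 gx0 pS.1) s0 0 1%:M.
  congr (cond_stein _ _ _ _ _); apply/funext => o /=.
  - by rewrite mul0mx add0r mul1mx x0E.
  - by rewrite mulmx0.
  - by rewrite !mul0mx add0r mul1mx trmx1 mulmx1.
have [_ _ _ u4] := uniq4 k; have i4 := block_indep sF Fm ind u4.
have GK : I k.+1 `<=` B [:: Seta k, Szeta k, Sv k & sources k] := @info_obs k.+1.
have mxK : msubmx (B [:: Seta k, Szeta k, Sv k & sources k]) (x k).
  move=> i j; apply: msubS (mx_block i j); apply: block_mono => s sJ.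
  by rewrite !inE sJ !orbT.
have mcK : msubmx (B [:: Seta k, Szeta k, Sv k & sources k]) (cur_mean k).
  by move=> i j; apply: msubS GK _; exact: msubmx_cur_mean.
have mMK : msubmx (B [:: Seta k, Szeta k, Sv k & sources k]) (cur_cov k).
  by move=> i j; apply: msubS GK _; exact: (bm_cur_cov k i j).1.
have mwS : msubmx (F (Sw k)) (w k) by move=> i j; rewrite (ord1 j); exact: mw_src.
have := cond_stein_time GK (@Bm _) (@Fm _) i4 mxK mcK mMK mwS (stein_w k)
  (cond_stein_cur IH) A 1%:M.
congr (cond_stein _ _ _ _ _); apply/funext => o /=.
- by rewrite mul1mx xSE.
- by rewrite mul1mx trmx1 mulmx1.
Qed.

Lemma pred_meanE k xm : cond_exp_mx P (I k) (x k) xm ->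
  {ae P, forall o, xm o = pred_mean k o}.
Proof.
move=> ce; apply: (cond_exp_nullv (sI k) (@Im k) ce (@msubmx_pred_mean k)).
exact: cond_stein_nullv (@cond_stein_pred k).
Qed.

Lemma pred_obsE k ym : cond_exp_mx P (I k) (y k) ym ->
  {ae P, forall o, ym o = C *m pred_mean k o}.
Proof.
move=> ce; have [u1 _ _ _] := uniq4 k; have i1 := block_indep sF Fm ind u1.
have mvS : msubmx (F (Sv k)) (v k) by move=> i j; rewrite (ord1 j); exact: mv_src.
apply: (cond_exp_nullv (sI k) (@Im k) ce).
  by apply: msubmxM; [exact: msubmx_cst|exact: msubmx_pred_mean].
exact: (innovation_nullv (@info_block k) (@Bcons _ _) (fun _ => id) (@Bm _) (@FB _ _) i1
  (@mx_block k) (@msubmx_pred_mean k) mvS (@bm_pred_cov k) (stein_v k)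
  (@cond_stein_pred k) (yE k)).
Qed.

Lemma pred_covE k xm Pm : cond_exp_mx P (I k) (x k) xm ->
  cond_exp_mx P (I k) (fun o => (x k o - xm o) *m (x k o - xm o)^T) Pm ->
  {ae P, forall o, Pm o = pred_cov k o}.
Proof.
apply: cond_stein_cov; [exact: sI|exact: Im| |exact: cond_stein_pred| |].
- by move=> i; exact: integ_measurable (Ix k i).
- exact: msubmx_pred_mean.
- by move=> i j; exact: (bm_pred_cov k (fun M => M i j)).
Qed.

Lemma cur_meanE k xh : cond_exp_mx P (I k.+1) (x k) xh ->
  {ae P, forall o, xh o = cur_mean k o}.
Proof.
move=> ce; apply: (cond_exp_nullv (sI k.+1) (@Im k.+1) ce).
  by apply: msubmx_cur_mean; exact: msubmx_pred_mean.
exact: cond_stein_nullv (cond_stein_cur (@cond_stein_pred k)).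
Qed.

Lemma cur_covE k xh Ph : cond_exp_mx P (I k.+1) (x k) xh ->
  cond_exp_mx P (I k.+1) (fun o => (x k o - xh o) *m (x k o - xh o)^T) Ph ->
  {ae P, forall o, Ph o = cur_cov k o}.
Proof.
apply: cond_stein_cov; [exact: sI|exact: Im| | | |].
- by move=> i; exact: integ_measurable (Ix k i).
- by apply: cond_stein_cur; exact: cond_stein_pred.
- by apply: msubmx_cur_mean; exact: msubmx_pred_mean.
- exact: bm_cur_cov.
Qed.

End Process.

Unset Implicit Arguments.

Theorem theorem1 (R : realType) (n m : nat) (d : measure_display)
  (Om : measurableType d) (P : probability Om R)
  (A Q Sigma : 'M[R]_n) (C : 'M[R]_(m, n)) (Rv Y : 'M[R]_m) (lam : R)
  (x0 : Om -> 'cV[R]_n) (w : nat -> Om -> 'cV[R]_n) (v : nat -> Om -> 'cV[R]_m)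
  (eta : nat -> Om -> bool) (zeta : nat -> Om -> R)
  (x : nat -> Om -> 'cV[R]_n) (y : nat -> Om -> 'cV[R]_m)
  (eps : nat -> Om -> bool)
  (xm xh : nat -> Om -> 'cV[R]_n) (ym : nat -> Om -> 'cV[R]_m)
  (Pm Ph : nat -> Om -> 'M[R]_n) :
  (* system data *)
  spectral_radius_lt1 A -> psd Q -> pd Rv ->
  psd Sigma -> Sigma = A *m Sigma *m A^T + Q ->
  pd Y -> 0 < lam <= 1 ->
  (* primitive random objects are random variables *)
  (forall i : 'I_n, measurable_fun setT (fun o => x0 o i ord0)) ->
  (forall k (i : 'I_n), measurable_fun setT (fun o => w k o i ord0)) ->
  (forall k (i : 'I_m), measurable_fun setT (fun o => v k o i ord0)) ->
  (forall k, measurable [set o | eta k o]) ->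
  (forall k, measurable_fun setT (zeta k)) ->
  (* distributions *)
  gaussian0 P x0 Sigma ->
  (forall k, gaussian0 P (w k) Q) ->
  (forall k, gaussian0 P (v k) Rv) ->
  (forall k, P [set o | eta k o] = lam%:E) ->
  (forall k, uniform01 P (zeta k)) ->
  (* x0, w_k, v_k, eta_k, zeta_k all mutually independent *)
  mutually_independent P (src_sigma x0 w v eta zeta) ->
  (* process and scheduler *)
  (forall o, x 0%N o = x0 o) ->
  (forall k o, x k.+1 o = A *m x k o + w k o) ->
  (forall k o, y k o = C *m x k o + v k o) ->
  (forall k o, eps k o =
     (expR (- (1 / 2) * ((y k o)^T *m Y *m y k o) ord0 ord0) < zeta k o)) ->
  (* conditional expectations / covariances (info k = sigma(I_{k-1})) *)
  (forall k, cond_exp_mx P (info eta eps y k) (x k) (xm k)) ->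
  (forall k, cond_exp_mx P (info eta eps y k) (y k) (ym k)) ->
  (forall k, cond_exp_mx P (info eta eps y k.+1) (x k) (xh k)) ->
  (forall k, cond_exp_mx P (info eta eps y k)
               (fun o => (x k o - xm k o) *m (x k o - xm k o)^T) (Pm k)) ->
  (forall k, cond_exp_mx P (info eta eps y k.+1)
               (fun o => (x k o - xh k o) *m (x k o - xh k o)^T) (Ph k)) ->
  {ae P, forall o,
    xm 0%N o = 0 /\ Pm 0%N o = Sigma /\
    forall k,
      let K := gain C Rv Y (eta k o) (eps k o) (Pm k o) in
      xh k o = xm k o + (eps k o)%:R *: (K *m y k o) - K *m ym k o /\
      xh k o = (1%:M - K *m C) *m xm k o + (eps k o)%:R *: (K *m y k o) /\
      Ph k o = Pm k o - K *m C *m Pm k o /\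
      xm k.+1 o = A *m xh k o /\
      Pm k.+1 o = A *m Ph k o *m A^T + Q}.
Proof.
move=> _ pQ pRv pS _ pY _ mx0 mw mv meta mzeta gx0 gw gv _ uz ind x0E xSE yE epsE
  cexm ceym cexh cePm cePh.
have Ix k i : integ P (fun o => x k o i ord0) by have [_ []] := cexm k i ord0.
have Iy k i : integ P (fun o => y k o i ord0) by have [_ []] := ceym k i ord0.
pose c := pred_mean A Q Sigma C Rv Y eta y eps.
pose M := pred_cov A Q Sigma C Rv Y eta eps.
(* A countable intersection puts the identities for all times outside one null set; the rest is a
   pathwise computation. *)
have all_k : {ae P, forall o, forall k, [/\ xm k o = c k o,
    ym k o = C *m c k o, Pm k o = M k o,
    xh k o = cur_mean A Q Sigma C Rv Y eta y eps k o &
    Ph k o = cur_cov A Q Sigma C Rv Y eta eps k o]}.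
  apply/ae_foralln => k.
  have e1 := pred_meanE pQ pRv pS pY mx0 mw mv meta mzeta gx0 gw gv uz ind x0E xSE yE
    epsE Ix Iy (cexm k).
  have e2 := pred_obsE pQ pRv pS pY mx0 mw mv meta mzeta gx0 gw gv uz ind x0E xSE yE
    epsE Ix Iy (ceym k).
  have e3 := pred_covE pQ pRv pS pY mx0 mw mv meta mzeta gx0 gw gv uz ind x0E xSE yE
    epsE Ix Iy (cexm k) (cePm k).
  have e4 := cur_meanE pQ pRv pS pY mx0 mw mv meta mzeta gx0 gw gv uz ind x0E xSE yE
    epsE Ix Iy (cexh k).
  have e5 := cur_covE pQ pRv pS pY mx0 mw mv meta mzeta gx0 gw gv uz ind x0E xSE yE
    epsE Ix Iy (cexh k) (cePh k).
  apply: filterS (filterI e1 (filterI e2 (filterI e3 (filterI e4 e5)))).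
  by move=> o [? [? [? []]]].
apply: filterS all_k => o H.
have [-> _ -> _ _] := H 0%N; split=> [//|]; split=> [//|k].
set K := gain C Rv Y (eta k o) (eps k o) (Pm k o).
have [xmE ymE PmE xhE PhE] := H k; have [xmS _ PmS _ _] := H k.+1.
have KE : K = gain C Rv Y (eta k o) (eps k o) (M k o) by rewrite /K PmE.
have xhE' : xh k o = (1%:M - K *m C) *m xm k o + (eps k o)%:R *: (K *m y k o).
  by rewrite xhE KE xmE.
split; last split => //; last split; last split.
- rewrite xhE' ymE xmE mulmxBl mul1mx mulmxA.
  by rewrite addrAC.
- by rewrite PhE KE PmE.
- by rewrite xmS xhE.
- by rewrite PmS PhE.
Qed.
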